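(* Let $0<c_*\le c^*$, $0<\delta<1<A_*<A^*$ and $v_0>1$ be fixed constants. Suppose $X\in\mathbb R^{n\times p}$ has i.i.d. rows with $\mathbb EX=0$, $\mathbb E(X^TX/n)=\Sigma$ with all eigenvalues of $\Sigma$ in $[c_*,c^*]$, and $$\sup_{b\ne0}\ \mathbb E\exp\Big(\frac{(e_i^TXb)^2}{v_0\,b^T\Sigma b}+\frac1{v_0}\Big)\le2,$$ where $e_i$ is the $i$-th canonical unit vector of $\mathbb R^n$. Suppose $y-X\beta^*\sim N_n(0,\sigma^2I_n)$, independent of $X$, let $\sigma^*=\|y-X\beta^*\|_2/\sqrt n$, and let $\{\hat\beta,\hat\sigma\}$ be a solution of $$\min_{\beta,\sigma}\Big\{\frac{\|y-X\beta\|_2^2}{2n\sigma}+\frac\sigma2+\sum_{j=1}^M\omega_j\|\beta_{G_j}\|_2\Big\}$$ with $$\omega_j/A^*\le\|X_{G_j}\|_S\big\{\sqrt{|G_j|}+\sqrt{2\log(M/\delta)}\big\}/n\le\omega_j/A_*\quad\text{for all }j.$$ Suppose $\mathrm{supp}(\beta^* )\subseteq G_{S^*}$ for some $S^*\subset\{1,\dots,M\}$ with $$\max_{1\le j\le M}\big(|G_j|+\log(M/\delta)\big)I_{\{|S^*|>0\}}+|G_{S^*}|+|S^*|\log(M/\delta)\le a_0n .$$ Then there exist constants $a_*$ and $C$ depending on $\{c_*,c^*,A_*,A^*\}$ only such that, with probability at least $1-\delta$, $$\max\Big\{\Big|1-\frac{\hat\sigma}{\sigma^*}\Big|,\ \frac{\|X\hat\beta-X\beta^*\|_2^2}{n\sigma^2},\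 \sum_{j=1}^M\frac{\|\hat\beta_{G_j}-\beta^*_{G_j}\|_2}{\sigma/\omega_j},\ \sum_{j=1}^M\frac{\|X_{G_j}(\hat\beta_{G_j}-\beta_{G_j}^* )\|_2}{n^{1/2}\sigma/\omega_j}\Big\}\le\frac{C\{|G_{S^*}|+|S^*|\log(M/\delta)\}}{n}$$ whenever $a_0\le a_*$.
   Context: Model: $y=X\beta^*+\varepsilon$ with $\beta^*\in\mathbb R^p$, $\sigma>0$. The index set $\{1,\dots,p\}$ is partitioned into given disjoint groups $G_1,\dots,G_M$; $G_T=\bigcup_{j\in T}G_j$ for $T\subset\{1,\dots,M\}$. $u_A$ and $X_A$ denote the subvector of $u$ and the column submatrix of $X$ indexed by $A$; $\|\cdot\|_S$ is the spectral norm. The sub-Gaussian constant $v_0$ is regarded as fixed throughout, so the constants $a_*$ and $C$ are chosen after $v_0$ is fixed. *)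

(* Defs.v *)
From HB Require Import structures.
From mathcomp Require Export all_boot all_order all_algebra.
From mathcomp Require Export all_classical all_reals all_analysis.
Export Order.TTheory GRing.Theory Num.Theory.
Export numFieldNormedType.Exports.

Set Implicit Arguments.
Unset Strict Implicit.
Unset Printing Implicit Defensive.

Global Open Scope classical_set_scope.
Global Open Scope ring_scope.

(* Matrices carry the sigma-algebra generated by their entries, as the library
   does for tuples; it is the Borel sigma-algebra of R^(m x n). *)
Section measurable_matrix.
Context (R : realType) (m n : nat).

Definition entry_cylinders : set (set 'M[R]_(m, n)) :=
  [set A | exists i j (B : set R),
     measurable B /\ A = (fun M : 'M[R]_(m, n) => M i j) @^-1` B].

Let mx_set0 : <<s entry_cylinders >> set0.
Proof. exact: sigma_algebra0. Qed.

Let mx_setC A : <<s entry_cylinders >> A -> <<s entry_cylinders >> (~` A).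
Proof. exact: sigma_algebraC. Qed.

Let mx_bigcup (F : (set 'M[R]_(m, n))^nat) :
  (forall i, <<s entry_cylinders >> (F i)) ->
  <<s entry_cylinders >> (\bigcup_i F i).
Proof. exact: sigma_algebra_bigcup. Qed.

HB.instance Definition _ := @isMeasurable.Build (sigma_display entry_cylinders)
  'M[R]_(m, n) <<s entry_cylinders >> mx_set0 mx_setC mx_bigcup.

End measurable_matrix.

Section probability_notions.
Context d (T : measurableType d) (R : realType) (P : probability T R).

Definition independent_pair d1 d2 (U : measurableType d1)
    (V : measurableType d2) (X : T -> U) (Y : T -> V) : Prop :=
  forall A B, measurable A -> measurable B ->
    P (X @^-1` A `&` Y @^-1` B) = (P (X @^-1` A) * P (Y @^-1` B))%E.

Definition mutually_independent d1 (U : measurableType d1) n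
    (X : 'I_n -> T -> U) : Prop :=
  forall (J : {set 'I_n}) (A : 'I_n -> set U), (forall i, measurable (A i)) ->
    P (\bigcap_(i in [set i | i \in J]) (X i @^-1` A i)) =
    (\prod_(i in J) P (X i @^-1` A i))%E.

Definition identically_distributed d1 (U : measurableType d1) n
    (X : 'I_n -> T -> U) : Prop :=
  forall i k (A : set U), measurable A -> P (X i @^-1` A) = P (X k @^-1` A).

Definition iid_rows n p (X : T -> 'M[R]_(n, p)) : Prop :=
  let rows (i : 'I_n) (w : T) := row i (X w) in
  mutually_independent rows /\ identically_distributed rows.

(* The law N_n(0, sigma^2 I_n); normal_prob takes the standard deviation. *)
Definition isotropic_gaussian n (sigma : R) (e : T -> 'cV[R]_n) : Prop :=
  let coords (i : 'I_n) (w : T) := e w i 0 in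
  mutually_independent coords /\
  forall i (B : set R), measurable B ->
    P (coords i @^-1` B) = normal_prob 0 sigma B.

Definition sub_gaussian_rows n p (v0 : R) (Sigma : 'M[R]_p)
    (X : T -> 'M[R]_(n, p)) : Prop :=
  forall i : 'I_n,
    let Z (b : 'cV[R]_p) (w : T) :=
      ((X w *m b) i 0) ^+ 2 / (v0 * (b^T *m Sigma *m b) 0 0) + v0^-1 in
    (ereal_sup [set 'E_P[fun w => expR (Z b w)] |
                b in [set b : 'cV[R]_p | (b != 0)%R]] <= 2%:E)%E.

End probability_notions.

Section group_lasso.
Context (R : realType) (n p M : nat).

Definition l2norm k (u : 'cV[R]_k) : R := Num.sqrt (\sum_i u i 0 ^+ 2).

Definition spectral_norm k l (A : 'M[R]_(k, l)) : R :=
  sup [set l2norm (A *m u) | u in [set u : 'cV[R]_l | l2norm u <= 1]].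

Definition subvec (A : {set 'I_p}) (u : 'cV[R]_p) : 'cV[R]_#|A| :=
  rowsub (enum_val : 'I_#|A| -> 'I_p) u.

Definition subcols (A : {set 'I_p}) (X : 'M[R]_(n, p)) : 'M[R]_(n, #|A|) :=
  colsub (enum_val : 'I_#|A| -> 'I_p) X.

Definition is_grouping (G : 'I_M -> {set 'I_p}) : Prop :=
  (forall j k, j <> k -> (G j :&: G k)%SET = finset.set0) /\
  (\bigcup_(j < M) G j)%SET = [set: 'I_p]%SET.

Definition group_union (G : 'I_M -> {set 'I_p}) (S : {set 'I_M}) : {set 'I_p} :=
  (\bigcup_(j in S) G j)%SET.

Definition scaled_group_lasso_loss (G : 'I_M -> {set 'I_p}) (omega : 'I_M -> R)
    (X : 'M[R]_(n, p)) (y : 'cV[R]_n) (b : 'cV[R]_p) (s : R) : R :=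
  l2norm (y - X *m b) ^+ 2 / (2 * n%:R * s) + s / 2
  + \sum_(j < M) omega j * l2norm (subvec (G j) b).

(* The minimisation is over b in R^p and s > 0. *)
Definition scaled_group_lasso_solution (G : 'I_M -> {set 'I_p})
    (omega : 'I_M -> R) (X : 'M[R]_(n, p)) (y : 'cV[R]_n)
    (bh : 'cV[R]_p) (sh : R) : Prop :=
  0 < sh /\
  forall b s, 0 < s -> scaled_group_lasso_loss G omega X y bh sh
                    <= scaled_group_lasso_loss G omega X y b s.

End group_lasso.

(* Main.v *)
From HB Require Import structures.
Require Import Defs.
From mathcomp Require Import measurable_realfun ring lra.

(* Minimising over the scale turns the problem into the square-root group lasso.
   On the event that every |X_{G_j}^T eps| is at most eta n^{1/2} omega_j |eps| with
   eta < 1, the error h lies in a cone; comparing the residual norms, any inequality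
   sum_j omega_j |h_{G_j}| <= K |X h| / n^{1/2} with 2 K^2 <= 1 bounds the four
   quantities by a multiple of K^2.

   Conditionally on X, the noise event fails with probability at most q delta, where
   q < 1 depends on A_ only: decoupling with an independent copy of the noise gives
   P(n^{1/2} |A^T eps| > A' (k^{1/2} + (2L)^{1/2}) |A| |eps|) <= exp(-L - (A'-1)^2/2).

   The compatibility inequality with K^2 of order s/n follows from upper and lower bounds
   for |X u| over all u supported on groups of total weight sum (|G_j| + L) <= kappa n
   (Chernoff bounds on an integer lattice net), extended to the cone by shelling h into
   blocks of groups with decreasing |h_{G_j}| / (|G_j| + L)^{1/2}. This costs a
   probability exp(-c n), paid by the slack (1 - q) delta: if G_S is nonempty the
   sparsity condition forces L <= a0 n and 1 <= a0 n, hence delta >= exp(-a0 n). If G_S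
   is empty, then beta = 0 and the four quantities vanish on the noise event alone. *)

Set Implicit Arguments.
Unset Strict Implicit.
Unset Printing Implicit Defensive.

(** * Euclidean and spectral norms *)

Section euclidean_norm.
Context (R : realType).

(** The confidence is exactly 1 - delta and the weights contain exactly log(M/delta), so the union
    over groups may not lose a constant. The only slack is the gap between 1 and A_*, and it is
    spent three times: on a failure factor below one, on testing spectral norms along integer
    directions, and on eta < 1.

    The noise bound is self-normalised, |A^T eps| against |eps|, because the scale is estimated
    along with beta. The level sigma enters the final bounds only through the upper bound |eps|^2 <=
    4 n sigma^2, which replaces the empirical noise level by sigma.

    The weight |G_j| + L has two roles. In the net, exp(-L) <= 1/M pays for the choice of a group
    and |G_j| for the lattice points on it. In the shelling, its square root is of the order of
    n^{1/2} omega_j, so one budget kappa n governs both the sparse bounds and the cone. *)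

Definition dotp k (u v : 'cV[R]_k) : R := \sum_i u i 0 * v i 0.

Lemma dotpE k (u v : 'cV[R]_k) : dotp u v = (u^T *m v) 0 0.
Proof. by rewrite mxE; apply: eq_bigr => i _; rewrite mxE. Qed.

Lemma dotpC k (u v : 'cV[R]_k) : dotp u v = dotp v u.
Proof. by apply: eq_bigr => i _; rewrite mulrC. Qed.

Lemma dotpDl k (u v w : 'cV[R]_k) : dotp (u + v) w = dotp u w + dotp v w.
Proof. by rewrite -big_split; apply: eq_bigr => i _; rewrite mxE mulrDl. Qed.

Lemma dotpDr k (u v w : 'cV[R]_k) : dotp w (u + v) = dotp w u + dotp w v.
Proof. by rewrite dotpC dotpDl !(dotpC w). Qed.

Lemma dotpZl k a (u v : 'cV[R]_k) : dotp (a *: u) v = a * dotp u v.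
Proof. by rewrite mulr_sumr; apply: eq_bigr => i _; rewrite mxE mulrA. Qed.

Lemma dotpZr k a (u v : 'cV[R]_k) : dotp u (a *: v) = a * dotp u v.
Proof. by rewrite dotpC dotpZl dotpC. Qed.

Lemma dotp_suml k (I : Type) (r : seq I) (F : I -> 'cV[R]_k) v :
  dotp (\sum_(i <- r) F i) v = \sum_(i <- r) dotp (F i) v.
Proof.
elim/big_rec2 : _ => [|i x y _ <-]; last by rewrite dotpDl.
by rewrite /dotp big1// => i _; rewrite mxE mul0r.
Qed.

Lemma dotp_mull k l (A : 'M[R]_(k, l)) u v : dotp (A *m u) v = dotp u (A^T *m v).
Proof. by rewrite !dotpE trmx_mul mulmxA. Qed.

Lemma l2norm_ge0 k (u : 'cV[R]_k) : 0 <= l2norm u.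
Proof. exact: sqrtr_ge0. Qed.

Lemma sqr_l2norm k (u : 'cV[R]_k) : l2norm u ^+ 2 = \sum_i u i 0 ^+ 2.
Proof. by rewrite sqr_sqrtr// sumr_ge0// => i _; rewrite sqr_ge0. Qed.

Lemma sqr_l2norm_dotp k (u : 'cV[R]_k) : l2norm u ^+ 2 = dotp u u.
Proof. by rewrite sqr_l2norm; apply: eq_bigr => i _; rewrite expr2. Qed.

Lemma l2norm0 k : l2norm (0 : 'cV[R]_k) = 0.
Proof. by rewrite /l2norm big1 ?sqrtr0// => i _; rewrite mxE expr0n. Qed.

Lemma l2normZ k a (u : 'cV[R]_k) : l2norm (a *: u) = `|a| * l2norm u.
Proof.
rewrite -[LHS]ger0_norm ?l2norm_ge0// -[l2norm u]ger0_norm ?l2norm_ge0// -normrM.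
apply/eqP; rewrite -(@eqrXn2 _ 2)// !real_normK ?num_real//; apply/eqP.
by rewrite exprMn !sqr_l2norm_dotp dotpZl dotpZr mulrA expr2.
Qed.

Lemma l2normN k (u : 'cV[R]_k) : l2norm (- u) = l2norm u.
Proof. by rewrite -scaleN1r l2normZ normrN1 mul1r. Qed.

Lemma l2norm_eq0 k (u : 'cV[R]_k) : (l2norm u == 0) = (u == 0).
Proof.
apply/idP/eqP => [|->]; last by rewrite l2norm0.
rewrite -sqrf_eq0 sqr_l2norm psumr_eq0 => [/allP h|i _]; last exact: sqr_ge0.
apply/colP => i; rewrite mxE; apply/eqP; rewrite -sqrf_eq0.
by apply: h; rewrite mem_index_enum.
Qed.

Lemma cauchy_schwarz k (u v : 'cV[R]_k) : dotp u v <= l2norm u * l2norm v.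
Proof.
have [->|v0] := eqVneq v 0.
  by rewrite l2norm0 mulr0 /dotp big1// => i _; rewrite mxE mulr0.
have v2 : 0 < l2norm v ^+ 2.
  by rewrite exprn_even_gt0//= l2norm_eq0.
case: (lerP (dotp u v) 0) => uv.
  by rewrite (le_trans uv)// mulr_ge0// l2norm_ge0.
rewrite -(@ler_pXn2r _ 2)// ?nnegrE ?mulr_ge0 ?l2norm_ge0 ?(ltW uv)// exprMn.
have := sqr_ge0 (l2norm (l2norm v ^+ 2 *: u + - dotp u v *: v)).
rewrite [X in 0 <= X]sqr_l2norm_dotp !(dotpDl, dotpDr, dotpZl, dotpZr).
rewrite (dotpC v u) -!sqr_l2norm_dotp => h.
rewrite -subr_ge0 -(pmulr_rge0 _ v2).
move: h; set a := l2norm v ^+ 2; set b := l2norm u ^+ 2; set c := dotp u v.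
nra.
Qed.

Lemma normr_dotp_le k (u v : 'cV[R]_k) : `|dotp u v| <= l2norm u * l2norm v.
Proof.
rewrite ler_norml cauchy_schwarz andbT lerNl.
rewrite -[X in X <= _]mulN1r -dotpZl scaleN1r.
by apply: le_trans (cauchy_schwarz _ _) _; rewrite l2normN.
Qed.

Lemma l2normD k (u v : 'cV[R]_k) : l2norm (u + v) <= l2norm u + l2norm v.
Proof.
rewrite -(@ler_pXn2r _ 2)// ?nnegrE ?addr_ge0 ?l2norm_ge0//.
rewrite sqr_l2norm_dotp !(dotpDl, dotpDr) (dotpC v u) -!sqr_l2norm_dotp.
have := cauchy_schwarz u v; rewrite sqrrD; lra.
Qed.

Lemma l2normB_ge k (u v : 'cV[R]_k) : l2norm u - l2norm v <= l2norm (u - v).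
Proof. by rewrite lerBlDr (le_trans _ (l2normD _ _))// subrK. Qed.

(** The Frobenius norm is a crude bound, but it makes the supremum in [spectral_norm] genuine: on an
    unbounded set [sup] would take a default value. *)
Lemma l2norm_mul_bound k l (A : 'M[R]_(k, l)) :
  exists2 F : R, 0 <= F & forall u, l2norm (A *m u) <= F * l2norm u.
Proof.
exists (Num.sqrt (\sum_i l2norm (row i A)^T ^+ 2)); first exact: sqrtr_ge0.
move=> u.
rewrite -(@ler_pXn2r _ 2)// ?nnegrE ?mulr_ge0 ?l2norm_ge0 ?sqrtr_ge0// exprMn.
rewrite (sqr_l2norm (A *m u)) sqr_sqrtr; last first.
  by apply: sumr_ge0 => i _; rewrite sqr_ge0.
rewrite mulr_suml; apply: ler_sum => i _.
rewrite -exprMn -ler_sqrt; last by rewrite exprn_even_ge0.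
rewrite !sqrtr_sqr [X in _ <= X]ger0_norm ?mulr_ge0 ?l2norm_ge0//.
rewrite (le_trans _ (normr_dotp_le _ _))// le_eqVlt; apply/orP; left; apply/eqP.
by congr (`|_|); rewrite mxE; apply: eq_bigr => j _; rewrite !mxE.
Qed.

Lemma spectral_norm_has_sup k l (A : 'M[R]_(k, l)) :
  has_sup [set l2norm (A *m u) | u in [set u : 'cV[R]_l | l2norm u <= 1]].
Proof.
split; first by exists (l2norm (A *m 0)), 0 => //=; rewrite l2norm0.
have [F F0 hF] := l2norm_mul_bound A.
by exists F => _ [u /= u1 <-]; rewrite (le_trans (hF u))// ler_piMr.
Qed.

Lemma spectral_norm_ge0 k l (A : 'M[R]_(k, l)) : 0 <= spectral_norm A.
Proof.
apply: ub_le_sup; first by case: (spectral_norm_has_sup A).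
by exists 0; rewrite /= ?l2norm0 ?mulmx0 ?l2norm0.
Qed.

Lemma l2norm_spectral k l (A : 'M[R]_(k, l)) u :
  l2norm (A *m u) <= spectral_norm A * l2norm u.
Proof.
have [->|u0] := eqVneq u 0; first by rewrite mulmx0 !l2norm0 mulr0.
have u0' : 0 < l2norm u by rewrite lt0r l2norm_ge0 l2norm_eq0 u0.
rewrite -ler_pdivrMr//; apply: ub_le_sup; first by case: (spectral_norm_has_sup A).
exists ((l2norm u)^-1 *: u) => /=.
  by rewrite l2normZ ger0_norm ?invr_ge0 ?l2norm_ge0// mulVf ?gt_eqF.
by rewrite -scalemxAr l2normZ ger0_norm ?invr_ge0 ?l2norm_ge0// mulrC.
Qed.

Lemma spectral_norm_le k l (A : 'M[R]_(k, l)) (c : R) : 0 <= c ->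
  (forall u, l2norm (A *m u) <= c * l2norm u) -> spectral_norm A <= c.
Proof.
move=> c0 h; apply: ge_sup; first by case: (spectral_norm_has_sup A).
by move=> _ [u /= u1 <-]; rewrite (le_trans (h u))// ler_piMr.
Qed.

(** |A^T u|^2 = <u, A A^T u> <= |u| |A| |A^T u|, then division by |A^T u|. *)
Lemma spectral_norm_tr k l (A : 'M[R]_(k, l)) (u : 'cV[R]_k) :
  l2norm (A^T *m u) <= spectral_norm A * l2norm u.
Proof.
have := sqr_l2norm_dotp (A^T *m u); rewrite dotp_mull trmxK => h.
have := cauchy_schwarz u (A *m (A^T *m u)); rewrite -h => {}h.
have h2 := l2norm_spectral A (A^T *m u).
have := l2norm_ge0 (A^T *m u); rewrite le_eqVlt => /predU1P[<-|p].
  by rewrite mulr_ge0 ?spectral_norm_ge0 ?l2norm_ge0.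
rewrite -(ler_pM2r p) -expr2 (le_trans h)//.
by rewrite mulrAC mulrC ler_wpM2r ?l2norm_ge0.
Qed.

End euclidean_norm.

(** * Restriction of vectors to coordinate sets and groups *)

Section groups.
Context (R : realType) (p M : nat) (G : 'I_M -> {set 'I_p}).

Implicit Types (A B : {set 'I_p}) (u v : 'cV[R]_p).

(** Zeroing outside [A] stays in dimension [p], whereas [subvec A] changes the dimension with [A];
    pieces on different groups can thus be added. *)
Definition restr (A : {set 'I_p}) (u : 'cV[R]_p) : 'cV[R]_p :=
  \col_i (if i \in A then u i 0 else 0).

Lemma restrD A u v : restr A (u + v) = restr A u + restr A v.
Proof. by apply/colP => i; rewrite !mxE; case: ifP; rewrite ?addr0. Qed.

Lemma restrZ A a u : restr A (a *: u) = a *: restr A u.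
Proof. by apply/colP => i; rewrite !mxE; case: ifP; rewrite ?mulr0. Qed.

Lemma restrB A u v : restr A (u - v) = restr A u - restr A v.
Proof. by rewrite -scaleN1r restrD restrZ scaleN1r. Qed.

Lemma restr_id A u : (forall i, i \notin A -> u i 0 = 0) -> restr A u = u.
Proof.
by move=> h; apply/colP => i; rewrite !mxE; case: ifPn => // /h ->.
Qed.

Lemma restr_notin A u i : i \notin A -> restr A u i 0 = 0.
Proof. by move=> iA; rewrite mxE (negbTE iA). Qed.

Lemma sqr_l2norm_restr A u :
  l2norm (restr A u) ^+ 2 = \sum_(i in A) u i 0 ^+ 2.
Proof.
rewrite sqr_l2norm [RHS]big_mkcond; apply: eq_bigr => i _.
by rewrite mxE; case: ifP => // _; rewrite expr0n.
Qed.

Lemma l2norm_restr_le A u : l2norm (restr A u) <= l2norm u.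
Proof.
rewrite -(@ler_pXn2r _ 2)// ?nnegrE ?l2norm_ge0// sqr_l2norm_restr sqr_l2norm.
by rewrite [leRHS](bigID (mem A))//= lerDl sumr_ge0// => i _; rewrite sqr_ge0.
Qed.

Lemma l2norm_subvec A u : l2norm (subvec A u) = l2norm (restr A u).
Proof.
apply/eqP; rewrite -(@eqrXn2 _ 2) ?l2norm_ge0// sqr_l2norm_restr sqr_l2norm.
rewrite (big_enum_val (fun i => u i 0 ^+ 2)).
by apply/eqP; apply: eq_bigr => i _; rewrite mxE.
Qed.

Lemma subvecB A u v : subvec A u - subvec A v = subvec A (u - v).
Proof. by apply/colP => i; rewrite !mxE. Qed.

Lemma subcols_subvec n A (X : 'M[R]_(n, p)) u :
  subcols A X *m subvec A u = X *m restr A u.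
Proof.
apply/colP => i; rewrite !mxE.
rewrite [RHS](bigID (mem A)) /= [X in _ = _ + X]big1 ?addr0; last first.
  by move=> j jA; rewrite mxE (negbTE jA) mulr0.
rewrite (big_enum_val (fun j => X i j * restr A u j 0)).
apply: eq_bigr => j _; rewrite !mxE.
by rewrite enum_valP.
Qed.

(** Extension by zero: a bound for vectors supported in [A] becomes a bound on
    [spectral_norm (subcols A X)]. *)
Lemma subvec_surj A (v : 'cV[R]_#|A|) : exists2 u : 'cV[R]_p, subvec A u = v & restr A u = u.
Proof.
pose f i := if [pick k : 'I_#|A| | enum_val k == i] is Some k then v k 0 else 0.
exists (\col_i f i).
  apply/colP => k; rewrite !mxE /f.
  case: pickP => [l /eqP/enum_val_inj->//|/(_ k)].
  by rewrite eqxx.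
apply: restr_id => i iA; rewrite mxE /f; case: pickP => // k /eqP ki.
by move: iA; rewrite -ki enum_valP.
Qed.

Hypothesis hG : is_grouping G.

Lemma grouping_inj i j k : i \in G j -> i \in G k -> j = k.
Proof.
move=> ij ik; apply: contrapT => jk.
by have := hG.1 _ _ jk => /setP/(_ i); rewrite !inE ij ik.
Qed.

Lemma sum_grouping (S : {set 'I_M}) (F : 'I_p -> R) :
  \sum_(i in group_union G S) F i = \sum_(j in S) \sum_(i in G j) F i.
Proof.
rewrite (exchange_big_dep (mem (group_union G S)))/=; last first.
  by move=> j i jS ij; apply/bigcupP; exists j.
apply: eq_bigr => i /bigcupP[j jS ij].
rewrite (big_pred1 j)// => k; rewrite /=.
apply/andP/eqP => [[_ ik]|->//]; exact: grouping_inj ik ij.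
Qed.

Lemma card_group_union (S : {set 'I_M}) :
  #|group_union G S|%:R = \sum_(j in S) #|G j|%:R :> R.
Proof.
transitivity (\sum_(i in group_union G S) 1 : R); first by rewrite sumr_const.
by rewrite sum_grouping; apply: eq_bigr => j _; rewrite sumr_const.
Qed.

Lemma restr_group_union (S : {set 'I_M}) u :
  restr (group_union G S) u = \sum_(j in S) restr (G j) u.
Proof.
apply/colP => i; rewrite summxE mxE; case: ifP => [/bigcupP[j jS ij]|iS].
  rewrite (bigD1 j)//= big1 ?addr0 ?mxE ?ij// => k /andP[kS kj].
  by rewrite mxE; case: ifP => // ik; rewrite (grouping_inj ij ik) eqxx in kj.
rewrite big1// => j jS; rewrite mxE; case: ifP => // ij.
by move/negbT/negP: iS => []; apply/bigcupP; exists j.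
Qed.

Lemma sum_restr u : u = \sum_j restr (G j) u.
Proof.
have h : group_union G [set: 'I_M]%SET = [set: 'I_p]%SET.
  by rewrite -hG.2 /group_union; apply: eq_bigl => j; rewrite inE.
rewrite -[LHS](@restr_id (group_union G [set: 'I_M]%SET)) => [|i]; last first.
  by rewrite h inE.
by rewrite restr_group_union; apply: eq_bigl => j; rewrite inE.
Qed.

Lemma sqr_l2norm_group_union (S : {set 'I_M}) u :
  l2norm (restr (group_union G S) u) ^+ 2 = \sum_(j in S) l2norm (restr (G j) u) ^+ 2.
Proof.
rewrite sqr_l2norm_restr sum_grouping; apply: eq_bigr => j _.
by rewrite sqr_l2norm_restr.
Qed.

End groups.

(** * The square-root lasso *)

(** The infimum of v^2/(2s) + s/2 over s > 0 is v, attained at s = v. For v = 0 it is not attained,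
    and s = c is tested instead. *)
Lemma le_inf_scale (R : realType) (c v : R) : 0 <= v ->
  (forall s, 0 < s -> c <= v ^+ 2 / (2 * s) + s / 2) -> c <= v.
Proof.
rewrite le_eqVlt => /predU1P[<- h|v0 h].
  rewrite leNgt; apply/negP => c0; have := h c c0.
  by rewrite expr0n/= mul0r add0r => ?; lra.
have := h v v0.
suff -> : v ^+ 2 / (2 * v) + v / 2 = v by [].
by field; rewrite gt_eqF.
Qed.

(** Equality case of the arithmetic-geometric mean inequality: optimality of [t] gives (t - v)^2 <=
    0. *)
Lemma scale_argmin (R : realType) (v t : R) : 0 <= v -> 0 < t ->
  (forall s, 0 < s -> v ^+ 2 / (2 * t) + t / 2 <= v ^+ 2 / (2 * s) + s / 2) -> t = v.
Proof.
move=> v0 t0 h; have hv := le_inf_scale v0 h.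
have : v ^+ 2 + t ^+ 2 <= 2 * t * v.
  have t2 : 0 < 2 * t by lra.
  rewrite -(ler_pM2l t2) in hv.
  suff <- : 2 * t * (v ^+ 2 / (2 * t) + t / 2) = v ^+ 2 + t ^+ 2 by [].
  by field; rewrite gt_eqF.
move=> {hv}h2.
have : (t - v) ^+ 2 <= 0 by rewrite sqrrB -mulr_natl; lra.
rewrite le_eqVlt ltNge sqr_ge0 orbF sqrf_eq0 subr_eq0 => /eqP//.
Qed.

Section sqrt_lasso.
Context (R : realType) (n p M : nat) (G : 'I_M -> {set 'I_p}) (omega : 'I_M -> R).
Context (X : 'M[R]_(n, p)) (y : 'cV[R]_n).
Hypothesis (n0 : (0 < n)%N).

Definition penalty (b : 'cV[R]_p) : R := \sum_j omega j * l2norm (restr (G j) b).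

Let rn : R := Num.sqrt n%:R.

Let rn0 : 0 < rn. Proof. by rewrite sqrtr_gt0 ltr0n. Qed.
Let rn2 : rn ^+ 2 = n%:R. Proof. by rewrite sqr_sqrtr. Qed.

Lemma scaled_group_lasso_lossE b s : 0 < s ->
  scaled_group_lasso_loss G omega X y b s =
  (l2norm (y - X *m b) / rn) ^+ 2 / (2 * s) + s / 2 + penalty b.
Proof.
move=> s0; rewrite /scaled_group_lasso_loss expr_div_n rn2; congr (_ + _ + _).
  by field; rewrite gt_eqF//= gt_eqF// ltr0n.
by apply: eq_bigr => j _; rewrite l2norm_subvec.
Qed.

Let nrm_ge0 b : 0 <= l2norm (y - X *m b) / rn.
Proof. by rewrite divr_ge0 ?l2norm_ge0// ltW. Qed.

Lemma scaled_lasso_scale bh sh :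
  scaled_group_lasso_solution G omega X y bh sh -> sh = l2norm (y - X *m bh) / rn.
Proof.
move=> [sh0 h]; apply: scale_argmin => // s s0.
by have := h bh s s0; rewrite !scaled_group_lasso_lossE// lerD2r.
Qed.

(** Profiling out the scale: for fixed [b] the infimum over [s] is the normalised residual norm, and
    at the solution the two scale terms add up to [sh]. *)
Lemma scaled_lasso_sqrt_lasso bh sh b :
  scaled_group_lasso_solution G omega X y bh sh ->
  sh + penalty bh <= l2norm (y - X *m b) / rn + penalty b.
Proof.
move=> hs; have e := scaled_lasso_scale hs; case: hs => sh0 h.
rewrite -lerBrDr -addrA -lerBlDr opprB addrA -(addrA sh).
suff: sh + penalty bh - penalty b <= l2norm (y - X *m b) / rn by lra.
apply: le_inf_scale => // s s0.
have := h b s s0; rewrite !scaled_group_lasso_lossE// -e.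
have -> : sh ^+ 2 / (2 * sh) = sh / 2 by field; rewrite gt_eqF.
lra.
Qed.

Context (S : {set 'I_M}) (beta bh : 'cV[R]_p) (sh eta : R).
Hypothesis hG : is_grouping G.
Hypothesis omega_ge0 : forall j, 0 <= omega j.
Hypothesis eta01 : 0 <= eta < 1.
Hypothesis supp_beta : forall i, i \notin group_union G S -> beta i 0 = 0.
Hypothesis sol : scaled_group_lasso_solution G omega X y bh sh.
Let eps := y - X *m beta.
Let h := bh - beta.
Hypothesis noise : forall j,
  l2norm ((subcols (G j) X)^T *m eps) <= eta * rn * omega j * l2norm eps.

Let b := l2norm eps / rn.
Let w := penalty h.
Let x := l2norm (X *m h) / rn.
Let wj j := omega j * l2norm (restr (G j) h).

Let wj_ge0 j : 0 <= wj j.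
Proof. by rewrite mulr_ge0 ?l2norm_ge0. Qed.

Let b_ge0 : 0 <= b. Proof. by rewrite divr_ge0 ?l2norm_ge0// ltW. Qed.

Let w_ge0 : 0 <= w.
Proof. by apply: sumr_ge0 => j _; apply: wj_ge0. Qed.

Lemma penalty_split :
  w = \sum_(j in S) wj j + \sum_(j | j \notin S) wj j.
Proof. by rewrite /w /penalty (bigID (mem S)). Qed.

(** On [S] the reverse triangle inequality bounds the gain in penalty; off [S] the vector [beta]
    vanishes, so the penalty of [bh] there is that of [h] and counts negatively. *)
Lemma sqrt_lasso_basic :
  sh <= b + \sum_(j in S) wj j - \sum_(j | j \notin S) wj j.
Proof.
have := scaled_lasso_sqrt_lasso beta sol; rewrite -/eps -/b.
suff : penalty beta - penalty bh <=
  \sum_(j in S) wj j - \sum_(j | j \notin S) wj j by lra.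
rewrite /penalty -sumrB (bigID (mem S))/= -sumrN; apply: lerD.
  apply: ler_sum => j _; rewrite -mulrBr ler_wpM2l//.
  rewrite (le_trans (l2normB_ge _ _))// -restrB -opprB -/h.
  by rewrite -scaleN1r restrZ scaleN1r l2normN.
apply: ler_sum => j jS; rewrite -mulrBr -mulrN ler_wpM2l//.
have b0 : restr (G j) beta = 0.
  apply/colP => i; rewrite !mxE; case: ifP => // ij; apply: supp_beta.
  by apply: contra jS => /bigcupP[k kS ik]; rewrite (grouping_inj hG ij ik).
by rewrite /h restrB b0 subr0 l2norm0 sub0r.
Qed.

Lemma noise_dual : dotp (X *m h) eps <= eta * rn * w * l2norm eps.
Proof.
rewrite {1}(sum_restr hG h) mulmx_sumr dotp_suml /w /penalty.
rewrite -!mulrA mulr_suml !mulr_sumr; apply: ler_sum => j _.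
rewrite -subcols_subvec dotp_mull (le_trans (cauchy_schwarz _ _))//.
rewrite l2norm_subvec (le_trans (ler_wpM2l (l2norm_ge0 _) (noise j)))//.
by rewrite le_eqVlt; apply/orP; left; apply/eqP; ring.
Qed.

Lemma resid : y - X *m bh = eps - X *m h.
Proof. by rewrite /eps /h mulmxBr opprB addrA subrK. Qed.

(** Pairing the residual with [eps]: |eps - X h| |eps| >= <eps - X h, eps>, and [noise_dual]
    controls <X h, eps>. The bound is linear in [w], so [b] cancels against [sqrt_lasso_basic] and
    the cone remains. *)
Lemma sqrt_lasso_lower : b - eta * w <= sh.
Proof.
rewrite (scaled_lasso_scale sol) resid.
rewrite ler_pdivlMr// mulrBl mulfVK ?gt_eqF//.
have w0 := w_ge0.
have e0 := l2norm_ge0 eps.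
have [/eqP e|ne] := boolP (l2norm eps == 0).
  rewrite e sub0r (@le_trans _ _ 0) ?l2norm_ge0// oppr_le0.
  by rewrite !mulr_ge0 ?(ltW rn0)//; case/andP: eta01.
have ep : 0 < l2norm eps by rewrite lt0r ne.
rewrite -(ler_pM2r ep).
rewrite (le_trans _ (cauchy_schwarz _ _))//.
have := noise_dual; move: ep; move: eps (X *m h) => e v ep.
rewrite -(scaleN1r v) dotpDl dotpZl -sqr_l2norm_dotp expr2 => hh; lra.
Qed.

Lemma sqrt_lasso_cone :
  (1 - eta) * \sum_(j | j \notin S) wj j <= (1 + eta) * \sum_(j in S) wj j.
Proof.
have := sqrt_lasso_basic; have := sqrt_lasso_lower; rewrite penalty_split; lra.
Qed.

Lemma sqrt_lasso_upper : sh <= b + w.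
Proof.
rewrite penalty_split; have := sqrt_lasso_basic.
have : 0 <= \sum_(j | j \notin S) wj j by apply: sumr_ge0.
lra.
Qed.

Lemma sqrt_lasso_scale_le : `|sh - b| <= w.
Proof.
have w0 := w_ge0.
have := sqrt_lasso_lower; have := sqrt_lasso_upper.
rewrite ler_norml; case/andP: eta01 => e0 e1 h1 h2; apply/andP; split; nra.
Qed.

(* Minimality only enters through [sh <= b + w], squared. *)
Lemma sqrt_lasso_pred : x ^+ 2 <= 4 * b * w + w ^+ 2.
Proof.
have w0 := w_ge0.
have sh0 : 0 <= sh by case: sol => /ltW.
have e : sh ^+ 2 = b ^+ 2 - 2 * dotp (X *m h) eps / n%:R + x ^+ 2.
  rewrite (scaled_lasso_scale sol) resid !expr_div_n rn2.
  rewrite -(scaleN1r (X *m h)); move: eps (X *m h) => e v.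
  rewrite sqr_l2norm_dotp !(dotpDl, dotpDr, dotpZl, dotpZr).
  rewrite (dotpC e v) -!sqr_l2norm_dotp.
  by field; rewrite gt_eqF// ltr0n.
have d : dotp (X *m h) eps / n%:R <= b * w.
  rewrite ler_pdivrMr ?ltr0n// (le_trans noise_dual)//.
  rewrite -rn2 /b expr2.
  have -> : l2norm eps / rn * w * (rn * rn) = rn * w * l2norm eps.
    by field; rewrite gt_eqF.
  rewrite -!mulrA ler_piMl ?mulr_ge0 ?l2norm_ge0//; first exact: ltW.
  by case/andP: eta01 => _ /ltW.
have u := sqrt_lasso_upper.
have : sh ^+ 2 <= (b + w) ^+ 2.
  by rewrite ler_pXn2r// ?nnegrE ?addr_ge0.
rewrite e sqrrD -mulr_natl; lra.
Qed.

(** Inserting w <= K x into [sqrt_lasso_pred] gives x^2 <= 4 b K x + K^2 x^2. Since 2 K^2 <= 1 the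
    last term is absorbed, whence x <= 8 K b and w <= 8 K^2 b. *)
Lemma sqrt_lasso_oracle (K : R) : 0 <= K -> 2 * K ^+ 2 <= 1 -> w <= K * x ->
  [/\ `|sh - b| <= 8 * K ^+ 2 * b, x ^+ 2 <= 64 * K ^+ 2 * b ^+ 2
    & w <= 8 * K ^+ 2 * b].
Proof.
move=> K0 K1 wK.
have w0 := w_ge0.
have x0 : 0 <= x by rewrite divr_ge0 ?l2norm_ge0// ltW.
have h1 := sqrt_lasso_pred.
have h2 : x ^+ 2 <= 8 * K * b * x.
  have : b * w <= b * (K * x) by rewrite ler_wpM2l.
  have : w ^+ 2 <= (K * x) ^+ 2 by rewrite ler_pXn2r// nnegrE// mulr_ge0.
  rewrite exprMn.
  have : 2 * K ^+ 2 * x ^+ 2 <= 1 * x ^+ 2 by rewrite ler_wpM2r ?sqr_ge0.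
  lra.
have kb : 0 <= 8 * K * b by rewrite mulr_ge0// mulr_ge0.
have h3 : x <= 8 * K * b.
  move: x0; rewrite le_eqVlt => /predU1P[<-|xp].
    exact: kb.
  by rewrite -(ler_pM2r xp) -expr2.
have h4 : w <= 8 * K ^+ 2 * b.
  by rewrite (le_trans wK)// expr2 (le_trans (ler_wpM2l K0 h3))//; lra.
split => //; first exact: le_trans sqrt_lasso_scale_le _.
have -> : 64 * K ^+ 2 * b ^+ 2 = (8 * K * b) ^+ 2 by ring.
by rewrite ler_pXn2r.
Qed.

End sqrt_lasso.

(** * Integration and independence *)

Section weighted_integral.
Local Open Scope ereal_scope.
Import HBNNSimple.
Context d (T : measurableType d) d' (U : measurableType d') (R : realType).

(** Monotone convergence along simple approximations of [f], with the weight [g] left untouched: the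
    integral is determined by the integrals of [g] times indicators of [Y]. *)
Lemma weighted_integral_limE (P : {measure set T -> \bar R}) (Y : T -> U)
    (g : T -> R) (f : U -> R) (h : {nnsfun U >-> R}^nat) :
  measurable_fun setT Y -> measurable_fun setT g -> (forall x, 0 <= g x)%R ->
  (forall y, EFin \o h ^~ y @ \oo --> (f y)%:E) ->
  nondecreasing_seq (h : (U -> R)^nat) ->
  \int[P]_x (g x * f (Y x))%:E =
  limn (fun n => \sum_(r \in range (h n))
    r%:E * \int[P]_x (g x * \1_(h n @^-1` [set r]) (Y x))%:E).
Proof.
move=> mY mg g0 hf ndh.
have mhY n : measurable_fun setT (fun x => h n (Y x)).
  exact: (measurableT_comp (measurable_funP (h n)) mY).
transitivity (limn (fun n => \int[P]_x (g x * h n (Y x))%:E)).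
  rewrite -monotone_convergence//.
  - apply: eq_integral => x _; apply/esym/cvg_lim => //.
    rewrite EFinM; under eq_fun do rewrite EFinM.
    by apply: cvgeZl => //; exact: hf.
  - by move=> n; apply/measurable_EFinP/measurable_funM.
  - by move=> n x _; rewrite lee_fin mulr_ge0.
  - move=> x _ m n mn; rewrite lee_fin ler_wpM2l//; exact/lefP/ndh.
congr (limn _); apply/funext => n.
have mi r : measurable_fun setT (fun x => \1_(h n @^-1` [set r]) (Y x) : R).
  by apply: measurableT_comp => //; apply: measurable_indic; exact: measurable_sfunP.
transitivity (\int[P]_x \sum_(r \in range (h n))
    (r * (g x * \1_(h n @^-1` [set r]) (Y x)))%:E).
  apply: eq_integral => x _; rewrite {1}(fimfunE (h n) (Y x)) fsumEFin//.
  congr EFin; rewrite mulr_fsumr//; apply: eq_fsbigr => r _.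
  by rewrite mulrCA.
rewrite ge0_integral_fsum//.
- apply: eq_fsbigr => r; rewrite inE => -[y _ <-].
  under eq_integral do rewrite EFinM.
  rewrite ge0_integralZl//.
  + by apply/measurable_EFinP/measurable_funM.
  + by move=> x _; rewrite lee_fin mulr_ge0.
  + by rewrite lee_fin; exact: fun_ge0.
- by move=> r; apply/measurable_EFinP/measurable_funM => //; apply/measurable_funM.
- move=> r x _; have := nnfun_muleindic_ge0 (h n) r (Y x).
  by rewrite !lee_fin mulrCA => ?; apply: mulr_ge0.
Qed.

End weighted_integral.

Section transfer.
Local Open Scope ereal_scope.
Import HBNNSimple.
Context d (T : measurableType d) d1 (T1 : measurableType d1)
  d' (U : measurableType d') (R : realType).

(** The two weights let one statement serve as transfer of a law (both constant), as change of
    density, and as one step of factorisation under independence ([g] the product of the other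
    factors, [g1] its mean). *)
Lemma ge0_integral_transfer (P : {measure set T -> \bar R})
    (P1 : {measure set T1 -> \bar R}) (Y : T -> U) (Y1 : T1 -> U)
    (g : T -> R) (g1 : T1 -> R) (f : U -> R) :
  measurable_fun setT Y -> measurable_fun setT g -> (forall x, 0 <= g x)%R ->
  measurable_fun setT Y1 -> measurable_fun setT g1 -> (forall x, 0 <= g1 x)%R ->
  measurable_fun setT f -> (forall y, 0 <= f y)%R ->
  (forall A, measurable A ->
    \int[P]_x (g x * \1_A (Y x))%:E = \int[P1]_x (g1 x * \1_A (Y1 x))%:E) ->
  \int[P]_x (g x * f (Y x))%:E = \int[P1]_x (g1 x * f (Y1 x))%:E.
Proof.
move=> mY mg g0 mY1 mg1 g10 mf f0 H.
have mEf : measurable_fun setT (fun y => (f y)%:E) by exact/measurable_EFinP.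
pose h := nnsfun_approx measurableT mEf.
have hf y : EFin \o h ^~ y @ \oo --> (f y)%:E.
  by apply: cvg_nnsfun_approx => // z _; rewrite lee_fin.
have ndh : nondecreasing_seq (h : (U -> R)^nat) by exact: nd_nnsfun_approx.
rewrite (weighted_integral_limE P mY mg g0 hf ndh).
rewrite (weighted_integral_limE P1 mY1 mg1 g10 hf ndh).
congr (limn _); apply/funext => n; apply: eq_fsbigr => r _.
by rewrite H//; exact: measurable_sfunP.
Qed.

End transfer.

Section independence.
Local Open Scope ereal_scope.
Context d (T : measurableType d) (R : realType) (P : probability T R).
Context d' (U : measurableType d') (n : nat).

Lemma indep_integral_prod (X : 'I_n -> T -> U) (f : 'I_n -> U -> R) :
  mutually_independent P X -> (forall i, measurable_fun setT (X i)) ->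
  (forall i, measurable_fun setT (f i)) -> (forall i y, 0 <= f i y)%R ->
  (forall i, \int[P]_x (f i (X i x))%:E < +oo) ->
  \int[P]_x (\prod_i f i (X i x))%:E = \prod_i \int[P]_x (f i (X i x))%:E.
Proof.
move=> iX mX mf f0 foo.
(* Hybrid argument: the first k factors are the f i, the others indicators. *)
pose F (A : 'I_n -> set U) k (i : 'I_n) : U -> R :=
  if (i < k)%N then f i else \1_(A i).
suff H k : (k <= n)%N -> forall A, (forall i, measurable (A i)) ->
    \int[P]_x (\prod_i F A k i (X i x))%:E = \prod_i \int[P]_x (F A k i (X i x))%:E.
  have := H n (leqnn n) (fun=> setT) (fun=> measurableT); rewrite /F.
  under eq_integral do under eq_bigr do rewrite ltn_ord.
  by under [in X in _ = X]eq_bigr do rewrite ltn_ord.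
have mF A j i : measurable (A i) -> measurable_fun setT (F A j i).
  by move=> mA; rewrite /F; case: ifP => // _; exact: measurable_indic.
have F0 A j i y : (0 <= F A j i y)%R by rewrite /F; case: ifP.
elim: k => [_ A mA|k IH kn A mA].
  rewrite /F /=.
  have hE i : \int[P]_x (\1_(A i) (X i x))%:E = P (X i @^-1` A i).
    transitivity (\int[P]_x (\1_(X i @^-1` A i) x)%:E); first by [].
    by rewrite integral_indic ?setIT//; rewrite -[_ @^-1` _]setTI; exact: mX.
  under [RHS]eq_bigr do rewrite hE.
  have := iX [set: 'I_n]%SET A mA.
  under [in X in _ = X -> _]eq_bigl do rewrite inE.
  move=> <-; rewrite -[X in P X]setIT -integral_indic//; last first.
    apply: fin_bigcap_measurable => // i _.
    by rewrite -[_ @^-1` _]setTI; exact: mX.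
  apply: eq_integral => x _; congr EFin.
  rewrite indicE; case: (boolP (x \in _)) => [|].
    rewrite inE => h; rewrite big1// => i _; rewrite indicE mem_set//.
    by apply: (h i); rewrite /= inE.
  rewrite notin_setE => h.
  suff [i hi] : exists i, ~ A i (X i x).
    by rewrite (bigD1 i)//= indicE memNset// mul0r.
  by apply: contrapT => hn; apply: h => i _; apply: contrapT => hi; apply: hn; exists i.
pose i0 := Ordinal kn.
have Fk B i : i != i0 -> F A k.+1 i = F (fun j => if j == i0 then B else A j) k i.
  move=> ii0; rewrite /F (negbTE ii0) ltnS leq_eqVlt.
  by have -> : (i == k :> nat) = false by apply/negbTE; exact: ii0.
have FB B : F (fun j => if j == i0 then B else A j) k i0 = \1_B.
  by rewrite /F ltnn eqxx.
have mAB B : measurable B ->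
    forall i, measurable ((fun j => if j == i0 then B else A j) i).
  by move=> mB i; case: ifP.
have ifin i : \int[P]_x (F A k.+1 i (X i x))%:E \is a fin_num.
  rewrite ge0_fin_numE; last by apply: integral_ge0 => x _; rewrite lee_fin.
  rewrite /F; case: ifP => // _.
  rewrite (_ : \int[P]_x _ = P (X i @^-1` A i)); last first.
    transitivity (\int[P]_x (\1_(X i @^-1` A i) x)%:E); first by [].
    by rewrite integral_indic ?setIT//; rewrite -[_ @^-1` _]setTI; exact: mX.
  rewrite (le_lt_trans (probability_le1 _ _)) ?ltry//.
  by rewrite -[_ @^-1` _]setTI; exact: mX.
pose c : R := (\prod_(i | i != i0) fine (\int[P]_x (F A k.+1 i (X i x))%:E)%E)%R.
have cE : \prod_(i | i != i0) \int[P]_x (F A k.+1 i (X i x))%:E = c%:E.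
  by rewrite /c -prodEFin; apply: eq_bigr => i _; rewrite fineK.
have c0 : (0 <= c)%R.
  by apply: prodr_ge0 => i _; apply/fine_ge0/integral_ge0 => x _; rewrite lee_fin.
rewrite [RHS](bigD1 i0)//= cE muleC.
have mg : measurable_fun setT (fun x => \prod_(i | i != i0) F A k.+1 i (X i x))%R.
  rewrite (_ : (fun x => _) =
    (fun x => \prod_(i <- [seq i <- index_enum 'I_n | i != i0]) F A k.+1 i (X i x))%R).
    by apply: measurable_prod => i _; apply: measurableT_comp => //; exact: mF.
  by apply/funext => x; rewrite big_filter.
transitivity (\int[P]_x (c * F A k.+1 i0 (X i0 x))%:E); last first.
  under eq_integral do rewrite EFinM.
  rewrite ge0_integralZl//; last by move=> x _; rewrite lee_fin.
  by apply/measurable_EFinP; apply: measurableT_comp => //; exact: mF.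
transitivity (\int[P]_x (\prod_(i | i != i0) F A k.+1 i (X i x) * F A k.+1 i0 (X i0 x))%:E).
  by apply: eq_integral => x _; rewrite (bigD1 i0)//= mulrC.
apply: (ge0_integral_transfer (Y := X i0) (Y1 := X i0) (g1 := cst c)) => //.
- by move=> x; apply: prodr_ge0.
- exact: mF.
(* Tested on the indicator of [B], the claim is stage [k] of the induction with the set at index
   [i0] replaced by [B]; hence the quantification over all families [A]. *)
move=> B mB.
transitivity (\int[P]_x (\prod_i F (fun j => if j == i0 then B else A j) k i (X i x))%:E).
  apply: eq_integral => x _; congr EFin; rewrite [RHS](bigD1 i0)//= FB mulrC.
  by congr (_ * _)%R; apply: eq_bigr => i ii0; rewrite (Fk B).
rewrite IH ?(ltnW kn)//; last exact: mAB.
rewrite (bigD1 i0)//= FB.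
transitivity (c%:E * \int[P]_x (\1_B (X i0 x))%:E).
  rewrite -cE muleC; congr (_ * _).
  by apply: eq_bigr => i ii0; rewrite (Fk B).
under [RHS]eq_integral do rewrite EFinM.
rewrite ge0_integralZl//.
by apply/measurable_EFinP; apply: measurableT_comp => //; exact: measurable_indic.
Qed.

End independence.

Section indicator_bound.
Local Open Scope ereal_scope.
Context d (T : measurableType d) (R : realType) (P : {measure set T -> \bar R}).

Lemma measure_le_integral (A : set T) (f : T -> R) :
  measurable A -> measurable_fun setT f -> (forall x, 0 <= f x)%R ->
  (forall x, A x -> 1 <= f x)%R -> P A <= \int[P]_x (f x)%:E.
Proof.
move=> mA mf f0 f1; rewrite -[A in X in X <= _]setIT -integral_indic//.
apply: ge0_le_integral => //.
- by apply/measurable_EFinP; exact: measurable_indic.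
- exact/measurable_EFinP.
- move=> x _; rewrite lee_fin indicE.
  by case: (boolP (x \in A)) => // /set_mem/f1.
Qed.

End indicator_bound.

Section measurable_comparison.
Context d (T : measurableType d) (R : realType) (f g : T -> R).
Hypotheses (mf : measurable_fun setT f) (mg : measurable_fun setT g).

Lemma measurable_set_lt : measurable [set x | f x < g x].
Proof.
have := measurable_fun_ltr mf mg measurableT (Y := [set true]).
by rewrite setTI; apply.
Qed.

Lemma measurable_set_le : measurable [set x | f x <= g x].
Proof.
have := measurable_fun_ler mf mg measurableT (Y := [set true]).
by rewrite setTI; apply.
Qed.

End measurable_comparison.

Section matrix_measurability.
Context (R : realType).

Lemma measurable_entry m n (i : 'I_m) (j : 'I_n) :
  measurable_fun setT (fun M : 'M[R]_(m, n) => M i j).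
Proof.
move=> _ B mB; rewrite setTI; apply: sub_gen_smallest.
by exists i, j, B.
Qed.

Lemma measurable_matrix d (T : measurableType d) m n (f : T -> 'M[R]_(m, n)) :
  (forall i j, measurable_fun setT (fun x => f x i j)) -> measurable_fun setT f.
Proof.
move=> h; apply: (@measurability _ _ _ _ _ f (@entry_cylinders R m n)) => //.
move=> _ [_ [i [j [B [mB ->]]]] <-].
exact: (h i j measurableT B mB).
Qed.

Lemma measurable_row m n (i : 'I_m) :
  measurable_fun setT (fun M : 'M[R]_(m, n) => row i M).
Proof.
apply: measurable_matrix => k j; under eq_fun do rewrite mxE.
exact: measurable_entry.
Qed.

End matrix_measurability.

(** * The random design in a fixed direction *)

Section rayleigh.
Context (R : realType) (p : nat).
Implicit Types (S : 'M[R]_p) (b : 'cV[R]_p).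

Definition quadf S b : R := (b^T *m S *m b) 0 0.

Lemma quadf_dotp S b : quadf S b = dotp b (S *m b).
Proof. by rewrite /quadf dotpE mulmxA. Qed.

Lemma quadfZ S a b : quadf S (a *: b) = a ^+ 2 * quadf S b.
Proof. by rewrite !quadf_dotp -scalemxAr dotpZl dotpZr mulrA expr2. Qed.

Let f S (v : 'rV[R]_p) : R := quadf S v^T.

Let f_continuous S : continuous (f S).
Proof.
have -> : f S = fun v => \sum_i (v 0 i * \sum_j (S i j * v 0 j)).
  apply/funext => v; rewrite /f quadf_dotp; apply: eq_bigr => i _.
  by rewrite !mxE; congr (_ * _); apply: eq_bigr => j _; rewrite mxE.
apply: (continuous_big (op := +%R)) => [|i _]; first exact: add_continuous.
have cc j : continuous (fun v : 'rV[R]_p => v 0 j) by exact: coord_continuous.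
move=> v; apply: (cvgM (cc i v)).
apply: (continuous_big (op := +%R) (P := xpredT)) => [|j _]; first exact: add_continuous.
by move=> w; apply: (cvgM _ (cc j w)); exact: cvg_cst.
Qed.

Lemma rayleigh_lower S (c : R) : S^T = S ->
  (forall a, eigenvalue S a -> c <= a) ->
  forall b, c * l2norm b ^+ 2 <= quadf S b.
Proof.
move=> symS hc b.
have [->|b0] := eqVneq b 0.
  by rewrite l2norm0 expr0n/= mulr0 quadf_dotp mulmx0 /dotp big1// => i _; rewrite !mxE mul0r.
have scaleE (w : 'cV[R]_p) : w != 0 ->
    l2norm ((l2norm w)^-1 *: w) = 1.
  move=> w0; rewrite l2normZ ger0_norm ?invr_ge0 ?l2norm_ge0// mulVf//.
  by rewrite l2norm_eq0.
pose A := [set v : 'rV[R]_p | f 1%:M v = 1].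
have fE v : f 1%:M v = l2norm v^T ^+ 2.
  by rewrite /f quadf_dotp mul1mx sqr_l2norm_dotp.
have AE (w : 'cV[R]_p) : w != 0 -> A ((l2norm w)^-1 *: w)^T.
  by move=> w0; rewrite /A /= fE trmxK scaleE// expr1n.
have cA : compact A.
  apply: bounded_closed_compact.
    exists 1; split; first exact: num_real.
    move=> M M1 v; rewrite /A /= fE => hv.
    rewrite /Num.norm /= mx_normrE; apply/bigmax_leP; split; first by rewrite ltW// (lt_trans _ M1).
    move=> [i j] _ /=; rewrite ord1 (le_trans _ (ltW M1))//.
    rewrite -(@ler_pXn2r _ 2)// ?nnegrE// expr1n real_normK ?num_real// -hv sqr_l2norm.
    rewrite (bigD1 j)//= mxE lerDl; apply: sumr_ge0 => k _; exact: sqr_ge0.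
  rewrite (_ : A = f 1%:M @^-1` [set 1]); last by [].
  by apply: closed_comp => [v _|]; [exact: f_continuous|exact: closed_eq].
(* A minimiser of the quadratic form on the sphere is an eigenvector. *)
have [v /set_mem vA vmin] : exists2 v, v \in A & forall t, t \in A -> f S v <= f S t.
  apply: EVT_min_rV => //; first by exists ((l2norm b)^-1 *: b)^T; exact: AE.
  by apply: continuous_subspaceT; exact: f_continuous.
set mu := f S v in vmin.
have hmu w : mu * l2norm w ^+ 2 <= quadf S w.
  have [->|w0] := eqVneq w 0.
    by rewrite l2norm0 expr0n/= mulr0 quadf_dotp mulmx0 /dotp big1// => i _; rewrite !mxE mul0r.
  have := vmin _ (mem_set (AE _ w0)); rewrite /f trmxK quadfZ exprVn.
  rewrite mulrC ler_pdivlMr//; by rewrite exprn_gt0// lt0r l2norm_eq0 w0 l2norm_ge0.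
have v1 : l2norm v^T ^+ 2 = 1 by move: vA; rewrite /A /= fE.
apply: le_trans (hmu b); rewrite ler_wpM2r ?sqr_ge0//; apply: hc.
apply/eigenvalueP; exists v; last first.
  by apply: contra_eq_neq v1 => ->; rewrite trmx0 l2norm0 expr0n/= eq_sym oner_eq0.
pose u := v^T; pose w := S *m u - mu *: u.
have mv : mu = dotp u (S *m u) by rewrite /mu /f quadf_dotp.
suff w0 : w = 0.
  apply: trmx_inj; rewrite trmx_mul symS -/u linearZ /=.
  by apply/eqP; rewrite -subr_eq0; apply/eqP.
apply/eqP; rewrite -l2norm_eq0 -sqrf_eq0.
rewrite eq_le sqr_ge0 andbT leNgt; apply/negP => B0.
set B := l2norm w ^+ 2 in B0.
have BE : dotp w (S *m u) - mu * dotp w u = B.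
  rewrite /B sqr_l2norm_dotp -mulNr -dotpZr -dotpDr.
  by rewrite scaleNr.
pose D := quadf S w - mu * B.
have D0 : 0 <= D by rewrite subr_ge0; exact: hmu.
(* First variation at the minimiser [u] in the direction of its residual [w]: the linear coefficient
   is 2 |w|^2, which is impossible for small negative [t] unless [w] vanishes. *)
have key t : 0 <= 2 * t * B + t ^+ 2 * D.
  have := hmu (u + t *: w).
  have : dotp u (S *m w) = dotp w (S *m u) by rewrite dotpC dotp_mull symS.
  have : dotp u u = 1 by rewrite -sqr_l2norm_dotp.
  rewrite /D -BE quadf_dotp; move: mv BE; rewrite /B sqr_l2norm_dotp.
  move: (w) (u) => w' u' mv' BE' u1 e1.
  rewrite quadf_dotp mulmxDr -scalemxAr sqr_l2norm_dotp.
  rewrite !(dotpDl, dotpDr, dotpZl, dotpZr) e1 (dotpC u' w') -mv' u1; nra.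
have D1 : 0 < D + 1 by lra.
(* The minimiser in [t] would be -B/D; adding 1 covers the case D = 0. *)
have := key (- B / (D + 1)).
have -> : 2 * (- B / (D + 1)) * B + (- B / (D + 1)) ^+ 2 * D =
   - (B ^+ 2 * (D + 2)) / (D + 1) ^+ 2.
  by field; rewrite gt_eqF.
rewrite leNgt => /negP; apply.
have D2 : 0 < D + 2 by lra.
rewrite mulNr oppr_lt0.
exact: divr_gt0 (mulr_gt0 (exprn_gt0 2 B0) D2) (exprn_gt0 2 D1).
Qed.

Lemma rayleigh_upper S (c : R) : S^T = S ->
  (forall a, eigenvalue S a -> a <= c) ->
  forall b, quadf S b <= c * l2norm b ^+ 2.
Proof.
move=> symS hc b.
have := @rayleigh_lower (- S) (- c) _ _ b.
have -> : quadf (- S) b = - quadf S b by rewrite /quadf mulmxN mulNmx mxE.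
rewrite mulNr lerN2; apply.
  by rewrite linearN /= symS.
move=> a /eigenvalueP[v hv v0]; rewrite lerNl; apply: hc.
apply/eigenvalueP; exists v => //.
by rewrite scaleNr -hv mulmxN opprK.
Qed.

End rayleigh.

Section elementary_exp.
Context (R : realType).

Lemma expRN_le_quad (x : R) : 0 <= x -> expR (- x) <= 1 - x + x ^+ 2.
Proof.
move=> x0; have x1 : 0 < 1 + x by lra.
rewrite expRN (@le_trans _ _ ((1 + x)^-1))//.
  by rewrite lef_pV2 ?posrE ?expR_gt0// expR_ge1Dx.
rewrite -(ler_pM2l x1) divff ?gt_eqF//.
have -> : (1 + x) * (1 - x + x ^+ 2) = 1 + x ^+ 3 by ring.
by rewrite lerDl exprn_ge0.
Qed.

Lemma sqr_le_expR (x : R) : 0 <= x -> x ^+ 2 / 4 <= expR x.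
Proof.
move=> x0.
have -> : expR x = expR (x / 2) ^+ 2 by rewrite expr2 -expRD; congr expR; lra.
have -> : x ^+ 2 / 4 = (x / 2) ^+ 2 by field.
rewrite ler_pXn2r// ?nnegrE ?expR_ge0 ?divr_ge0//.
by rewrite (le_trans _ (expR_ge1Dx _))// lerDr.
Qed.

Lemma expR_prod (I : finType) (f : I -> R) :
  expR (\sum_i f i) = \prod_i expR (f i).
Proof. by elim/big_rec2 : _ => [|i x y _ <-]; rewrite ?expR0 ?expRD. Qed.

End elementary_exp.

(** * Chernoff bounds for independent nonnegative summands *)

Section chernoff.
Local Open Scope ereal_scope.
Context d (T : measurableType d) (R : realType) (P : probability T R).
Context (n : nat) (Z : 'I_n -> T -> R) (m v0 : R).
Hypotheses (m0 : (0 < m)%R) (v00 : (0 < v0)%R) (Z0 : forall i x, (0 <= Z i x)%R).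
Hypothesis (mZ : forall i, measurable_fun setT (Z i)).
Hypothesis indepZ : forall f : 'I_n -> R -> R,
  (forall i, measurable_fun setT (f i)) -> (forall i y, 0 <= f i y)%R ->
  (forall i, \int[P]_x (f i (Z i x))%:E < +oo) ->
  \int[P]_x (\prod_i f i (Z i x))%:E = \prod_i \int[P]_x (f i (Z i x))%:E.
Hypothesis expZ : forall i, \int[P]_x (expR (Z i x / (v0 * m)))%:E <= 2%:E.

Let mfexp (c : R) : measurable_fun setT (fun y : R => expR (c * y)).
Proof. by apply: measurableT_comp => //; exact: measurable_funM. Qed.

Let mexp (c : R) i : measurable_fun setT (fun x => expR (c * Z i x)).
Proof. exact: measurableT_comp (mfexp c) (mZ i). Qed.

Let e0 (c : R) i : 0 <= \int[P]_x (expR (c * Z i x))%:E.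
Proof. by apply: integral_ge0 => x _; rewrite lee_fin expR_ge0. Qed.

(** The sign of [c] is free, so the same inequality yields the upper tail (c > 0) and the lower tail
    (c < 0). *)
Lemma chernoff_exp_sum (c b : R) (e : 'I_n -> R) :
  (forall i, \int[P]_x (expR (c * Z i x))%:E <= (e i)%:E) ->
  P [set x | (0 < c * \sum_i Z i x - b)%R] <= (expR (- b) * \prod_i e i)%:E.
Proof.
move=> he.
have mS : measurable_fun setT (fun x => c * \sum_i Z i x - b)%R.
  apply: measurable_funB => //; apply: measurable_funM => //.
  by apply: measurable_sum => i.
have fin i : \int[P]_x (expR (c * Z i x))%:E < +oo.
  by rewrite (le_lt_trans (he i))// ltry.
apply: (@le_trans _ _ (\int[P]_x (expR (c * \sum_i Z i x - b))%:E)).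
  apply: measure_le_integral => //.
  - exact: measurable_set_lt.
  - exact: measurableT_comp.
  - move=> x /= h; rewrite (le_trans _ (expR_ge1Dx _))// lerDl; exact: ltW.
under eq_integral do rewrite expRD mulrC EFinM.
rewrite ge0_integralZl//; last first.
  apply/measurable_EFinP; apply: measurableT_comp => //; apply: measurable_funM => //.
  by apply: measurable_sum => i.
rewrite EFinM lee_wpmul2l ?lee_fin ?expR_ge0//.
under eq_integral do rewrite mulr_sumr expR_prod.
rewrite (indepZ (f := fun=> fun y => expR (c * y)))//.
have hf i : \int[P]_x (expR (c * Z i x))%:E =
    (fine (\int[P]_x (expR (c * Z i x))%:E))%:E.
  by rewrite fineK// ge0_fin_numE.
rewrite (eq_bigr _ (fun i _ => hf i)).
rewrite prodEFin lee_fin; apply: ler_prod => i _.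
by rewrite fine_ge0//= -lee_fin -hf.
Qed.

(** With the exponent 1/(v0 m) each factor is at most 2 <= e, so the threshold leaves e^(-2n) 2^n <=
    e^(-n). *)
Lemma chernoff_upper :
  P [set x | (2 * v0 * n%:R * m < \sum_i Z i x)%R] <= (expR (- n%:R))%:E.
Proof.
have vm0 : (0 < v0 * m)%R by rewrite mulr_gt0.
have := @chernoff_exp_sum ((v0 * m)^-1) (2 * n%:R)%R (fun=> 2%R).
rewrite (_ : [set x | _] = [set x | (2 * v0 * n%:R * m < \sum_i Z i x)%R]); last first.
  apply/seteqP; split => x /=; rewrite subr_gt0 ltr_pdivlMl// => h.
  - by move: h; congr (_ < _)%R; ring.
  - by move: h; congr (_ < _)%R; ring.
move=> h; apply: (le_trans (h _)).
  by move=> i; under eq_integral do rewrite mulrC; exact: expZ.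
rewrite lee_fin prodr_const card_ord.
have -> : (- n%:R = - (2 * n%:R) + n%:R * 1 :> R)%R by ring.
rewrite expRD ler_wpM2l ?expR_ge0// expRM_natl lerXn2r ?nnegrE ?expR_ge0//.
by rewrite (le_trans _ (expR_ge1Dx _)).
Qed.

Hypothesis meanZ : \int[P]_x (\sum_i Z i x)%:E = (n%:R * m)%:E.

Lemma chernoff_lower :
  P [set x | (\sum_i Z i x < n%:R * m / 2)%R] <= (expR (- n%:R / (128 * v0 ^+ 2)))%:E.
Proof.
(* The minimiser of -l n m / 2 + 8 l^2 n v0^2 m^2, whose minimum is -n / (128 v0^2). *)
pose l : R := ((32 * v0 ^+ 2 * m)^-1)%R.
have l0 : (0 < l)%R by rewrite invr_gt0 !mulr_gt0 ?exprn_gt0.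
have vm0 : (0 < v0 * m)%R by rewrite mulr_gt0.
have k0 : (0 <= 4 * l ^+ 2 * (v0 * m) ^+ 2)%R.
  by rewrite mulr_ge0 ?sqr_ge0// mulr_ge0 ?sqr_ge0.
have mEZ i : measurable_fun setT (fun x => (Z i x)%:E) by apply/measurable_EFinP.
have mW i : measurable_fun setT (fun x => expR (Z i x / (v0 * m))).
  by have := mexp (v0 * m)^-1 i; under eq_fun do rewrite mulrC.
have mEW i : measurable_fun setT (fun x => (expR (Z i x / (v0 * m)))%:E).
  exact/measurable_EFinP.
have EZ i : \int[P]_x (Z i x)%:E \is a fin_num.
  rewrite ge0_fin_numE; last by apply: integral_ge0 => x _; rewrite lee_fin.
  apply: (@le_lt_trans _ _ (\int[P]_x ((v0 * m)%:E * (expR (Z i x / (v0 * m)))%:E))).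
    apply: ge0_le_integral => //.
    - by move=> x _; rewrite lee_fin.
    - by apply: emeasurable_funM.
    - move=> x _; rewrite -EFinM lee_fin mulrC -ler_pdivrMr//.
      by rewrite (le_trans _ (expR_ge1Dx _))// lerDr.
  rewrite ge0_integralZl//; last by rewrite lee_fin ltW.
  apply: (@le_lt_trans _ _ ((v0 * m)%:E * 2%:E)); last by rewrite -EFinM ltry.
  by rewrite lee_wpmul2l ?lee_fin ?(ltW vm0).
pose z i : R := fine (\int[P]_x (Z i x)%:E).
have sz : (\sum_i z i = n%:R * m)%R.
  apply: EFin_inj; rewrite -meanZ -sumEFin.
  under [RHS]eq_integral do rewrite -sumEFin.
  rewrite ge0_integral_sum//; last by move=> i x _; rewrite lee_fin.
  by apply: eq_bigr => i _; rewrite fineK.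
(* [exp(-x) <= 1 - x + x^2], with the square absorbed by the exponential moment. *)
have lem i : \int[P]_x (expR (- l * Z i x))%:E <=
    (expR (- l * z i + 8 * l ^+ 2 * (v0 * m) ^+ 2))%:E.
  have : \int[P]_x (expR (- l * Z i x))%:E + l%:E * \int[P]_x (Z i x)%:E <=
      1 + (4 * l ^+ 2 * (v0 * m) ^+ 2)%R%:E * \int[P]_x (expR (Z i x / (v0 * m)))%:E.
    rewrite -!ge0_integralZl ?lee_fin ?(ltW l0)//.
    have i1 : \int[P]_x (cst 1 x) = 1.
      by rewrite integral_cst//= ?probability_setT ?mule1.
    rewrite -[X in _ <= X + _]i1 -!ge0_integralD//.
    - apply: ge0_le_integral => //.
      + by move=> x _; rewrite -EFinM -EFinD lee_fin addr_ge0 ?expR_ge0// mulr_ge0// ltW.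
      + by apply: emeasurable_funD; [exact/measurable_EFinP|exact: emeasurable_funM].
      + by apply: emeasurable_funD => //; exact: emeasurable_funM.
      + move=> x _; rewrite -!EFinM -!EFinD lee_fin.
        have lz0 : (0 <= l * Z i x)%R by rewrite mulr_ge0// ltW.
        have := expRN_le_quad lz0; rewrite mulNr.
        have : (0 <= Z i x / (v0 * m))%R by rewrite divr_ge0// ltW.
        move=> /sqr_le_expR; rewrite expr_div_n => hq.
        have : (4 * l ^+ 2 * (v0 * m) ^+ 2 * (Z i x ^+ 2 / (v0 * m) ^+ 2 / 4) <=
          4 * l ^+ 2 * (v0 * m) ^+ 2 * expR (Z i x / (v0 * m)))%R.
          by rewrite ler_wpM2l.
        have -> : (4 * l ^+ 2 * (v0 * m) ^+ 2 * (Z i x ^+ 2 / (v0 * m) ^+ 2 / 4) =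
          (l * Z i x) ^+ 2)%R by field; rewrite !gt_eqF.
        lra.
    - by move=> x _; rewrite -EFinM lee_fin mulr_ge0 ?expR_ge0.
    - exact: emeasurable_funM.
    - exact/measurable_EFinP.
    - by move=> x _; rewrite -EFinM lee_fin mulr_ge0// ltW.
    - exact: emeasurable_funM.
    - by move=> x _; rewrite lee_fin.
  move=> h.
  have : \int[P]_x (expR (- l * Z i x))%:E + (l * z i)%:E <=
      (1 + 8 * l ^+ 2 * (v0 * m) ^+ 2)%:E.
    rewrite EFinM fineK// (le_trans h)// EFinD leeD2l//.
    have -> : (8 * l ^+ 2 * (v0 * m) ^+ 2 = 4 * l ^+ 2 * (v0 * m) ^+ 2 * 2)%R by ring.
    by rewrite [X in _ <= X]EFinM lee_wpmul2l// lee_fin.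
  rewrite -leeBrDr// -EFinB => /le_trans; apply; rewrite lee_fin.
  by rewrite (le_trans _ (expR_ge1Dx _))//; lra.
have := chernoff_exp_sum (- (l * (n%:R * m / 2)))%R lem.
rewrite (_ : [set x | _] = [set x | (\sum_i Z i x < n%:R * m / 2)%R]); last first.
  by apply/seteqP; split => x /=; rewrite mulNr opprK addrC subr_gt0 ltr_pM2l.
move=> /le_trans; apply; rewrite lee_fin -expR_prod big_split/= -mulr_sumr sz.
rewrite sumr_const card_ord -expRD ler_expR le_eqVlt; apply/orP; left; apply/eqP.
rewrite -mulr_natl /l; field; by rewrite !gt_eqF.
Qed.

End chernoff.

Section random_design.
Context d (T : measurableType d) (R : realType) (P : probability T R).
Context (n p : nat) (v0 : R) (Sigma : 'M[R]_p) (X : T -> 'M[R]_(n, p)).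
Hypothesis n0 : (0 < n)%N.
Hypothesis v00 : 0 < v0.
Hypothesis mX : measurable_fun setT X.
Hypothesis iid : iid_rows P X.
Hypothesis cov : (forall j k, 'E_P[fun w => ((n%:R^-1 *: ((X w)^T *m X w)) j k)%R]
               = (Sigma j k)%:E)%E.
Hypothesis subG : sub_gaussian_rows P v0 Sigma X.

Lemma cov_sym : Sigma^T = Sigma.
Proof.
apply/matrixP => j k; rewrite mxE; apply: EFin_inj; rewrite -!cov.
congr expectation; apply/funext => w; rewrite !mxE; congr (_ * _).
by apply: eq_bigr => i _; rewrite !mxE mulrC.
Qed.

Lemma measurable_mx_entry i j : measurable_fun setT (fun w => X w i j).
Proof. exact: measurableT_comp (measurable_entry i j) mX. Qed.

Lemma measurable_mulmx_entry (b : 'cV[R]_p) i :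
  measurable_fun setT (fun w => (X w *m b) i 0).
Proof.
under eq_fun do rewrite mxE.
apply: measurable_sum => j; apply: measurable_funM => //.
exact: measurable_mx_entry.
Qed.

Lemma mean_sq_design (b : 'cV[R]_p) :
  (\int[P]_w (\sum_i ((X w *m b) i 0) ^+ 2)%:E = (n%:R * quadf Sigma b)%:E)%E.
Proof.
pose Q j k w := ((n%:R^-1 *: ((X w)^T *m X w)) j k).
have mQ j k : measurable_fun setT (Q j k).
  rewrite /Q; under eq_fun do rewrite !mxE.
  apply: measurable_funM => //; apply: measurable_sum => i.
  under eq_fun do rewrite mxE.
  by apply: measurable_funM; exact: measurable_mx_entry.
have iQ j k : (\int[P]_w (Q j k w)%:E = (Sigma j k)%:E)%E.
  by rewrite -cov unlock.
(* [cov] makes the integral finite, and this already forces integrability. *)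
have intQ j k : P.-integrable setT (fun w => (Q j k w)%:E).
  apply/integrableP; split; first exact/measurable_EFinP.
  by rewrite integral_fin_num_abs// iQ.
have n0' : n%:R != 0 :> R by rewrite pnatr_eq0 -lt0n.
transitivity (\int[P]_w (\sum_j \sum_k (n%:R * b j 0 * b k 0)%:E * (Q j k w)%:E)%E)%E.
  apply: eq_integral => w _.
  under [RHS]eq_bigr do under eq_bigr do rewrite -EFinM.
  under [RHS]eq_bigr do rewrite sumEFin.
  rewrite sumEFin; congr EFin.
  rewrite -sqr_l2norm sqr_l2norm_dotp dotp_mull mulmxA.
  rewrite -[(X w)^T *m X w](scalerKV n0') -scalemxAl dotpZr mulr_sumr.
  apply: eq_bigr => j _; rewrite mxE !mulr_sumr; apply: eq_bigr => k _.
  by rewrite -/(Q j k w); ring.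
rewrite integral_sum//; last first.
  by move=> j; apply: integrable_sum => // k _; apply: integrableZl.
under eq_bigr => j _.
  rewrite integral_sum//; last by move=> k; apply: integrableZl.
  under eq_bigr => k _ do rewrite integralZl// iQ -EFinM.
  rewrite sumEFin; over.
rewrite sumEFin; congr EFin; rewrite quadf_dotp mulr_sumr.
apply: eq_bigr => j _; rewrite mxE !mulr_sumr; apply: eq_bigr => k _; ring.
Qed.

Section fixed_direction.
Context (b : 'cV[R]_p).
Hypothesis b0 : 0 < quadf Sigma b.

Let Z i w := ((X w *m b) i 0) ^+ 2.

Let mZ i : measurable_fun setT (Z i).
Proof. by apply: measurable_funX; exact: measurable_mulmx_entry. Qed.

Let Z0 i w : 0 <= Z i w. Proof. exact: sqr_ge0. Qed.

Let indepZ (f : 'I_n -> R -> R) :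
  (forall i, measurable_fun setT (f i)) -> (forall i y, 0 <= f i y)%R ->
  (forall i, \int[P]_x (f i (Z i x))%:E < +oo)%E ->
  (\int[P]_x (\prod_i f i (Z i x))%:E = \prod_i \int[P]_x (f i (Z i x))%:E)%E.
Proof.
move=> mf f0 foo.
pose h (r : 'rV[R]_p) : R := ((r *m b) 0 0) ^+ 2.
have mh : measurable_fun setT h.
  apply: measurable_funX; under eq_fun do rewrite mxE.
  apply: measurable_sum => j; apply: measurable_funM => //.
  exact: measurable_entry.
have hE i w : Z i w = h (row i (X w)) by rewrite /Z /h -row_mul [in RHS]mxE.
have foo' i : (\int[P]_x (f i (h (row i (X x))))%:E < +oo)%E.
  by under eq_integral do rewrite -hE.
have := @indep_integral_prod _ T R P _ _ n (fun i w => row i (X w))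
  (fun i => f i \o h) iid.1 _ _ _ foo'.
move=> H; transitivity (\int[P]_x (\prod_i f i (h (row i (X x))))%:E)%E.
  by apply: eq_integral => w _; congr EFin; apply: eq_bigr => i _; rewrite hE.
transitivity (\prod_i \int[P]_x (f i (h (row i (X x))))%:E)%E; last first.
  by apply: eq_bigr => i _; apply: eq_integral => w _; rewrite hE.
apply: H.
- by move=> i; apply: measurableT_comp (measurable_row i) mX.
- by move=> i; apply: measurableT_comp.
- by move=> i y; exact: f0.
Qed.

Let expZ i : (\int[P]_x (expR (Z i x / (v0 * quadf Sigma b)))%:E <= 2%:E)%E.
Proof.
have bn0 : b != 0.
  by apply: contraTneq b0 => ->; rewrite quadf_dotp mulmx0 /dotp big1 ?ltxx// => k _; rewrite !mxE mul0r.
have := subG i; apply: le_trans.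
apply: (@le_trans _ _ ('E_P[fun w => expR (Z i w / (v0 * quadf Sigma b) + v0^-1)])%E).
  rewrite unlock; apply: ge0_le_integral => //.
  - apply/measurable_EFinP; apply: measurableT_comp => //.
    exact: measurable_funM.
  - apply/measurable_EFinP; apply: measurableT_comp => //.
    by apply: measurable_funD => //; exact: measurable_funM.
  - by move=> x _; rewrite lee_fin ler_expR lerDl invr_ge0 ltW.
by apply: ereal_sup_ubound; exists b.
Qed.

Lemma design_upper_tail :
  (P [set w | (2 * v0 * n%:R * quadf Sigma b < l2norm (X w *m b) ^+ 2)%R]
    <= (expR (- n%:R))%:E)%E.
Proof.
have -> : [set w | 2 * v0 * n%:R * quadf Sigma b < l2norm (X w *m b) ^+ 2] =
  [set w | 2 * v0 * n%:R * quadf Sigma b < \sum_i Z i w].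
  by apply/seteqP; split => w /=; rewrite sqr_l2norm.
exact: chernoff_upper.
Qed.

Lemma design_lower_tail :
  (P [set w | (l2norm (X w *m b) ^+ 2 < n%:R * quadf Sigma b / 2)%R]
    <= (expR (- n%:R / (128 * v0 ^+ 2)))%:E)%E.
Proof.
have -> : [set w | (l2norm (X w *m b) ^+ 2 < n%:R * quadf Sigma b / 2)%R] =
  [set w | \sum_i Z i w < n%:R * quadf Sigma b / 2].
  by apply/seteqP; split => w /=; rewrite sqr_l2norm.
by apply: chernoff_lower => //; exact: mean_sq_design.
Qed.

End fixed_direction.

End random_design.

(** * Gaussian noise *)

Section normal_mgf.
Local Open Scope ereal_scope.
Context (R : realType) (sigma : R).
Hypothesis s0 : (0 < sigma)%R.

Lemma ge0_integral_normal_prob (f : R -> R) :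
  measurable_fun setT f -> (forall x, 0 <= f x)%R ->
  \int[normal_prob 0 sigma]_x (f x)%:E =
  \int[lebesgue_measure]_x (normal_pdf 0 sigma x * f x)%:E.
Proof.
move=> mf f0.
transitivity (\int[normal_prob 0 sigma]_x (cst 1 x * f x)%R%:E).
  by apply: eq_integral => x _; rewrite mul1r.
apply: (ge0_integral_transfer (Y := idfun) (Y1 := idfun)) => //.
- exact: measurable_id.
- exact: measurable_id.
- exact: measurable_normal_pdf.
- by move=> x; exact: normal_pdf_ge0.
move=> A mA; under eq_integral do rewrite mul1r.
rewrite integral_indic// setIT.
transitivity (\int[lebesgue_measure]_(x in A) (normal_pdf 0 sigma x)%:E); first by [].
rewrite [LHS]integral_mkcond.
apply: eq_integral => x _; rewrite /patch indicE.
by case: ifP; rewrite ?mulr1 ?mulr0.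
Qed.

(** Completing the square: the tilted density is a constant times the normal density with mean v
    sigma^2 / (1 + mu) and variance sigma^2 / (1 + mu). The quadratic tilt [mu] is what later allows
    comparison with |e|^2. *)
Lemma normal_mgf (v mu : R) : (0 < 1 + mu)%R ->
  \int[normal_prob 0 sigma]_x (expR (v * x - mu * x ^+ 2 / (2 * sigma ^+ 2)))%:E =
  ((Num.sqrt (1 + mu))^-1 * expR (sigma ^+ 2 * v ^+ 2 / (2 * (1 + mu))))%:E.
Proof.
move=> mu1.
have q0 : (0 < Num.sqrt (1 + mu))%R by rewrite sqrtr_gt0.
have q2 : (Num.sqrt (1 + mu) ^+ 2 = 1 + mu)%R by rewrite sqr_sqrtr ?ltW.
set q := Num.sqrt (1 + mu) in q0 q2 *.
rewrite ge0_integral_normal_prob//; last first.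
  apply: measurableT_comp => //; apply: measurable_funB; first exact: measurable_funM.
  by apply: measurable_funM => //; apply: measurable_funM => //; exact: measurable_funX.
pose s' : R := (sigma / q)%R; pose m' : R := (v * sigma ^+ 2 / (1 + mu))%R.
have s'0 : (0 < s')%R by rewrite divr_gt0.
pose K : R := (q^-1 * expR (sigma ^+ 2 * v ^+ 2 / (2 * (1 + mu))))%R.
transitivity (\int[lebesgue_measure]_x (K%:E * (normal_pdf m' s' x)%:E)); last first.
  rewrite ge0_integralZl//.
  - by rewrite integral_normal_pdf mule1.
  - apply/measurable_EFinP; exact: measurable_normal_pdf.
  - by move=> x _; rewrite lee_fin normal_pdf_ge0.
  - by rewrite lee_fin mulr_ge0 ?expR_ge0// invr_ge0 ltW.
apply: eq_integral => x _; rewrite -EFinM; congr EFin.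
rewrite !normal_pdfE ?gt_eqF//= /normal_fun /K.
have -> : normal_peak sigma = (normal_peak s' / q)%R.
  rewrite /normal_peak -invfM; congr GRing.inv.
  have -> : (sigma ^+ 2 * pi *+ 2 = s' ^+ 2 * pi *+ 2 * q ^+ 2 :> R)%R.
    rewrite /s' expr_div_n; move: (pi : R) => P.
    by field; rewrite gt_eqF.
  rewrite sqrtrM; last by rewrite mulrn_wge0// mulr_ge0 ?sqr_ge0 ?pi_ge0.
  by rewrite sqrtr_sqr ger0_norm// ltW.
set c := (sigma ^+ 2 * v ^+ 2 / (2 * (1 + mu)))%R.
set a := (- (x - 0) ^+ 2 / _)%R; set b := (v * x - _)%R; set d := (- (x - m') ^+ 2 / _)%R.
have e : (expR a * expR b = expR c * expR d)%R.
  rewrite -!expRD; congr expR; rewrite /a /b /c /d /s' /m' expr_div_n q2 subr0.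
  field.
  by rewrite !gt_eqF.
by rewrite -(mulrA _ (expR a)) e (mulrC _ q^-1)%R -!mulrA; congr (_ * _)%R; rewrite mulrCA.
Qed.

End normal_mgf.

Section gaussian_vector.
Local Open Scope ereal_scope.
Context d (T : measurableType d) (R : realType) (P : probability T R).
Context (n : nat) (sigma : R) (e : T -> 'cV[R]_n).
Hypothesis s0 : (0 < sigma)%R.
Hypothesis me : measurable_fun setT e.
Hypothesis gauss : isotropic_gaussian P sigma e.

Lemma measurable_coord i : measurable_fun setT (fun w => e w i 0%R).
Proof. exact: measurableT_comp (measurable_entry i 0%R) me. Qed.

Lemma ge0_integral_coord i (f : R -> R) :
  measurable_fun setT f -> (forall x, 0 <= f x)%R ->
  \int[P]_w (f (e w i 0))%:E = \int[normal_prob 0 sigma]_x (f x)%:E.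
Proof.
move=> mf f0.
transitivity (\int[P]_w (cst 1 w * f (e w i 0))%R%:E).
  by apply: eq_integral => x _; rewrite mul1r.
transitivity (\int[normal_prob 0 sigma]_x (cst 1 x * f (idfun x))%R%:E); last first.
  by apply: eq_integral => x _; rewrite mul1r.
apply: (@ge0_integral_transfer _ T _ _ _ _ R P (normal_prob 0 sigma) (fun w => e w i 0%R) idfun (cst 1%R) (cst 1%R) f) => //.
- exact: measurable_coord.
- exact: measurable_id.
move=> A mA.
transitivity (P ((fun w => e w i 0%R) @^-1` A)).
  rewrite -[X in _ = P X]setIT -integral_indic//; last first.
    by rewrite -[_ @^-1` _]setTI; exact: measurable_coord.
  by apply: eq_integral => x _; rewrite mul1r.
rewrite (gauss.2 i A mA); under eq_integral do rewrite mul1r.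
by rewrite integral_indic// setIT.
Qed.

Lemma gaussian_mgf (v mu : 'I_n -> R) : (forall i, 0 < 1 + mu i)%R ->
  \int[P]_w (expR (\sum_i (v i * e w i 0 - mu i * e w i 0 ^+ 2 / (2 * sigma ^+ 2))))%:E =
  (\prod_i ((Num.sqrt (1 + mu i))^-1 *
    expR (sigma ^+ 2 * v i ^+ 2 / (2 * (1 + mu i)))))%:E.
Proof.
move=> hmu.
pose f i x : R := expR (v i * x - mu i * x ^+ 2 / (2 * sigma ^+ 2))%R.
have mf i : measurable_fun setT (f i).
  apply: measurableT_comp => //; apply: measurable_funB; first exact: measurable_funM.
  by apply: measurable_funM => //; apply: measurable_funM => //; exact: measurable_funX.
have f0 i x : (0 <= f i x)%R by rewrite expR_ge0.
have fE i : \int[P]_w (f i (e w i 0))%:E =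
  ((Num.sqrt (1 + mu i))^-1 * expR (sigma ^+ 2 * v i ^+ 2 / (2 * (1 + mu i))))%:E.
  by rewrite ge0_integral_coord// normal_mgf.
rewrite -prodEFin.
under [RHS]eq_bigr do rewrite -fE.
rewrite -(indep_integral_prod (X := fun i w => e w i 0%R) gauss.1) //.
- by apply: eq_integral => w _; rewrite expR_prod.
- exact: measurable_coord.
- by move=> i; rewrite fE ltry.
Qed.

Lemma gaussian_mgf_iso (v : 'cV[R]_n) (mu : R) : (0 < 1 + mu)%R ->
  \int[P]_w (expR (dotp v (e w) - mu * l2norm (e w) ^+ 2 / (2 * sigma ^+ 2)))%:E =
  ((Num.sqrt (1 + mu))^-1 ^+ n * expR (sigma ^+ 2 * l2norm v ^+ 2 / (2 * (1 + mu))))%:E.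
Proof.
move=> hmu; have := @gaussian_mgf (fun i => v i 0%R) (fun=> mu) (fun=> hmu).
rewrite big_split/= prodr_const card_ord -expR_prod -mulr_suml -mulr_sumr.
rewrite -sqr_l2norm => <-; apply: eq_integral => w _; congr (expR _)%:E.
by rewrite sumrB -mulr_suml -mulr_sumr -sqr_l2norm.
Qed.

Lemma gaussian_mgf_sub (J : {set 'I_n}) (theta : R) : (theta < 1)%R ->
  \int[P]_w (expR (theta * (\sum_(i in J) e w i 0 ^+ 2) / (2 * sigma ^+ 2)))%:E =
  ((Num.sqrt (1 - theta))^-1 ^+ #|J|)%:E.
Proof.
move=> ht.
have := @gaussian_mgf (fun=> 0%R) (fun i => if i \in J then - theta else 0)%R.
rewrite (_ : (fun w => _) = (fun w =>
    (expR (theta * (\sum_(i in J) e w i 0 ^+ 2) / (2 * sigma ^+ 2)))%:E)); last first.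
  apply/funext => w; congr (expR _)%:E.
  rewrite [in RHS]big_mkcond mulr_sumr mulr_suml; apply: eq_bigr => i _.
  by case: ifP => _; rewrite mul0r sub0r ?mul0r ?oppr0 ?mulr0 ?mul0r ?mulNr ?opprK.
move=> ->; last first.
  by move=> i; case: ifP => _; [rewrite subr_gt0|rewrite addr0].
congr EFin; rewrite (bigID (mem J))/= [X in (_ * X)%R]big1 ?mulr1; last first.
  by move=> i /negbTE ->; rewrite addr0 sqrtr1 invr1 expr0n/= mulr0 mul0r expR0 mulr1.
rewrite -prodr_const; apply: eq_bigr => i ->.
by rewrite expr0n/= mulr0 mul0r expR0 mulr1.
Qed.

(** Tilting with mu = -1/2: the mean of exp(|e|^2 / (4 sigma^2)) is 2^(n/2) <= e^(n/2), against the
    threshold e^n. *)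
Lemma gaussian_norm_tail :
  P [set w | (4 * n%:R * sigma ^+ 2 < l2norm (e w) ^+ 2)%R] <= (expR (- n%:R / 2))%:E.
Proof.
have m2 : measurable_fun setT (fun w => l2norm (e w) ^+ 2)%R.
  under eq_fun do rewrite sqr_l2norm.
  by apply: measurable_sum => i; apply: measurable_funX; exact: measurable_coord.
have s2 : (0 < 4 * sigma ^+ 2)%R by rewrite mulr_gt0 ?exprn_gt0.
pose f w := expR (dotp 0 (e w) - (- 2^-1) * l2norm (e w) ^+ 2 / (2 * sigma ^+ 2)).
have fE w : f w = expR (l2norm (e w) ^+ 2 / (4 * sigma ^+ 2)).
  congr expR; rewrite /dotp big1 => [|i _]; last by rewrite mxE mul0r.
  by field; rewrite gt_eqF.
have mf : measurable_fun setT f.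
  rewrite (_ : f = fun w => expR (l2norm (e w) ^+ 2 / (4 * sigma ^+ 2))); last first.
    by apply/funext => w; rewrite fE.
  by apply: measurableT_comp => //; exact: measurable_funM.
apply: (@le_trans _ _ (\int[P]_w ((expR (- n%:R))%:E * (f w)%:E))).
  apply: (@le_trans _ _ (\int[P]_w (expR (- n%:R) * f w)%:E)); last first.
    by under eq_integral do rewrite EFinM.
  apply: measure_le_integral.
  - exact: measurable_set_lt.
  - exact: measurable_funM.
  - by move=> w; rewrite mulr_ge0 ?expR_ge0.
  - move=> w /= h; rewrite fE -expRD -[leLHS]expR0 ler_expR addrC subr_ge0 ler_pdivlMr//.
    by rewrite mulrCA mulrA; exact: ltW.
rewrite ge0_integralZl//; last 2 first.
- exact/measurable_EFinP.
- by move=> w _; rewrite lee_fin expR_ge0.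
rewrite /f gaussian_mgf_iso; last by lra.
rewrite l2norm0 expr0n/= mulr0 mul0r expR0 mulr1 -EFinM lee_fin.
have -> : (- n%:R / 2 = - n%:R + n%:R * (1 / 2) :> R)%R by field.
rewrite expRD expRM_natl ler_wpM2l ?expR_ge0// lerXn2r ?nnegrE ?invr_ge0 ?sqrtr_ge0 ?expR_ge0//.
rewrite -(@ler_pXn2r _ 2)// ?nnegrE ?invr_ge0 ?sqrtr_ge0 ?expR_ge0//.
rewrite exprVn sqr_sqrtr; last by lra.
rewrite -expRM_natl; have -> : (2 * (1 / 2) = 1 :> R)%R by field.
have -> : ((1 - 2^-1)^-1 = 1 + 1 :> R)%R by field.
exact: expR_ge1Dx.
Qed.

End gaussian_vector.

Lemma sqr_l2normZ (R : realType) k (a : R) (u : 'cV[R]_k) :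
  l2norm (a *: u) ^+ 2 = a ^+ 2 * l2norm u ^+ 2.
Proof. by rewrite !sqr_l2norm_dotp dotpZl dotpZr mulrA expr2. Qed.

Lemma mgf_exponent_le (R : realType) (sigma a s m z S : R) :
  0 < sigma -> 0 < a -> 0 <= s -> 0 < m -> z <= a ^+ 2 * S ->
  sigma ^+ 2 * (s / (sigma ^+ 2 * a) ^+ 2 * z) / (2 * m) <=
  s / m * S / (2 * sigma ^+ 2).
Proof.
move=> s0 a0 s_0 m0 hz.
have q0 : 0 <= sigma ^+ 2 * (s / (sigma ^+ 2 * a) ^+ 2) / (2 * m).
  apply: divr_ge0; last by rewrite mulr_ge0// ltW.
  by apply: mulr_ge0; [exact: sqr_ge0|apply: divr_ge0 => //; exact: sqr_ge0].
have := ler_wpM2l q0 hz.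
have -> : sigma ^+ 2 * (s / (sigma ^+ 2 * a) ^+ 2) / (2 * m) * (a ^+ 2 * S) =
  s / m * S / (2 * sigma ^+ 2) by field; rewrite !gt_eqF.
by apply: le_trans; rewrite le_eqVlt; apply/orP; left; apply/eqP; ring.
Qed.

Lemma ge0_integralZl_exp d (T : measurableType d) (R : realType)
    (P : {measure set T -> \bar R}) (c : R) (f : T -> R) :
  measurable_fun setT f -> 0 <= c ->
  (\int[P]_x (c%:E * (expR (f x))%:E) = c%:E * \int[P]_x (expR (f x))%:E)%E.
Proof.
move=> mf c0; rewrite ge0_integralZl//.
by apply/measurable_EFinP; exact: measurableT_comp.
Qed.

(** * Decoupling and the self-normalised Gaussian tail *)

Section decoupling.
Local Open Scope ereal_scope.
Context d (T : measurableType d) (R : realType) (P : probability T R).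
Context (n : nat) (sigma : R) (e : T -> 'cV[R]_n).
Hypothesis s0 : (0 < sigma)%R.
Hypothesis me : measurable_fun setT e.
Hypothesis gauss : isotropic_gaussian P sigma e.

(* The square in the exponent is linearised by an independent copy e' of e,
   exp(c^2 sigma^2 |v|^2 / 2) = E exp(c <v, e'>), and Tonelli integrates e first. *)
Lemma gaussian_quad_mgf (B : 'M[R]_n) (J : {set 'I_n}) (a s mu : R) :
  (0 < a)%R -> (0 <= s)%R -> (0 < 1 + mu)%R -> (s < 1 + mu)%R ->
  (forall u, l2norm (B *m u) ^+ 2 <= a ^+ 2 * \sum_(i in J) u i 0%R ^+ 2)%R ->
  \int[P]_w (expR (s / (2 * sigma ^+ 2) * (l2norm (B^T *m e w) ^+ 2 / a ^+ 2)
                   - mu * l2norm (e w) ^+ 2 / (2 * sigma ^+ 2)))%:E <=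
  ((Num.sqrt (1 + mu))^-1 ^+ n * (Num.sqrt (1 - s / (1 + mu)))^-1 ^+ #|J|)%:E.
Proof.
move=> a0 s_0 mu1 smu hB.
have hs : (s / (1 + mu) < 1)%R by rewrite ltr_pdivrMr// mul1r.
(* Chosen so that averaging exp <c B^T e, e'> over the copy e' yields exactly the quadratic exponent
   of the statement, see [scaleE]. *)
pose c : R := (Num.sqrt s / (sigma ^+ 2 * a))%R.
have c2 : (c ^+ 2 = s / (sigma ^+ 2 * a) ^+ 2)%R by rewrite expr_div_n sqr_sqrtr.
have scaleE (z : 'cV[R]_n) : (sigma ^+ 2 * l2norm (c *: z) ^+ 2 / (2 * 1) =
    s / (2 * sigma ^+ 2) * (l2norm z ^+ 2 / a ^+ 2))%R.
  rewrite sqr_l2normZ c2; move: (l2norm z) => r.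
  by field; rewrite !gt_eqF.
pose g (z : T * T) : R :=
  expR (dotp (c *: (B^T *m e z.1)) (e z.2) - mu * l2norm (e z.1) ^+ 2 / (2 * sigma ^+ 2)).
have mc1 i : measurable_fun setT (fun z : T * T => e z.1 i 0%R).
  exact: measurableT_comp (measurable_coord me i) measurable_fst.
have mc2 i : measurable_fun setT (fun z : T * T => e z.2 i 0%R).
  exact: measurableT_comp (measurable_coord me i) measurable_snd.
have mg : measurable_fun setT g.
  apply: measurableT_comp => //; apply: measurable_funB.
    apply: measurable_sum => i; apply: measurable_funM => //.
    under eq_fun do rewrite mxE.
    apply: measurable_funM => //; under eq_fun do rewrite mxE.
    by apply: measurable_sum => k; apply: measurable_funM.
  apply: measurable_funM => //; apply: measurable_funM => //.
  under eq_fun do rewrite sqr_l2norm.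
  by apply: measurable_sum => i; exact: measurable_funX.
have mEg : measurable_fun setT (EFin \o g) by exact/measurable_EFinP.
have g0 z : 0 <= (EFin \o g) z by rewrite lee_fin expR_ge0.
have tonelli := @fubini_tonelli _ _ T T R P P _ mEg g0.
rewrite [X in X <= _](_ : _ = \int[P]_x \int[P]_y (EFin \o g) (x, y)); last first.
  apply: eq_integral => x _; apply/esym; rewrite /g.
  have md : measurable_fun setT (fun y => dotp (c *: (B^T *m e x)) (e y)).
    apply: measurable_sum => i.
    by apply: measurable_funM; [exact: measurable_cst|exact: measurable_coord].
  transitivity (\int[P]_y ((expR (- (mu * l2norm (e x) ^+ 2 / (2 * sigma ^+ 2))))%:E *
      (expR (dotp (c *: (B^T *m e x)) (e y)))%:E)).
    by apply: eq_integral => y _; rewrite -EFinM -expRD addrC.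
  apply: (etrans (ge0_integralZl_exp P md (expR_ge0 _))).
  have := gaussian_mgf_iso s0 me gauss (c *: (B^T *m e x)) (mu := 0%R) ltac:(lra).
  rewrite (_ : (fun w => _) = (fun y => (expR (dotp (c *: (B^T *m e x)) (e y)))%:E)); last first.
    by apply/funext => y; rewrite !mul0r subr0.
  move=> ->; rewrite addr0 sqrtr1 invr1 expr1n mul1r -EFinM -expRD addrC.
  by rewrite scaleE.
rewrite tonelli.
(* Integrating the first copy moves [B] onto the second, where [hB] sees only the coordinates in
   [J]: the second factor gets the exponent #|J| instead of [n]. *)
have inner y : \int[P]_x (EFin \o g) (x, y) = ((Num.sqrt (1 + mu))^-1 ^+ n *
    expR (sigma ^+ 2 * l2norm (c *: (B *m e y)) ^+ 2 / (2 * (1 + mu))))%:E.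
  rewrite -(gaussian_mgf_iso s0 me gauss (c *: (B *m e y)) mu1).
  apply: eq_integral => x _; rewrite /g.
  have sw : dotp (c *: (B^T *m e x)) (e y) = dotp (c *: (B *m e y)) (e x).
    by rewrite dotpZl dotp_mull trmxK dotpC -dotpZl.
  by rewrite -sw.
rewrite (eq_integral _ _ (fun y _ => inner y)).
have mS : measurable_fun setT (fun y => \sum_(i in J) e y i 0 ^+ 2)%R.
  rewrite (_ : (fun y => _) =
    (fun y => \sum_(i <- [seq i <- index_enum 'I_n | i \in J]) e y i 0 ^+ 2)%R).
    by apply: measurable_sum => i; apply: measurable_funX; exact: measurable_coord.
  by apply/funext => y; rewrite big_filter.
have mS' : measurable_fun setT
    (fun y => s / (1 + mu) * (\sum_(i in J) e y i 0 ^+ 2) / (2 * sigma ^+ 2))%R.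
  apply: measurable_funM; last exact: measurable_cst.
  by apply: measurable_funM; [exact: measurable_cst|exact: mS].
apply: (@le_trans _ _ (\int[P]_y (((Num.sqrt (1 + mu))^-1 ^+ n)%:E *
   (expR (s / (1 + mu) * (\sum_(i in J) e y i 0%R ^+ 2) / (2 * sigma ^+ 2)))%:E))).
  apply: ge0_le_integral.
  - exact: measurableT.
  - by move=> y _; rewrite lee_fin mulr_ge0 ?expR_ge0// exprn_ge0// invr_ge0 sqrtr_ge0.
  - apply/measurable_EFinP; apply: measurable_funM; first exact: measurable_cst.
    apply: measurableT_comp; first exact: measurable_expR.
    apply: measurable_funM; last exact: measurable_cst.
    apply: measurable_funM; first exact: measurable_cst.
    under eq_fun do rewrite sqr_l2norm.
    apply: measurable_sum => i; apply: measurable_funX.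
    under eq_fun do rewrite mxE.
    apply: measurable_funM; first exact: measurable_cst.
    under eq_fun do rewrite mxE.
    apply: measurable_sum => k.
    by apply: measurable_funM; [exact: measurable_cst|exact: measurable_coord].
  - apply/measurable_EFinP; apply: measurable_funM; first exact: measurable_cst.
    by apply: measurableT_comp; first exact: measurable_expR.
  - move=> y _; rewrite -EFinM lee_fin.
    apply: ler_wpM2l; first by rewrite exprn_ge0 ?invr_ge0 ?sqrtr_ge0.
    rewrite ler_expR sqr_l2normZ c2.
    exact: (mgf_exponent_le s0 a0 s_0 mu1 (hB (e y))).
rewrite (ge0_integralZl_exp P mS'); last by rewrite exprn_ge0 ?invr_ge0 ?sqrtr_ge0.
by rewrite (gaussian_mgf_sub s0 me gauss J hs) -EFinM lexx.
Qed.

End decoupling.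

Section padding.
Context (R : realType) (n k : nat) (kn : (k <= n)%N).

(* Padding by zero columns turns an n x k matrix into a square one, so that the
   independent copy in gaussian_quad_mgf can have the law of the noise itself. *)
Definition pad_mx : 'M[R]_(k, n) := \matrix_(i, l) (widen_ord kn i == l)%:R.

Lemma pad_mulE (u : 'cV[R]_n) i : (pad_mx *m u) i 0 = u (widen_ord kn i) 0.
Proof.
rewrite mxE (bigD1 (widen_ord kn i))//= mxE eqxx mul1r big1 ?addr0// => l hl.
by rewrite mxE eq_sym (negbTE hl) mul0r.
Qed.

Lemma pad_mul_tr : pad_mx *m pad_mx^T = 1%:M.
Proof.
apply/matrixP => i j; rewrite !mxE (bigD1 (widen_ord kn i))//= !mxE eqxx mul1r.
rewrite big1 ?addr0 => [|l hl]; last by rewrite !mxE eq_sym (negbTE hl) mul0r.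
by congr (_%:R); rewrite eq_sym; congr nat_of_bool; apply/eqP/eqP => [[/val_inj]|->].
Qed.

Lemma l2norm_pad_tr (v : 'cV[R]_k) : l2norm (pad_mx^T *m v) ^+ 2 = l2norm v ^+ 2.
Proof.
by rewrite !sqr_l2norm_dotp dotp_mull trmxK mulmxA pad_mul_tr mul1mx.
Qed.

Lemma sqr_l2norm_pad (u : 'cV[R]_n) :
  l2norm (pad_mx *m u) ^+ 2 = \sum_(l in [set widen_ord kn i | i : 'I_k]%SET) u l 0 ^+ 2.
Proof.
rewrite sqr_l2norm big_imset/=; last by move=> i j _ _ [] /val_inj.
by apply: eq_big => [i|i _]; [rewrite inE|rewrite pad_mulE].
Qed.

Lemma card_pad : #|[set widen_ord kn i | i : 'I_k]%SET| = k.
Proof. by rewrite card_imset ?card_ord// => i j [] /val_inj. Qed.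

End padding.

Section gaussian_tail.
Context d (T : measurableType d) (R : realType) (P : probability T R).
Context (n : nat) (sigma : R) (e : T -> 'cV[R]_n).
Hypothesis n0 : (0 < n)%N.
Hypothesis s0 : (0 < sigma)%R.
Hypothesis me : measurable_fun setT e.
Hypothesis gauss : isotropic_gaussian P sigma e.

Lemma measurable_sqr_l2norm_mulmx k (A : 'M[R]_(k, n)) :
  measurable_fun setT (fun w => l2norm (A *m e w) ^+ 2).
Proof.
under eq_fun do rewrite sqr_l2norm.
apply: measurable_sum => i; apply: measurable_funX.
under eq_fun do rewrite mxE.
apply: measurable_sum => l.
by apply: measurable_funM; [exact: measurable_cst|exact: measurable_coord].
Qed.

Lemma sqrt1B_le_expR (x : R) : 0 <= 1 - x -> Num.sqrt (1 - x) <= expR (- x / 2).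
Proof.
move=> x1; rewrite -(@ler_pXn2r _ 2)// ?nnegrE ?sqrtr_ge0 ?expR_ge0//.
rewrite sqr_sqrtr// -expRM_natl (_ : 2 * (- x / 2) = - x); last by field.
exact: expR_ge1Dx.
Qed.

(** Both sides of the event are quadratic in [e], so the Chernoff exponent is s (|A^T e|^2 / a^2 -
    (tau/n) |e|^2) / (2 sigma^2), that is mu = s tau / n. Prescribing s / (1 + mu) = theta gives 1 +
    mu = 1/q with q = 1 - theta tau / n, and the normalising factor q^(n/2) is at most exp(-theta
    tau / 2), as if |e|^2 were equal to n sigma^2. *)
Lemma gaussian_dual_tail k (A : 'M[R]_(n, k)) (a theta tau : R) :
  (k <= n)%N -> 0 < a -> (forall h, l2norm (A *m h) <= a * l2norm h) ->
  0 < theta -> theta < 1 -> 0 <= tau -> theta * tau < n%:R ->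
  (P [set w | (tau * a ^+ 2 * l2norm (e w) ^+ 2 < n%:R * l2norm (A^T *m e w) ^+ 2)%R]
  <= (expR (- (theta * tau) / 2) * (Num.sqrt (1 - theta))^-1 ^+ k)%:E)%E.
Proof.
move=> kn a0 hA th0 th1 tau0 htau.
have n0' : 0 < n%:R :> R by rewrite ltr0n.
pose q := 1 - theta * tau / n%:R.
have q0 : 0 < q by rewrite subr_gt0 ltr_pdivrMr// mul1r.
pose mu := q^-1 - 1; pose s := theta / q.
have mu1E : 1 + mu = q^-1 by rewrite /mu addrCA subrr addr0.
have mu1 : 0 < 1 + mu by rewrite mu1E invr_gt0.
have s_0 : 0 <= s by rewrite divr_ge0 ?ltW.
have smu : s < 1 + mu by rewrite mu1E ltr_pdivrMr// mulVf ?gt_eqF.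
have sE : s / (1 + mu) = theta by rewrite mu1E /s invrK mulfVK ?gt_eqF.
have muE : mu = s * (tau / n%:R).
  by rewrite /mu /s /q; field; rewrite !gt_eqF// -[X in 0 < X](_ : q * n%:R = _) ?mulr_gt0// /q; field; rewrite gt_eqF.
pose B := A *m pad_mx R kn.
pose J := [set widen_ord kn i | i : 'I_k]%SET.
have hB u : l2norm (B *m u) ^+ 2 <= a ^+ 2 * \sum_(i in J) u i 0 ^+ 2.
  rewrite -sqr_l2norm_pad -exprMn lerXn2r ?nnegrE ?mulr_ge0 ?l2norm_ge0 ?(ltW a0)//.
  by rewrite /B -mulmxA hA.
have BE w : l2norm (B^T *m e w) ^+ 2 = l2norm (A^T *m e w) ^+ 2.
  by rewrite /B trmx_mul -mulmxA l2norm_pad_tr.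
have mA := measurable_sqr_l2norm_mulmx A^T.
have mI : measurable_fun setT (fun w => l2norm (e w) ^+ 2).
  by have := measurable_sqr_l2norm_mulmx 1%:M; under eq_fun do rewrite mul1mx.
apply: (@le_trans _ _ (\int[P]_w (expR (s / (2 * sigma ^+ 2) *
    (l2norm (A^T *m e w) ^+ 2 / a ^+ 2) - mu * l2norm (e w) ^+ 2 / (2 * sigma ^+ 2)))%:E)%E).
  apply: measure_le_integral.
  - by apply: measurable_set_lt; apply: measurable_funM.
  - apply: measurableT_comp; first exact: measurable_expR.
    apply: measurable_funB.
      by apply: measurable_funM; [exact: measurable_cst|apply: measurable_funM].
    by apply: measurable_funM; [apply: measurable_funM|].
  - by move=> w; exact: expR_ge0.
  - move=> w /= h; rewrite -[leLHS]expR0 ler_expR.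
    move: h; move: (l2norm (A^T *m e w)) (l2norm (e w)) => x z h.
    have -> : s / (2 * sigma ^+ 2) * (x ^+ 2 / a ^+ 2) - mu * z ^+ 2 / (2 * sigma ^+ 2) =
        s / (2 * sigma ^+ 2 * a ^+ 2 * n%:R) * (n%:R * x ^+ 2 - tau * a ^+ 2 * z ^+ 2).
      by rewrite muE; field; rewrite !gt_eqF.
    apply: mulr_ge0; last by rewrite subr_ge0 ltW.
    by rewrite divr_ge0// mulr_ge0 ?ler0n// mulr_ge0 ?sqr_ge0// mulr_ge0 ?sqr_ge0.
under eq_integral do rewrite -BE.
apply: le_trans (gaussian_quad_mgf s0 me gauss a0 s_0 mu1 smu hB) _.
rewrite sE card_pad lee_fin ler_wpM2r ?exprn_ge0 ?invr_ge0 ?sqrtr_ge0//.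
rewrite mu1E sqrtrV ?(ltW q0)// invrK.
have -> : - (theta * tau) / 2 = n%:R * (- (theta * tau / n%:R) / 2).
  by field; rewrite gt_eqF.
rewrite expRM_natl lerXn2r ?nnegrE ?sqrtr_ge0 ?expR_ge0//.
by apply: sqrt1B_le_expR; exact: ltW.
Qed.

Lemma gaussian_spectral_tail k (A : 'M[R]_(n, k)) (A1 L : R) :
  (0 < k)%N -> 1 < A1 -> 0 <= L ->
  (P [set w | (A1 * (Num.sqrt k%:R + Num.sqrt (2 * L)) * spectral_norm A * l2norm (e w)
               < Num.sqrt n%:R * l2norm (A^T *m e w))%R]
  <= (expR (- L - (A1 - 1) ^+ 2 / 2))%:E)%E.
Proof.
move=> k0 A11 L0.
set x := Num.sqrt k%:R; set y := Num.sqrt (2 * L).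
have A10 : 0 < A1 by lra.
have x2 : x ^+ 2 = k%:R by rewrite sqr_sqrtr.
have y2 : y ^+ 2 = 2 * L by rewrite sqr_sqrtr// mulr_ge0.
have x1 : 1 <= x by rewrite -sqrtr1 ler_sqrt ?ler0n// ler1n.
have x0 : 0 < x by lra.
have y0 : 0 <= y by exact: sqrtr_ge0.
have [a0|a0] := eqVneq (spectral_norm A) 0.
  rewrite (_ : [set w | _] = set0) ?measure0 ?lee_fin ?expR_ge0//.
  apply/seteqP; split => w //=; rewrite a0 mulr0 mul0r.
  have := spectral_norm_tr A (e w); rewrite a0 mul0r => h.
  by rewrite ltNge => /negP; apply; rewrite mulr_ge0_le0 ?sqrtr_ge0.
set a := spectral_norm A in a0 *.
have ap : 0 < a by rewrite lt0r a0 spectral_norm_ge0.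
set tau := (A1 * (x + y)) ^+ 2.
have D0 : 0 < A1 * (x + y) by rewrite mulr_gt0//; lra.
have tauk : k%:R <= tau.
  rewrite -x2 /tau lerXn2r ?nnegrE ?(ltW x0) ?(ltW D0)//.
  by nra.
set E := [set w | _].
have EE : E = [set w | (tau * a ^+ 2 * l2norm (e w) ^+ 2 < n%:R * l2norm (A^T *m e w) ^+ 2)%R].
  have n2 : Num.sqrt (n%:R : R) ^+ 2 = n%:R by rewrite sqr_sqrtr.
  have key w : (A1 * (x + y) * a * l2norm (e w) < Num.sqrt n%:R * l2norm (A^T *m e w)) =
      (tau * a ^+ 2 * l2norm (e w) ^+ 2 < n%:R * l2norm (A^T *m e w) ^+ 2).
    rewrite -(@ltr_pXn2r _ 2)//.
    - by rewrite /tau; move: (A1 * (x + y)) => D; rewrite !exprMn n2.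
    - rewrite nnegrE; apply: mulr_ge0; last exact: l2norm_ge0.
      by apply: mulr_ge0; exact: ltW.
    - by rewrite nnegrE; apply: mulr_ge0; [exact: sqrtr_ge0|exact: l2norm_ge0].
  by apply/seteqP; split => w; rewrite /E /= key.
rewrite EE.
(* For tau >= n the event is empty, as |A^T e| <= |A| |e|. Otherwise k <= tau < n, which is what the
   padding requires. *)
have [ntau|taun] := leP n%:R tau.
  rewrite (_ : [set w | _] = set0) ?measure0 ?lee_fin ?expR_ge0//.
  apply/seteqP; split => w //=; apply/negP; rewrite -leNgt -mulrA -exprMn.
  apply: ler_pM; rewrite ?ler0n ?sqr_ge0//.
  by rewrite lerXn2r ?nnegrE ?mulr_ge0 ?l2norm_ge0 ?(ltW ap)// spectral_norm_tr.
(* Not the minimiser [1 - theta = k / tau] of the Chernoff bound: with this choice the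
   estimate [1 + t <= exp t] suffices. *)
pose theta := 1 - x / (A1 ^+ 2 * (x + y)).
have xy0 : 0 < x + y by lra.
have A2 : 1 < A1 ^+ 2 by rewrite expr_gt1// ltW.
have DD : x < A1 ^+ 2 * (x + y) by nra.
have D20 : 0 < A1 ^+ 2 * (x + y) by lra.
have th0 : 0 < theta by rewrite subr_gt0 ltr_pdivrMr// mul1r.
have th1 : theta < 1 by rewrite ltrBlDr ltrDl divr_gt0.
have kn : (k <= n)%N by rewrite -(ler_nat R) (le_trans tauk)// ltW.
have htau : theta * tau < n%:R.
  by rewrite (le_lt_trans _ taun)// ler_piMl ?sqr_ge0// ltW.
apply: (le_trans (gaussian_dual_tail kn ap (l2norm_spectral A) th0 th1 (sqr_ge0 _) htau)).
rewrite lee_fin.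
have h1 : (Num.sqrt (1 - theta))^-1 <= expR (A1 - 1 + y / (2 * x)).
  have -> : 1 - theta = x / (A1 ^+ 2 * (x + y)) by rewrite /theta opprB addrCA subrr addr0.
  rewrite -sqrtrV ?divr_ge0 ?(ltW x0) ?(ltW D20)// invf_div.
  rewrite -(@ler_pXn2r _ 2)// ?nnegrE ?sqrtr_ge0 ?expR_ge0// sqr_sqrtr ?divr_ge0 ?(ltW x0) ?(ltW D20)//.
  have -> : A1 ^+ 2 * (x + y) / x = A1 ^+ 2 * (1 + y / x) by field; rewrite gt_eqF.
  rewrite expRD exprMn; apply: ler_pM; rewrite ?sqr_ge0//.
  - by rewrite addr_ge0// divr_ge0// ltW.
  - rewrite lerXn2r ?nnegrE ?expR_ge0 ?(ltW A10)//.
    by have := expR_ge1Dx (A1 - 1); rewrite addrCA subrr addr0.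
  - rewrite -expRM_natl (_ : 2 * (y / (2 * x)) = y / x); last by field; rewrite gt_eqF.
    exact: expR_ge1Dx.
apply: (@le_trans _ _ (expR (- (theta * tau) / 2) * expR (A1 - 1 + y / (2 * x)) ^+ k)).
  rewrite ler_wpM2l ?expR_ge0// lerXn2r ?nnegrE ?invr_ge0 ?sqrtr_ge0 ?expR_ge0//.
rewrite -expRM_natl -expRD ler_expR -x2.
have -> : L = y ^+ 2 / 2 by rewrite y2; field.
have -> : x ^+ 2 * (A1 - 1 + y / (2 * x)) = x ^+ 2 * (A1 - 1) + x * y / 2.
  by field; rewrite gt_eqF.
have -> : theta * tau = A1 ^+ 2 * (x + y) ^+ 2 - x * (x + y).
  by rewrite /theta /tau; field; rewrite !gt_eqF.
(* The left exponent equals -L minus half of the quantity in [e1] minus x^2 (A1 - 1)^2 / 2; the last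
   term suffices because x >= 1. *)
have e1 : 0 <= (A1 ^+ 2 - 1) * (2 * x * y + y ^+ 2).
  apply: mulr_ge0; first by lra.
  by apply: addr_ge0; [apply: mulr_ge0 => //; lra|exact: sqr_ge0].
have e2 : (A1 - 1) ^+ 2 <= x ^+ 2 * (A1 - 1) ^+ 2.
  by rewrite ler_peMl ?sqr_ge0// expr_ge1// ltW.
nra.
Qed.

End gaussian_tail.

(** * From a fixed design to the noise event *)

Section integer_direction.
Context (R : realType).

(* Restricting the supremum to integer directions makes the noise event measurable
   without proving that the spectral norm is a measurable function. *)
Lemma integer_direction n k (A : 'M[R]_(n, k)) (rho : R) :
  (0 < k)%N -> 0 < rho -> rho < 1 ->
  exists2 u : 'cV[int]_k, map_mx intr u != 0 :> 'cV[R]_k &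
    rho * spectral_norm A * l2norm (map_mx intr u : 'cV[R]_k) <=
    l2norm (A *m map_mx intr u).
Proof.
move=> k0 r0 r1; set a := spectral_norm A.
have [a0|a0] := eqVneq a 0.
  exists (const_mx 1); last by rewrite a0 mulr0 mul0r l2norm_ge0.
  apply/eqP => /colP/(_ (Ordinal k0)); rewrite !mxE => /eqP.
  by rewrite oner_eq0.
have ap : 0 < a by rewrite lt0r a0 spectral_norm_ge0.
have [v v1 hv] : exists2 v : 'cV[R]_k, l2norm v <= 1 & (1 + rho) / 2 * a < l2norm (A *m v).
  have h : (1 + rho) / 2 * a < a by rewrite gtr_pMl//; lra.
  have [_ [v /= v1 <-] hv] := sup_gt (proj1 (spectral_norm_has_sup A)) h.
  by exists v.
set sk := Num.sqrt (k%:R : R).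
have sk0 : 0 <= sk by exact: sqrtr_ge0.
(* Scaling the near-maximiser [v] by [N] before taking floors makes the rounding error, at most sqrt
   k, small against the gap N (1 - rho) / 2. *)
have [N hN] : exists N : nat, 4 * (sk + 1) / (1 - rho) < N%:R.
  have := archi_boundP (_ : 0 <= 4 * (sk + 1) / (1 - rho)).
  move=> /(_ ltac:(by rewrite divr_ge0 ?mulr_ge0//; lra)) h.
  by eexists; exact: h.
pose u : 'cV[int]_k := \col_i Num.floor (N%:R * v i 0).
have hu : l2norm (N%:R *: v - map_mx intr u) <= sk.
  rewrite /l2norm ler_sqrt ?ler0n//.
  rewrite -[X in _ <= X%:R](card_ord k) -sum1_card natr_sum; apply: ler_sum => i _.
  rewrite !mxE expr_le1//.
    have := floorD1_gt (N%:R * v i 0); rewrite intrD => /ltW.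
    by rewrite lerBlDl.
  by rewrite subr_ge0 floor_le.
set U := map_mx intr u : 'cV[R]_k in hu *.
have hN' : 4 * (sk + 1) < N%:R * (1 - rho) by rewrite -ltr_pdivrMr// subr_gt0.
have N0 : 0 <= N%:R :> R by exact: ler0n.
have hU : l2norm U <= N%:R + sk.
  have := l2normB_ge U (N%:R *: v).
  rewrite -[X in _ <= X]l2normN opprB l2normZ ger0_norm// => h.
  have : N%:R * l2norm v <= N%:R * 1 by rewrite ler_wpM2l.
  lra.
have hAU : a * (N%:R * ((1 + rho) / 2) - sk) < l2norm (A *m U).
  have := l2normB_ge (A *m (N%:R *: v)) (A *m U); rewrite -mulmxBr => h.
  have h2 := le_trans (l2norm_spectral A _) (ler_wpM2l (ltW ap) hu).
  have : N%:R * ((1 + rho) / 2 * a) < N%:R * l2norm (A *m v).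
    rewrite ltr_pM2l// lt0r N0 andbT; apply: contraTneq hN' => ->.
    by rewrite mul0r -leNgt; lra.
  move: h; rewrite -scalemxAr l2normZ ger0_norm//; lra.
exists u; rewrite -/U.
  apply: contraTneq hAU => ->; rewrite mulmx0 l2norm0 -leNgt mulr_ge0 ?(ltW ap)//; nra.
apply: le_trans (ltW hAU); rewrite mulrC (mulrC rho) mulrCA ler_pM2l//.
have : l2norm U * rho <= (N%:R + sk) * rho by rewrite ler_wpM2r// ltW.
nra.
Qed.

End integer_direction.

Section union_bound.
Local Open Scope ereal_scope.
Context d (T : measurableType d) (R : realType) (P : {measure set T -> \bar R}).
Context (I : finType) (Q : pred I) (F : I -> set T).
Hypothesis mF : forall i, Q i -> measurable (F i).

Let mU (s : seq I) : measurable [set w | exists i, [/\ i \in s, Q i & F i w]].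
Proof.
elim: s => [|i s IH].
  by rewrite (_ : [set w | _] = set0)//; apply/seteqP; split => w // -[j []].
rewrite (_ : [set w | _] =
  (if Q i then F i else set0) `|` [set w | exists i, [/\ i \in s, Q i & F i w]]).
  by apply: measurableU => //; case: ifP => // /mF.
apply/seteqP; split => w /=.
  move=> [j []]; rewrite inE => /predU1P[->|js] Qj Fj; first by left; rewrite Qj.
  by right; exists j.
case; last by move=> [j [js Qj Fj]]; exists j; rewrite inE js orbT.
by case: ifP => // Qi Fi; exists i; rewrite inE eqxx.
Qed.

Lemma measurable_exists_fin : measurable [set w | exists2 i, Q i & F i w].
Proof.
rewrite (_ : [set w | _] = [set w | exists i, [/\ i \in index_enum I, Q i & F i w]])//.
apply/seteqP; split => w /= [i]; first by move=> Qi Fi; exists i; rewrite mem_index_enum.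
by move=> [_ Qi Fi]; exists i.
Qed.

Lemma union_bound : P [set w | exists2 i, Q i & F i w] <= \sum_(i | Q i) P (F i).
Proof.
rewrite (_ : [set w | _] = [set w | exists i, [/\ i \in index_enum I, Q i & F i w]]); last first.
  apply/seteqP; split => w /= [i]; first by move=> Qi Fi; exists i; rewrite mem_index_enum.
  by move=> [_ Qi Fi]; exists i.
elim: (index_enum I) => [|i s IH].
  rewrite big_nil (_ : [set w | _] = set0) ?measure0//.
  by apply/seteqP; split => w // -[j []].
rewrite (_ : [set w | _] =
  (if Q i then F i else set0) `|` [set w | exists i, [/\ i \in s, Q i & F i w]]); last first.
  apply/seteqP; split => w /=.
    move=> [j []]; rewrite inE => /predU1P[->|js] Qj Fj; first by left; rewrite Qj.
    by right; exists j.
  case; last by move=> [j [js Qj Fj]]; exists j; rewrite inE js orbT.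
  by case: ifP => // Qi Fi; exists i; rewrite inE eqxx.
rewrite big_cons; case: ifPn => Qi; last by rewrite set0U.
by rewrite (le_trans (measureU2 _ _ _))//; [exact: mF|exact: leeD2l].
Qed.

End union_bound.

Section independent_section.
Local Open Scope ereal_scope.
Context d (T : measurableType d) (R : realType) (P : probability T R).
Context d1 d2 (U : measurableType d1) (V : measurableType d2).
Context (X : T -> U) (Y : T -> V).
Hypothesis mX : measurable_fun setT X.
Hypothesis mY : measurable_fun setT Y.

Let X_mixin := isMeasurableFun.Build _ _ _ _ X mX.
Let X' : {mfun T >-> U} := HB.pack X X_mixin.
Let Y_mixin := isMeasurableFun.Build _ _ _ _ Y mY.
Let Y' : {mfun T >-> V} := HB.pack Y Y_mixin.
Let XY w := (X w, Y w).
Let mXY : measurable_fun setT XY.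
Proof. exact: measurable_fun_pair. Qed.
Let XY_mixin := isMeasurableFun.Build _ _ _ _ XY mXY.
Let XY' : {mfun T >-> (U * V)%type} := HB.pack XY XY_mixin.

(** Conditioning on [X]: independence identifies the joint law with the product law on rectangles,
    hence everywhere, and the product measure integrates the sections at fixed [x]. *)
Lemma indep_section_bound (B : set (U * V)) (c : R) :
  independent_pair P X Y -> measurable B ->
  (forall x, P [set w | B (x, Y w)] <= c%:E) ->
  P [set w | B (X w, Y w)] <= c%:E.
Proof.
move=> ind mB hc.
have h : (distribution P X' \x distribution P Y') B = P [set w | B (X w, Y w)] :=
  @product_measure_unique _ _ U V R (distribution P X') (distribution P Y')
    (distribution P XY') ind B mB.
rewrite -h.
rewrite /product_measure1 /=.
apply: (@le_trans _ _ (\int[distribution P X']_x (cst c%:E x))).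
  apply: ge0_le_integral.
  - exact: measurableT.
  - by move=> x _; exact: measure_ge0.
  - exact: (measurable_fun_xsection (distribution P Y') mB).
  - exact: measurable_cst.
  - move=> x _ /=; apply: le_trans (hc x); rewrite le_eqVlt; apply/orP; left.
    by apply/eqP; congr (P _); apply/seteqP; split => w /=; rewrite /xsection/= inE.
by rewrite integral_cst//= ?probability_setT ?mule1.
Qed.

End independent_section.

Section noise_event.
Context d (T : measurableType d) (R : realType) (P : probability T R).
Context (n p M : nat) (sigma delta A1 A2 : R) (G : 'I_M -> {set 'I_p}).
Context (X : T -> 'M[R]_(n, p)) (eps : T -> 'cV[R]_n).
Hypothesis n0 : (0 < n)%N.
Hypothesis s0 : 0 < sigma.
Hypothesis delta01 : 0 < delta < 1.
Hypothesis A11 : 1 < A1.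
Hypothesis A12 : A1 < A2.
Hypothesis mX : measurable_fun setT X.
Hypothesis me : measurable_fun setT eps.
Hypothesis gauss : isotropic_gaussian P sigma eps.
Hypothesis ind : independent_pair P X eps.

Let L := ln (M%:R / delta).
Let c j := Num.sqrt #|G j|%:R + Num.sqrt (2 * L).

Let bad j (z : 'M[R]_(n, p) * 'cV[R]_n) : Prop :=
  forall u : 'cV[int]_#|G j|, map_mx intr u != 0 :> 'cV[R]_#|G j| ->
    A2 * c j * l2norm z.2 * l2norm (subcols (G j) z.1 *m map_mx intr u) <
    Num.sqrt n%:R * l2norm ((subcols (G j) z.1)^T *m z.2) * l2norm (map_mx intr u : 'cV[R]_#|G j|).

Lemma measurable_l2norm d' (T' : measurableType d') k (f : T' -> 'cV[R]_k) :
  (forall i, measurable_fun setT (fun w => f w i 0)) ->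
  measurable_fun setT (fun w => l2norm (f w)).
Proof.
move=> mf; rewrite /l2norm.
rewrite (_ : (fun w => _) = (fun w => (\sum_i f w i 0 ^+ 2) `^ 2^-1)); last first.
  apply/funext => w; rewrite powR12_sqrt//.
  by apply: sumr_ge0 => i _; exact: sqr_ge0.
apply: (measurableT_comp (measurable_powR 2^-1)).
by apply: measurable_sum => i; apply: measurable_funX.
Qed.

Let mbad j : measurable (bad j : set _).
Proof.
pose S (u : 'cV[int]_#|G j|) : set ('M[R]_(n, p) * 'cV[R]_n) :=
  if map_mx intr u != 0 :> 'cV[R]_#|G j| then
  [set z | A2 * c j * l2norm z.2 * l2norm (subcols (G j) z.1 *m map_mx intr u) <
    Num.sqrt n%:R * l2norm ((subcols (G j) z.1)^T *m z.2) * l2norm (map_mx intr u : 'cV[R]_#|G j|)]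
  else setT.
(* Integer vectors are countable; the intersection runs through their codes, and numbers that code
   nothing contribute the whole space. *)
pose F (m : nat) := if unpickle m is Some u then S u else setT.
rewrite (_ : bad j = \bigcap_m F m); last first.
  apply/seteqP; split => z.
    move=> h m _; rewrite /F; case: unpickle => // u; rewrite /S; case: ifP => //= u0.
    exact: h.
  move=> h u u0; have := h (pickle u) I; rewrite /F pickleK /S u0; exact.
apply: bigcapT_measurable => m; rewrite /F; case: unpickle => // u.
rewrite /S; case: ifP => // u0.
have m1 i k : measurable_fun setT (fun z : 'M[R]_(n, p) * 'cV[R]_n => z.1 i k).
  exact: measurableT_comp (measurable_entry i k) measurable_fst.
have m2 i : measurable_fun setT (fun z : 'M[R]_(n, p) * 'cV[R]_n => z.2 i 0).
  exact: measurableT_comp (measurable_entry i 0) measurable_snd.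
apply: measurable_set_lt.
  apply: measurable_funM.
    apply: measurable_funM; first exact: measurable_cst.
    exact: measurable_l2norm.
  apply: measurable_l2norm => i; under eq_fun do rewrite mxE.
  apply: measurable_sum => k; apply: measurable_funM; last exact: measurable_cst.
  under eq_fun do rewrite mxE; exact: m1.
apply: measurable_funM; last exact: measurable_cst.
apply: measurable_funM; first exact: measurable_cst.
apply: measurable_l2norm => i; under eq_fun do rewrite mxE.
apply: measurable_sum => k; apply: measurable_funM => //.
under eq_fun do rewrite !mxE; exact: m1.
Qed.

(** [bad] at level [A2], tested on an integer direction that attains the fraction A1 / A2 of the
    spectral norm, implies the event of [gaussian_spectral_tail] at level [A1]. Conversely, if [bad]
    fails, a single direction already proves the bound at level [A2]. Each nonempty group costs
    exp(-(A1 - 1)^2 / 2) delta / M. *)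
Lemma noise_event : exists E : set T, [/\ measurable E,
  (P (~` E) <= (expR (- (A1 - 1) ^+ 2 / 2) * delta)%:E)%E &
  forall w, E w -> forall j, Num.sqrt n%:R * l2norm ((subcols (G j) (X w))^T *m eps w)
    <= A2 * c j * spectral_norm (subcols (G j) (X w)) * l2norm (eps w)].
Proof.
have [d0 d1] := andP delta01.
have A10 : 0 < A1 := lt_trans ltr01 A11.
have A20 : 0 < A2 := lt_trans A10 A12.
pose Q j := (0 < #|G j|)%N.
pose N := [set w | exists2 j, Q j & bad j (X w, eps w)].
have mbadw j : Q j -> measurable [set w | bad j (X w, eps w)].
  move=> _; rewrite -[X in measurable X]setTI.
  have : measurable_fun setT (fun w => (X w, eps w)) by exact: measurable_fun_pair.
  by move=> /(_ measurableT _ (mbad j)).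
have mN : measurable N by exact: measurable_exists_fin.
exists (~` N); split; first exact: measurableC.
- rewrite setCK.
  have L0 : 0 < M%:R / delta -> (0 < M)%N -> 0 <= L.
    move=> _ M0; apply: ln_ge0; rewrite ler_pdivlMr// mul1r (le_trans (ltW d1))//.
    by rewrite ler1n.
  have hj j : Q j -> (P [set w | bad j (X w, eps w)] <=
      (expR (- (A1 - 1) ^+ 2 / 2) * (delta / M%:R))%:E)%E.
    move=> Qj.
    have M0 : (0 < M)%N by apply: leq_ltn_trans (ltn_ord j).
    have Md : 0 < M%:R / delta by rewrite divr_gt0// ltr0n.
    apply: (indep_section_bound mX me ind (mbad j)) => x.
    have r0 : 0 < A1 / A2 by rewrite divr_gt0.
    have r1 : A1 / A2 < 1 by rewrite ltr_pdivrMr// mul1r.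
    have [u u0 hu] := integer_direction (subcols (G j) x) Qj r0 r1.
    have := gaussian_spectral_tail n0 s0 me gauss (subcols (G j) x) Qj A11 (L0 Md M0).
    rewrite expRD /L expRN lnK ?posrE// invf_div => h.
    rewrite (_ : - (A1 - 1) ^+ 2 / 2 = - ((A1 - 1) ^+ 2 / 2)); last by rewrite mulNr.
    rewrite mulrC; apply: le_trans h; apply: le_measure; rewrite ?inE.
    + have h0 : measurable_fun setT (fun w => (x, eps w)).
        by apply: measurable_fun_pair => //; exact: measurable_cst.
      by have := h0 measurableT _ (mbad j); rewrite setTI.
    + apply: measurable_set_lt.
        apply: measurable_funM; first exact: measurable_cst.
        by apply: measurable_l2norm => i; exact: measurable_coord.
      apply: measurable_funM; first exact: measurable_cst.
      apply: measurable_l2norm => i; under eq_fun do rewrite mxE.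
      apply: measurable_sum => k; apply: measurable_funM; first exact: measurable_cst.
      exact: measurable_coord.
    + move=> w /= /(_ u u0) /= h.
      have up : 0 < l2norm (map_mx intr u : 'cV[R]_#|G j|) by rewrite lt0r l2norm_eq0 u0 l2norm_ge0.
      rewrite -(ltr_pM2r up); apply: le_lt_trans h.
      have c0 : 0 <= A2 * c j * l2norm (eps w).
        by rewrite mulr_ge0 ?l2norm_ge0// mulr_ge0 ?addr_ge0 ?sqrtr_ge0// ltW.
      have := ler_wpM2l c0 hu; apply: le_trans; rewrite le_eqVlt; apply/orP; left; apply/eqP.
      rewrite -/(c j); move: (l2norm _) (l2norm _) (spectral_norm _) (c j) => a b e f.
      by field; rewrite gt_eqF.
  apply: (le_trans (union_bound P mbadw)).
  apply: (@le_trans _ _ (\sum_(j | Q j) (expR (- (A1 - 1) ^+ 2 / 2) * (delta / M%:R))%:E)%E).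
    exact: lee_sum.
  rewrite sumEFin lee_fin sumr_const -(mulr_natr (_ * _)) -mulrA ler_wpM2l ?expR_ge0//.
  have [M0|M0] := posnP M.
    have -> : M%:R = 0 :> R by rewrite M0.
    by rewrite invr0 mulr0 mul0r ltW.
  rewrite -mulrA ler_piMr ?(ltW d0)// mulrC ler_pdivrMr ?ltr0n// mul1r ler_nat.
  by rewrite (leq_trans (max_card _))// card_ord.
- move=> w hw j.
  have [G0|G0] := posnP #|G j|.
    rewrite (_ : l2norm ((subcols (G j) (X w))^T *m eps w) = 0).
      by rewrite mulr0 !mulr_ge0 ?spectral_norm_ge0 ?l2norm_ge0 ?addr_ge0 ?sqrtr_ge0 ?(ltW A20).
    rewrite /l2norm big1 ?sqrtr0// => i _; have := ltn_ord i; by rewrite {2}G0.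
  have [u hu] : exists u : 'cV[int]_#|G j|, ~ (map_mx intr u != 0 :> 'cV[R]_#|G j| ->
    A2 * c j * l2norm (eps w) * l2norm (subcols (G j) (X w) *m map_mx intr u) <
    Num.sqrt n%:R * l2norm ((subcols (G j) (X w))^T *m eps w) * l2norm (map_mx intr u : 'cV[R]_#|G j|)).
    apply: contrapT => hn; apply: hw; exists j => // u u0.
    by apply: contrapT => hb; apply: hn; exists u => /(_ u0).
  have [u0|u0] := eqVneq (map_mx intr u : 'cV[R]_#|G j|) 0.
    by exfalso; apply: hu; rewrite u0 eqxx.
  have hu' : Num.sqrt n%:R * l2norm ((subcols (G j) (X w))^T *m eps w) * l2norm (map_mx intr u : 'cV[R]_#|G j|)
     <= A2 * c j * l2norm (eps w) * l2norm (subcols (G j) (X w) *m map_mx intr u).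
    by rewrite leNgt; apply/negP => h; apply: hu => _.
  have up : 0 < l2norm (map_mx intr u : 'cV[R]_#|G j|) by rewrite lt0r l2norm_eq0 u0 l2norm_ge0.
  rewrite -(ler_pM2r up) (le_trans hu')//.
  have c0 : 0 <= A2 * c j * l2norm (eps w).
    by rewrite mulr_ge0 ?l2norm_ge0// mulr_ge0 ?addr_ge0 ?sqrtr_ge0// ltW.
  have := ler_wpM2l c0 (l2norm_spectral (subcols (G j) (X w)) (map_mx intr u)).
  move=> /le_trans; apply; rewrite le_eqVlt; apply/orP; left; apply/eqP.
  by move: (l2norm _) (l2norm _) (spectral_norm _) (c j) => a b e f; ring.
Qed.

End noise_event.

(** * Nets and sparse vectors *)

Section lattice_net.
Context (R : realType) (p m : nat).

(* Sign and absolute value of each coordinate. *)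
Definition lattice_pt := {ffun 'I_p -> bool * 'I_m.+1}.

Definition lattice_val (x : bool * 'I_m.+1) : R := (-1) ^+ x.1 * x.2%:R.

Definition lattice_vec (f : lattice_pt) : 'cV[R]_p := \col_i lattice_val (f i).

Definition lattice_supp (A : {set 'I_p}) (f : lattice_pt) :=
  [forall i, (i \notin A) ==> (f i == (false, ord0))].

Lemma sqr_lattice_val x : lattice_val x ^+ 2 = x.2%:R ^+ 2.
Proof. by rewrite exprMn sqrr_sign mul1r. Qed.

Lemma lattice_vec_supp A f i : lattice_supp A f -> i \notin A -> lattice_vec f i 0 = 0.
Proof.
move=> /forallP/(_ i)/implyP h iA; rewrite mxE (eqP (h iA)).
by rewrite /lattice_val/= mulr0.
Qed.

(** Rounding towards zero on the mesh t = eta |u| / sqrt K: at most K coordinates err by at most t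
    each, which gives eta |u| in total. Rounding towards zero does not increase the norm, so the
    lattice vector has squared norm at most |u|^2 / t^2 = K / eta^2. *)
Lemma lattice_round (A : {set 'I_p}) (K eta : R) (u : 'cV[R]_p) :
  0 < K -> 0 < eta -> #|A|%:R <= K -> (forall i, i \notin A -> u i 0 = 0) ->
  K / eta ^+ 2 <= m%:R ^+ 2 -> u != 0 ->
  exists f t, [/\ lattice_supp A f, l2norm (lattice_vec f) ^+ 2 <= K / eta ^+ 2,
    l2norm (t *: lattice_vec f) <= l2norm u &
    l2norm (u - t *: lattice_vec f) <= eta * l2norm u].
Proof.
move=> K0 e0 AK hu hm u0.
have un : 0 < l2norm u by rewrite lt0r l2norm_eq0 u0 l2norm_ge0.
have sK0 : 0 < Num.sqrt K by rewrite sqrtr_gt0.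
pose t := eta * l2norm u / Num.sqrt K.
have t0 : 0 < t by rewrite divr_gt0// mulr_gt0.
have t2 : K * t ^+ 2 = (eta * l2norm u) ^+ 2.
  by rewrite expr_div_n sqr_sqrtr ?(ltW K0)// mulrCA divff ?mulr1// gt_eqF.
have euE : (eta * l2norm u) ^+ 2 = l2norm u ^+ 2 * eta ^+ 2 by rewrite exprMn mulrC.
pose k i := Num.truncn (`|u i 0| / t).
have kle i : (k i)%:R * t <= `|u i 0|.
  by rewrite -ler_pdivlMr// truncn_le// divr_ge0// ltW.
have kgt i : `|u i 0| < ((k i)%:R + 1) * t.
  by rewrite -ltr_pdivrMr// natr1 truncnS_gt.
pose f : lattice_pt := [ffun i => if i \in A then (u i 0 < 0, inord (k i)) else (false, ord0)].
have km i : (k i <= m)%N.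
  rewrite -(ler_nat R) -(@ler_pXn2r _ 2)// ?nnegrE ?ler0n//.
  apply: le_trans hm; rewrite ler_pdivlMr ?exprn_gt0//.
  have t20 : 0 < t ^+ 2 by rewrite exprn_gt0.
  rewrite -(ler_pM2r t20) t2 euE mulrAC ler_pM2r ?exprn_gt0//.
  rewrite -exprMn sqr_l2norm (bigD1 i)//= -(real_normK (num_real (u i 0))).
  rewrite (@le_trans _ _ (`|u i 0| ^+ 2))//; last first.
    by rewrite lerDl; apply: sumr_ge0 => l _; exact: sqr_ge0.
  by rewrite lerXn2r ?nnegrE ?kle// mulr_ge0 ?ler0n ?(ltW t0).
have vE i : lattice_vec f i 0 = (-1) ^+ (u i 0 < 0)%R * (k i)%:R.
  rewrite mxE /f ffunE; case: ifPn => iA.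
    by rewrite /lattice_val/= inordK// ltnS.
  by rewrite /lattice_val/= mulr0 /k hu// normr0 mul0r truncn0 mulr0.
have uE i : u i 0 = (-1) ^+ (u i 0 < 0)%R * `|u i 0| by exact: numEsign.
have hle : l2norm (t *: lattice_vec f) <= l2norm u.
  rewrite -(@ler_pXn2r _ 2)// ?nnegrE ?l2norm_ge0// !sqr_l2norm.
  apply: ler_sum => i _; rewrite mxE vE mulrCA exprMn sqrr_sign mul1r.
  rewrite -(real_normK (num_real (u i 0))) lerXn2r ?nnegrE//.
    by rewrite mulr_ge0 ?ler0n ?(ltW t0).
  by rewrite mulrC.
exists f, t; split => //.
- apply/forallP => i; apply/implyP => iA; rewrite /f ffunE (negbTE iA) eqxx//.
- rewrite ler_pdivlMr ?exprn_gt0//.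
  have t20 : 0 < t ^+ 2 by rewrite exprn_gt0.
  rewrite -(ler_pM2r t20) t2 euE mulrAC ler_pM2r ?exprn_gt0//.
  by rewrite mulrC -sqr_l2normZ lerXn2r ?nnegrE ?l2norm_ge0.
- rewrite -(@ler_pXn2r _ 2)// ?nnegrE ?mulr_ge0 ?l2norm_ge0 ?(ltW e0)//.
  rewrite -t2 sqr_l2norm (bigID (mem A))/= [X in _ + X]big1 ?addr0; last first.
    move=> i iA; rewrite !mxE hu// ffunE (negbTE iA) /lattice_val/= !mulr0 subr0.
    by rewrite expr0n.
  apply: (@le_trans _ _ (\sum_(i in A) t ^+ 2)); last first.
    by rewrite sumr_const -mulr_natl ler_wpM2r ?sqr_ge0.
  apply: ler_sum => i _.
  rewrite [(u - _) i 0]mxE [X in _ + X]mxE [X in - X]mxE vE {1}(uE i).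
  rewrite mulrCA -mulrBr exprMn sqrr_sign mul1r.
  rewrite lerXn2r ?nnegrE ?(ltW t0)//; first by rewrite subr_ge0 mulrC.
  by have := kgt i; have := kle i; lra.
Qed.

Lemma sum_inv_pow2 (q : nat) : \sum_(k < q) 2^-1 ^+ k <= 2 :> R.
Proof.
have : \sum_(k < q) 2^-1 ^+ k = 2 - 2 * 2^-1 ^+ q :> R.
  elim: q => [|q IH]; first by rewrite big_ord0 expr0; ring.
  by rewrite big_ord_recr/= IH exprS; field.
by move=> ->; rewrite lerBlDr lerDl mulr_ge0// exprn_ge0.
Qed.

(** e^(-k^2) <= 2^(-k) and a geometric series; the factor 2 counts both signs, at zero as well. The
    bound is uniform in [m]. *)
Lemma sum_lattice_weight : \sum_(x : bool * 'I_m.+1) expR (- (lattice_val x) ^+ 2) <= 4.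
Proof.
have -> : \sum_(x : bool * 'I_m.+1) expR (- (lattice_val x) ^+ 2) =
   \sum_(b : bool) \sum_(k < m.+1) expR (- (k%:R : R) ^+ 2).
  rewrite pair_big/=; apply: eq_bigr => x _; congr (expR (- _)).
  by rewrite sqr_lattice_val.
rewrite sumr_const card_bool -(mulr_natl (\sum_(k < m.+1) _)).
have -> : 4 = 2 * 2 :> R by ring.
rewrite ler_pM2l//; apply: le_trans (sum_inv_pow2 m.+1); apply: ler_sum => k _.
rewrite expRN exprVn lef_pV2 ?posrE ?expR_gt0 ?exprn_gt0//.
apply: (@le_trans _ _ (expR 1 ^+ k)).
  rewrite lerXn2r ?nnegrE ?expR_ge0//.
  by rewrite (le_trans _ (expR_ge1Dx _)).
rewrite -expRM_natl mulr1 ler_expR -natrX ler_nat.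
by case: (nat_of_ord k) => // l; rewrite leq_pmulr.
Qed.

(** The weight factorises over coordinates, so the sum is a product of one-dimensional sums, with a
    single term equal to 1 off [A]. *)
Lemma sum_lattice_supp (A : {set 'I_p}) :
  \sum_(f : lattice_pt | lattice_supp A f) expR (- l2norm (lattice_vec f) ^+ 2)
    <= 4 ^+ #|A|.
Proof.
pose F i : pred (bool * 'I_m.+1) :=
  if i \in A then predT else pred1 (false, ord0).
have -> : \sum_(f : lattice_pt | lattice_supp A f) expR (- l2norm (lattice_vec f) ^+ 2) =
   \sum_(f in family F) \prod_i expR (- lattice_val (f i) ^+ 2).
  apply: eq_big => f; last first.
    move=> _; rewrite sqr_l2norm -sumrN.
    elim/big_rec2 : _ => [|i x y _ <-]; first by rewrite expR0.
    by rewrite expRD mxE.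
  apply/forallP/familyP => h i; have := h i; rewrite /F.
    by case: ifPn => // iA /=; rewrite !inE.
  by case: ifPn => // iA; rewrite inE.
rewrite -(bigA_distr_big_dep _ (fun i x => expR (- lattice_val x ^+ 2))).
rewrite (bigID (mem A))/= [X in _ * X]big1 ?mulr1 => [|i iA]; last first.
  rewrite /F (negbTE iA) big_pred1_eq /lattice_val/= mulr0 expr0n/= oppr0 expR0//.
rewrite -prodr_const; apply: ler_prod => i iA.
rewrite sumr_ge0 => [|x _]; last exact: expR_ge0.
by rewrite /F iA (le_trans _ sum_lattice_weight).
Qed.

End lattice_net.

Section counting.
Context (R : realType) (p M m : nat) (G : 'I_M -> {set 'I_p}) (L K D : R).
Hypothesis hG : is_grouping G.
Hypothesis L0 : 0 <= L.
Hypothesis ML : M%:R * expR (- L) <= 1.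

Definition group_weight (S : {set 'I_M}) : R := \sum_(j in S) (#|G j|%:R + L).

Lemma card_le_group_weight S : #|group_union G S|%:R <= group_weight S.
Proof.
by rewrite card_group_union//; apply: ler_sum => j _; rewrite lerDl.
Qed.

Definition net_adm (z : {set 'I_M} * lattice_pt p m) : bool :=
  [&& group_weight z.1 <= K, lattice_supp (group_union G z.1) z.2 &
      l2norm (lattice_vec R z.2) ^+ 2 <= D].

(* The weights [exp(-2 group_weight)] and [exp(-|z|^2)] bound the sum over all pairs by
   [(1 + exp(-L))^M <= e]; admissible pairs lose at most [exp(D + 2K)]. *)
Lemma card_net_adm : #|net_adm|%:R <= expR (D + 2 * K + 1).
Proof.
have -> : #|net_adm|%:R = \sum_(z | net_adm z) 1 :> R by rewrite sumr_const.
apply: (@le_trans _ _ (\sum_(z : {set 'I_M} * lattice_pt p m |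
     lattice_supp (group_union G z.1) z.2)
   expR (D + 2 * K) * (expR (- 2 * group_weight z.1) * expR (- l2norm (lattice_vec R z.2) ^+ 2)))).
  rewrite big_mkcond [leRHS]big_mkcond; apply: ler_sum => z _.
  case: ifPn => [/and3P[hK -> hD]|_].
    rewrite -!expRD -[leLHS]expR0 ler_expR; lra.
  by case: ifP => // _; rewrite !mulr_ge0 ?expR_ge0.
rewrite -mulr_sumr (expRD (D + 2 * K)) ler_pM2l ?expR_gt0//.
rewrite -(pair_big_dep xpredT (fun S f => lattice_supp (group_union G S) f)
  (fun S f => expR (- 2 * group_weight S) * expR (- l2norm (lattice_vec R f) ^+ 2)))/=.
apply: (@le_trans _ _ (\sum_(S : {set 'I_M}) \prod_(j in S) expR (- L))).
  apply: ler_sum => S _; rewrite -mulr_sumr.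
  apply: (@le_trans _ _ (expR (- 2 * group_weight S) * 4 ^+ #|group_union G S|)).
    by rewrite ler_pM2l ?expR_gt0// sum_lattice_supp.
  have e4 : 4 <= expR 2 :> R.
    have -> : 2 = 2%:R * 1 :> R by rewrite mulr1.
    rewrite expRM_natl (_ : 4 = 2 ^+ 2); last by ring.
    by rewrite lerXn2r ?nnegrE ?expR_ge0// (le_trans _ (expR_ge1Dx _)).
  apply: (@le_trans _ _ (expR (- 2 * group_weight S) * expR (#|group_union G S|%:R * 2))).
    by rewrite ler_pM2l ?expR_gt0// expRM_natl lerXn2r ?nnegrE ?expR_ge0.
  rewrite -expRD card_group_union// /group_weight.
  have -> : \prod_(j in S) expR (- L) = expR (\sum_(j in S) - L).
    by elim/big_rec2 : _ => [|i x y _ ->]; rewrite ?expR0 ?expRD.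
  rewrite ler_expR mulr_sumr mulr_suml -big_split/=; apply: ler_sum => j _.
  by move: L0; lra.
have -> : \sum_(S : {set 'I_M}) \prod_(j in S) expR (- L) = (expR (- L) + 1) ^+ M.
  rewrite -[M in RHS]card_ord -prodr_const bigA_distr; apply: eq_bigr => S _.
  rewrite [LHS]big_mkcond/=; apply: eq_bigr => j _; by [].
apply: (@le_trans _ _ (expR (expR (- L)) ^+ M)).
  by rewrite lerXn2r ?nnegrE ?addr_ge0 ?expR_ge0// addrC expR_ge1Dx.
by rewrite -expRM_natl ler_expR.
Qed.

End counting.

(** * From the net to all group-sparse vectors *)

Section sparse_from_net.
Context (R : realType) (n p M m : nat) (G : 'I_M -> {set 'I_p}) (L K lo hi eta : R).
Context (X : 'M[R]_(n, p)).
Hypothesis hG : is_grouping G.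
Hypothesis L0 : 0 <= L.
Hypothesis K0 : 0 < K.
Hypothesis eta0 : 0 < eta.
Hypothesis eta2 : eta <= 2^-1.
Hypothesis lo0 : 0 <= lo.
Hypothesis hi0 : 0 <= hi.
Hypothesis hm : K / eta ^+ 2 <= m%:R ^+ 2.
Hypothesis net : forall z : {set 'I_M} * lattice_pt p m, net_adm G L K (K / eta ^+ 2) z ->
  lo * l2norm (lattice_vec R z.2) <= l2norm (X *m lattice_vec R z.2)
    <= hi * l2norm (lattice_vec R z.2).

Let round (S : {set 'I_M}) (u : 'cV[R]_p) : group_weight G L S <= K ->
  (forall i, i \notin group_union G S -> u i 0 = 0) ->
  exists v : 'cV[R]_p, [/\ forall i, i \notin group_union G S -> v i 0 = 0,
    l2norm v <= l2norm u, l2norm (u - v) <= eta * l2norm u &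
    lo * l2norm v <= l2norm (X *m v) <= hi * l2norm v].
Proof.
move=> hS hu; have [->|u0] := eqVneq u 0.
  exists 0; rewrite subr0 mulmx0 !l2norm0 !mulr0 lexx; split => // i _; exact: mxE.
have cS : #|group_union G S|%:R <= K.
  exact: le_trans (card_le_group_weight hG L0 S) hS.
have [f [t [hf fD tf utf]]] := lattice_round K0 eta0 cS hu hm u0.
have /net/andP[h1 h2] : net_adm G L K (K / eta ^+ 2) (S, f) by apply/and3P.
exists (t *: lattice_vec R f); split => //.
  by move=> i iS; rewrite mxE (lattice_vec_supp _ hf iS) mulr0.
by rewrite -scalemxAr !l2normZ !(mulrCA _ `|t|) !ler_wpM2l.
Qed.

(** A self-bounding argument: approximating by the net gives B <= hi + B eta for the spectral norm
    [B] on the support, and eta <= 1/2 closes it because [B] is finite. *)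
Lemma sparse_upper (S : {set 'I_M}) (u : 'cV[R]_p) : group_weight G L S <= K ->
  (forall i, i \notin group_union G S -> u i 0 = 0) ->
  l2norm (X *m u) <= 2 * hi * l2norm u.
Proof.
move=> hS; set A := group_union G S; pose B := spectral_norm (subcols A X).
have B0 : 0 <= B by exact: spectral_norm_ge0.
have hB (u' : 'cV[R]_p) : (forall i, i \notin A -> u' i 0 = 0) -> l2norm (X *m u') <= B * l2norm u'.
  move=> hu'; have := l2norm_spectral (subcols A X) (subvec A u').
  by rewrite subcols_subvec l2norm_subvec restr_id.
suff BH : B <= 2 * hi.
  by move=> hu; rewrite (le_trans (hB u hu))// ler_wpM2r ?l2norm_ge0.
suff : B <= hi + B * eta.
  have : B * eta <= B * 2^-1 by rewrite ler_wpM2l.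
  lra.
apply: spectral_norm_le; first by rewrite addr_ge0 ?mulr_ge0 ?(ltW eta0).
move=> x; have [u' <- hu'] := subvec_surj x.
rewrite subcols_subvec l2norm_subvec hu'.
have hu0 i : i \notin A -> u' i 0 = 0 by rewrite -hu'; exact: restr_notin.
have [v [hv vu uv /andP[_ hXv]]] := round hS hu0.
rewrite -[u' in X in X <= _](subrK v) mulmxDr (le_trans (l2normD _ _))//.
rewrite mulrDl addrC lerD//.
  by rewrite (le_trans hXv)// ler_wpM2l.
rewrite (le_trans (hB _ _))//; last by rewrite -mulrA ler_wpM2l.
by move=> i iA; rewrite mxE mxE hu0// hv// subrr.
Qed.

(** The net point keeps at least half of |u|, and the rounding error has the same support, so
    [sparse_upper] bounds its image. *)
Lemma sparse_lower (S : {set 'I_M}) (u : 'cV[R]_p) : group_weight G L S <= K ->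
  (forall i, i \notin group_union G S -> u i 0 = 0) ->
  (lo / 2 - 2 * hi * eta) * l2norm u <= l2norm (X *m u).
Proof.
move=> hS hu.
have [v [hv vu uv /andP[hXv _]]] := round hS hu.
have h1 : l2norm (X *m (v - u)) <= 2 * hi * l2norm (v - u).
  by apply: (sparse_upper hS) => i iA; rewrite mxE mxE hu// hv// subrr.
have e1 : l2norm (v - u) = l2norm (u - v) by rewrite -l2normN opprB.
rewrite e1 in h1.
have h2 : 2 * hi * l2norm (u - v) <= 2 * hi * (eta * l2norm u).
  by rewrite ler_wpM2l// mulr_ge0.
have h3 := l2normB_ge (X *m v) (X *m (v - u)).
rewrite -mulmxBr opprB addrCA subrr addr0 in h3.
have h4 : l2norm u / 2 <= l2norm v.
  have := l2normB_ge u (u - v); rewrite opprB addrCA subrr addr0.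
  have := ler_wpM2r (l2norm_ge0 u) eta2; lra.
have h5 : lo * (l2norm u / 2) <= lo * l2norm v by rewrite ler_wpM2l.
lra.
Qed.

End sparse_from_net.

(** * Shelling a vector into blocks of groups *)

Section shelling.
Context (R : realType) (p M : nat) (G : 'I_M -> {set 'I_p}) (L K : R).
Hypothesis hG : is_grouping G.
Hypothesis L0 : 0 < L.
Hypothesis K0 : 0 < K.

Let N j : R := #|G j|%:R + L.
Hypothesis NK : forall j, N j <= K / 2.

Let N0 j : 0 < N j.
Proof. by rewrite /N ltr_wpDl. Qed.

Let sN0 j : 0 < Num.sqrt (N j). Proof. by rewrite sqrtr_gt0. Qed.

Let sNN j : Num.sqrt (N j) ^+ 2 = N j. Proof. by rewrite sqr_sqrtr// ltW. Qed.

Let r (u : 'cV[R]_p) j := l2norm (restr (G j) u) / Num.sqrt (N j).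

Let rE u j : l2norm (restr (G j) u) = r u j * Num.sqrt (N j).
Proof. by rewrite /r mulfVK ?gt_eqF. Qed.

Let r0 u j : 0 <= r u j.
Proof. by rewrite divr_ge0 ?l2norm_ge0 ?ltW. Qed.

Let rN u j : r u j * N j = Num.sqrt (N j) * l2norm (restr (G j) u).
Proof. by rewrite rE -[in LHS]sNN expr2 mulrA mulrC. Qed.

(** Up to a factor n^{1/2}, a stand-in for the penalty that depends on the groups and [L] only, not
    on the random weights. *)
Definition weighted_norm (A : {set 'I_M}) (u : 'cV[R]_p) : R :=
  \sum_(j in A) Num.sqrt (#|G j|%:R + L) * l2norm (restr (G j) u).

Let w0 A u : 0 <= weighted_norm A u.
Proof. by apply: sumr_ge0 => j _; rewrite mulr_ge0 ?sqrtr_ge0 ?l2norm_ge0. Qed.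

Let proj (S : {set 'I_M}) (u : 'cV[R]_p) := restr (group_union G S) u.

(* T is a maximal set of groups of weight at most K whose ratios [r] dominate the rest of
   A: unless T = A, its weight exceeds K/2, so the ratios left over are small. *)
Lemma top_block u (A : {set 'I_M}) :
  exists T : {set 'I_M}, [/\ T \subset A, group_weight G L T <= K &
    T = A \/ exists rho : R, [/\ 0 <= rho, forall j, j \in A :\: T -> r u j <= rho,
                        rho * (K / 2) <= weighted_norm T u & (#|A :\: T| < #|A|)%N]].
Proof.
pose Pb (T : {set 'I_M}) := [&& T \subset A, group_weight G L T <= K &
  [forall i in T, forall j in A :\: T, r u j <= r u i]].
have P0 : Pb finset.set0.
  rewrite /Pb finset.sub0set /group_weight big_set0 ltW//=.
  by apply/forall_inP => i; rewrite inE.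
case: (arg_maxnP (fun T : {set 'I_M} => #|T|) P0) => T /and3P[TA TK /forall_inP Tr] Tmax.
exists T; split => //.
have [->|TneA] := eqVneq T A; first by left.
right.
have [j0 j0A] : exists j, j \in A :\: T.
  apply/finset.set0Pn; rewrite finset.setD_eq0; apply: contra TneA => AT.
  by rewrite finset.eqEsubset TA.
case: (arg_maxP (r u) j0A) => j jA' jmax'.
have jA : j \in A :\: T := jA'.
have jmax k : k \in A :\: T -> r u k <= r u j := jmax' k.
have jT : j \notin T by move: jA; rewrite inE => /andP[].
have jinA : j \in A by move: jA; rewrite inE => /andP[].
have wT' : group_weight G L (j |: T) = N j + group_weight G L T.
  by rewrite /group_weight big_setU1.
(* Otherwise the group [j] of largest ratio outside [T] could be added, its own weight being at most
   K/2 by [NK]. *)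
have wT : K / 2 < group_weight G L T.
  rewrite ltNge; apply/negP => h.
  have /Tmax : Pb (j |: T).
    apply/and3P; split.
    - by rewrite finset.subUset finset.sub1set jinA.
    - by rewrite wT'; have := NK j; lra.
    - apply/forall_inP => i; rewrite !inE => /predU1P[->|iT]; apply/forall_inP => l.
        rewrite !inE negb_or => /andP[/andP[_ lT] lA].
        by apply: jmax; rewrite inE lT.
      rewrite !inE negb_or => /andP[/andP[_ lT] lA].
      by have /forall_inP := Tr i iT; apply; rewrite inE lT.
  by rewrite cardsU1 jT /= add1n => /leq_trans/(_ (leqnn _)); rewrite ltnn.
exists (r u j); split => //.
  apply: (@le_trans _ _ (r u j * group_weight G L T)); first by rewrite ler_wpM2l// ltW.
  rewrite mulr_sumr; apply: ler_sum => i iT.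
  rewrite -/(N i) -rN ler_wpM2r ?(ltW (N0 i))//.
  by have /forall_inP := Tr i iT; apply.
rewrite cardsD (finset.setIidPr TA).
have T0 : (0 < #|T|)%N.
  rewrite lt0n; apply: contraTneq wT => /eqP; rewrite cards_eq0 => /eqP ->.
  by rewrite /group_weight big_set0 -leNgt divr_ge0// ltW.
by rewrite ltn_subrL T0 (leq_trans T0)// subset_leq_card.
Qed.

Lemma norm_block_le (u : 'cV[R]_p) (T : {set 'I_M}) (rho : R) : 0 <= rho -> group_weight G L T <= K ->
  (forall j, j \in T -> r u j <= rho) -> l2norm (proj T u) <= rho * Num.sqrt K.
Proof.
move=> rho0 TK hr.
rewrite -(@ler_pXn2r _ 2)// ?nnegrE ?l2norm_ge0 ?mulr_ge0 ?sqrtr_ge0//.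
rewrite exprMn (sqr_sqrtr (ltW K0)) /proj sqr_l2norm_group_union//.
apply: (@le_trans _ _ (rho ^+ 2 * group_weight G L T)); last first.
  by rewrite ler_wpM2l ?sqr_ge0.
rewrite mulr_sumr; apply: ler_sum => j jT.
rewrite rE exprMn sNN ler_wpM2r ?(ltW (N0 j))//.
by rewrite lerXn2r ?nnegrE ?hr.
Qed.

Let projD (A T : {set 'I_M}) (u : 'cV[R]_p) : T \subset A -> proj A u = proj T u + proj (A :\: T) u.
Proof.
move=> TA; rewrite /proj !restr_group_union// (bigID (mem T))/=; congr (_ + _).
  apply: eq_bigl => j; rewrite andbC; case: (boolP (j \in T)) => //= jT.
  by rewrite (fintype.subsetP TA).
by apply: eq_bigl => j; rewrite inE andbC.
Qed.

Let wnD (A T : {set 'I_M}) (u : 'cV[R]_p) : T \subset A ->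
  weighted_norm A u = weighted_norm T u + weighted_norm (A :\: T) u.
Proof.
move=> TA; rewrite /weighted_norm (bigID (mem T))/=; congr (_ + _).
  apply: eq_bigl => j; rewrite andbC; case: (boolP (j \in T)) => //= jT.
  by rewrite (fintype.subsetP TA).
by apply: eq_bigl => j; rewrite inE andbC.
Qed.

Let shell_step rho w : rho * (K / 2) <= w -> rho * Num.sqrt K <= 2 / Num.sqrt K * w.
Proof.
move=> h; have s0 : 0 < Num.sqrt K by rewrite sqrtr_gt0.
have sK : Num.sqrt K ^+ 2 = K by rewrite sqr_sqrtr// ltW.
rewrite mulrAC ler_pdivlMr// -mulrA -expr2 sK; lra.
Qed.

(** The norm of a block is at most sqrt K times the largest ratio in it, and that ratio is charged
    to the weighted norm of the preceding block. The charges add up to the weighted norm of [A];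
    only the first block, bounded through [rho], has no predecessor. *)
Lemma tail_bound k (X : 'M[R]_(k, p)) (U : R) (u : 'cV[R]_p) : 0 <= U ->
  (forall S, group_weight G L S <= K -> l2norm (X *m proj S u) <= U * l2norm (proj S u)) ->
  forall (A : {set 'I_M}) (rho : R), 0 <= rho -> (forall j, j \in A -> r u j <= rho) ->
  l2norm (X *m proj A u) <= U * (rho * Num.sqrt K + 2 / Num.sqrt K * weighted_norm A u).
Proof.
move=> U0 hX A; move: {2}#|A|.+1 (ltnSn #|A|) => q.
have s0 : 0 < Num.sqrt K by rewrite sqrtr_gt0.
have c0 : 0 <= 2 / Num.sqrt K by rewrite divr_ge0// ltW.
elim: q A => // q IH A; rewrite ltnS => Aq rho rho0 hr.
have [T [TA TK hT]] := top_block u A.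
have hrT j : j \in T -> r u j <= rho by move=> jT; apply: hr; rewrite (fintype.subsetP TA).
have hXT : l2norm (X *m proj T u) <= U * (rho * Num.sqrt K).
  by rewrite (le_trans (hX T TK))// ler_wpM2l// norm_block_le.
case: hT => [TE|[rho' [rho'0 hr' hw card]]].
  rewrite -TE (le_trans hXT)// ler_wpM2l// lerDl mulr_ge0//.
rewrite (projD u TA) mulmxDr (le_trans (l2normD _ _))// mulrDr lerD//.
apply: (le_trans (IH _ (leq_trans card Aq) rho' rho'0 hr')).
rewrite ler_wpM2l// (wnD u TA) mulrDr lerD2r; exact: shell_step.
Qed.

(** The first block carries the lower bound. [tail_bound] is applied twice to the rest: with [X], to
    bound its image, and with the identity, to pass from the norm of the first block to that of [u];
    hence the factor U + l. *)
Lemma restricted_lower_bound n (X : 'M[R]_(n, p)) (U l : R) (u : 'cV[R]_p) : 0 <= U -> 0 <= l ->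
  (forall S, group_weight G L S <= K -> l2norm (X *m proj S u) <= U * l2norm (proj S u)) ->
  (forall S, group_weight G L S <= K -> l * l2norm (proj S u) <= l2norm (X *m proj S u)) ->
  l * l2norm u - (U + l) * (2 / Num.sqrt K * weighted_norm [set: 'I_M]%SET u) <= l2norm (X *m u).
Proof.
move=> U0 l0 hU hl.
have uE : proj [set: 'I_M]%SET u = u.
  rewrite /proj restr_group_union// [RHS](sum_restr hG).
  by apply: eq_bigl => j; rewrite inE.
set w := weighted_norm _ _.
have s0 : 0 < Num.sqrt K by rewrite sqrtr_gt0.
have c0 : 0 <= 2 / Num.sqrt K by rewrite divr_ge0// ltW.
have cw0 : 0 <= 2 / Num.sqrt K * w by rewrite mulr_ge0// w0.
have [T [TA TK hT]] := top_block u [set: 'I_M]%SET.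
case: hT => [TE|[rho [rho0 hr hw _]]].
  have := hl T TK; rewrite TE uE.
  have : 0 <= (U + l) * (2 / Num.sqrt K * w) by rewrite mulr_ge0// addr_ge0.
  lra.
have hid S : group_weight G L S <= K ->
    l2norm (1%:M *m proj S u) <= 1 * l2norm (proj S u) by rewrite mul1mx mul1r.
have t1 := tail_bound U0 hU rho0 hr.
have t2 := tail_bound ler01 hid rho0 hr.
have t3 : rho * Num.sqrt K + 2 / Num.sqrt K * weighted_norm ([set: 'I_M]%SET :\: T) u
    <= 2 / Num.sqrt K * w.
  by rewrite /w (wnD u TA) mulrDr lerD2r shell_step.
rewrite mul1mx mul1r in t2.
have t1' := le_trans t1 (ler_wpM2l U0 t3).
have t2' := le_trans t2 t3.
have hlT := hl T TK.
have e := projD u TA; rewrite uE in e.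
have h1 : l2norm (X *m proj T u) - l2norm (X *m proj ([set: 'I_M]%SET :\: T) u) <= l2norm (X *m u).
  have := l2normB_ge (X *m u) (- (X *m proj T u)).
  have := l2normD (X *m u) (- (X *m proj ([set: 'I_M]%SET :\: T) u)).
  rewrite l2normN -mulmxBr {1}e addrK; lra.
have h2 : l2norm u <= l2norm (proj T u) + l2norm (proj ([set: 'I_M]%SET :\: T) u).
  by rewrite {1}e l2normD.
have h3 := ler_wpM2l l0 h2.
have h4 := ler_wpM2l l0 t2'.
lra.
Qed.

End shelling.

(** * The sparse eigenvalue event *)

Section sparse_event.
Context d (T : measurableType d) (R : realType) (P : probability T R).
Context (n p M : nat) (v0 c_ cc L K eta : R) (Sigma : 'M[R]_p) (X : T -> 'M[R]_(n, p)).
Context (G : 'I_M -> {set 'I_p}).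
Hypothesis n0 : (0 < n)%N.
Hypothesis v01 : 1 < v0.
Hypothesis c0 : 0 < c_.
Hypothesis mX : measurable_fun setT X.
Hypothesis iid : iid_rows P X.
Hypothesis cov : (forall j k, 'E_P[fun w => ((n%:R^-1 *: ((X w)^T *m X w)) j k)%R]
               = (Sigma j k)%:E)%E.
Hypothesis eig : forall a, eigenvalue Sigma a -> c_ <= a <= cc.
Hypothesis subG : sub_gaussian_rows P v0 Sigma X.
Hypothesis hG : is_grouping G.
Hypothesis L0 : 0 <= L.
Hypothesis ML : M%:R * expR (- L) <= 1.
Hypothesis K0 : 0 < K.
Hypothesis eta0 : 0 < eta.
Hypothesis eta2 : eta <= 2^-1.

Let v00 : 0 < v0. Proof. exact: lt_trans ltr01 v01. Qed.

Let quad_lo b : c_ * l2norm b ^+ 2 <= quadf Sigma b.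
Proof.
by apply: rayleigh_lower => [|a /eig/andP[]//]; exact: cov_sym cov.
Qed.

Let quad_hi b : quadf Sigma b <= cc * l2norm b ^+ 2.
Proof.
by apply: rayleigh_upper => [|a /eig/andP[]//]; exact: cov_sym cov.
Qed.

Let Bad (b : 'cV[R]_p) : set T :=
  [set w | 2 * v0 * n%:R * quadf Sigma b < l2norm (X w *m b) ^+ 2] `|`
  [set w | l2norm (X w *m b) ^+ 2 < n%:R * quadf Sigma b / 2].

Let mBad b : measurable (Bad b).
Proof.
have m2 : measurable_fun setT (fun w => l2norm (X w *m b) ^+ 2).
  apply: measurable_funX; apply: measurable_l2norm => i.
  exact: measurable_mulmx_entry.
by apply: measurableU; apply: measurable_set_lt => //; exact: measurable_cst.
Qed.

Let PBad b : b != 0 -> (P (Bad b) <= (2 * expR (- n%:R / (128 * v0 ^+ 2)))%:E)%E.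
Proof.
move=> b0; have q0 : 0 < quadf Sigma b.
  apply: lt_le_trans (quad_lo b); rewrite mulr_gt0// exprn_gt0//.
  by rewrite lt0r l2norm_eq0 b0 l2norm_ge0.
apply: (le_trans (measureU2 _ _ _)).
- apply: measurable_set_lt; first exact: measurable_cst.
  apply: measurable_funX; apply: measurable_l2norm => i; exact: measurable_mulmx_entry.
- apply: measurable_set_lt; last exact: measurable_cst.
  apply: measurable_funX; apply: measurable_l2norm => i; exact: measurable_mulmx_entry.
have -> : 2 * expR (- n%:R / (128 * v0 ^+ 2)) =
  expR (- n%:R / (128 * v0 ^+ 2)) + expR (- n%:R / (128 * v0 ^+ 2)) :> R by ring.
rewrite EFinD; apply: leeD; last exact: (design_lower_tail n0 v00 mX iid cov subG q0).
apply: le_trans (design_upper_tail v00 mX iid subG q0) _.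
rewrite lee_fin ler_expR mulNr lerN2 ler_pdivrMr; last by rewrite mulr_gt0 ?exprn_gt0.
rewrite ler_peMr// (@le_trans _ _ (v0 ^+ 2))//; first by rewrite exprn_ege1// ltW.
by rewrite ler_peMl ?sqr_ge0//; lra.
Qed.

Lemma sparse_event (lo := Num.sqrt (c_ / 2) * Num.sqrt n%:R)
    (hi := Num.sqrt (2 * v0 * cc) * Num.sqrt n%:R) : exists E : set T,
  [/\ measurable E,
    (P (~` E) <= (2 * expR (K / eta ^+ 2 + 2 * K + 1 - n%:R / (128 * v0 ^+ 2)))%:E)%E &
    forall w, E w -> forall (S : {set 'I_M}) (u : 'cV[R]_p), group_weight G L S <= K ->
      (forall i, i \notin group_union G S -> u i 0 = 0) ->
      (lo / 2 - 2 * hi * eta) * l2norm u <= l2norm (X w *m u) <= 2 * hi * l2norm u].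
Proof.
have D0 : 0 <= K / eta ^+ 2 by rewrite divr_ge0 ?sqr_ge0// ltW.
(* Any [m] with K / eta^2 <= m^2 will do: the bound on the size of the net is uniform in [m]. *)
pose m := (Num.bound (K / eta ^+ 2)).+1.
have hm : K / eta ^+ 2 <= m%:R ^+ 2.
  apply: (@le_trans _ _ m%:R).
    by rewrite (le_trans (ltW (archi_boundP D0)))// ler_nat.
  by rewrite -natrX ler_nat expnS leq_pmulr// expn_gt0.
pose Q (z : {set 'I_M} * lattice_pt p m) :=
  net_adm G L K (K / eta ^+ 2) z && (lattice_vec R z.2 != 0).
pose F (z : {set 'I_M} * lattice_pt p m) := Bad (lattice_vec R z.2).
have mF z : Q z -> measurable (F z) by move=> _; exact: mBad.
have mB : measurable [set w | exists2 z, Q z & F z w] by exact: measurable_exists_fin.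
exists (~` [set w | exists2 z, Q z & F z w]); split; first exact: measurableC.
  rewrite setCK; apply: le_trans (union_bound P mF) _.
  apply: (@le_trans _ _ (\sum_(z | Q z) (2 * expR (- n%:R / (128 * v0 ^+ 2)))%:E)%E).
    by apply: lee_sum => z /andP[_ z0]; exact: PBad.
  rewrite sumEFin lee_fin sumr_const -[leLHS]mulr_natl (mulrCA #|_|%:R) ler_pM2l// mulNr.
  rewrite [in leRHS]expRD ler_pM2r ?expR_gt0//.
  apply: le_trans (card_net_adm m K (K / eta ^+ 2) hG L0 ML).
  by rewrite ler_nat; apply: subset_leq_card; apply/fintype.subsetP => z /andP[].
move=> w /= hw.
have net (z : {set 'I_M} * lattice_pt p m) : net_adm G L K (K / eta ^+ 2) z ->
    lo * l2norm (lattice_vec R z.2) <= l2norm (X w *m lattice_vec R z.2)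
    <= hi * l2norm (lattice_vec R z.2).
  move=> hz; have [->|z0] := eqVneq (lattice_vec R z.2) 0.
    by rewrite mulmx0 !l2norm0 !mulr0 lexx.
  have cc0 : 0 <= cc.
    have zn : 0 < l2norm (lattice_vec R z.2) ^+ 2.
      by rewrite exprn_gt0// lt0r l2norm_eq0 z0 l2norm_ge0.
    rewrite -(pmulr_lge0 _ zn); apply: le_trans (quad_hi _).
    by apply: le_trans (quad_lo _); rewrite mulr_ge0 ?sqr_ge0// ltW.
  have nh1 : ~ (2 * v0 * n%:R * quadf Sigma (lattice_vec R z.2)
      < l2norm (X w *m lattice_vec R z.2) ^+ 2).
    by move=> h; apply: hw; exists z; [rewrite /Q hz|left].
  have nh2 : ~ (l2norm (X w *m lattice_vec R z.2) ^+ 2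
      < n%:R * quadf Sigma (lattice_vec R z.2) / 2).
    by move=> h; apply: hw; exists z; [rewrite /Q hz|right].
  have nR : 0 <= n%:R :> R by [].
  have vc : 0 <= 2 * v0 * cc by rewrite !mulr_ge0// ltW.
  apply/andP; split.
    rewrite -(@ler_pXn2r _ 2)// ?nnegrE ?mulr_ge0 ?sqrtr_ge0 ?l2norm_ge0//.
    move/negP: nh2; rewrite -leNgt; apply: le_trans.
    rewrite !exprMn (sqr_sqrtr nR) sqr_sqrtr; last by rewrite divr_ge0// ltW.
    have := ler_wpM2l nR (quad_lo (lattice_vec R z.2)); lra.
  rewrite -(@ler_pXn2r _ 2)// ?nnegrE ?mulr_ge0 ?sqrtr_ge0 ?l2norm_ge0//.
  move/negP: nh1; rewrite -leNgt => /le_trans; apply.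
  rewrite !exprMn (sqr_sqrtr nR) (sqr_sqrtr vc).
  have h : 0 <= 2 * v0 * n%:R by rewrite !mulr_ge0// ltW.
  by have := ler_wpM2l h (quad_hi (lattice_vec R z.2)); lra.
have lo0 : 0 <= lo by rewrite mulr_ge0 ?sqrtr_ge0.
have hi0 : 0 <= hi by rewrite mulr_ge0 ?sqrtr_ge0.
move=> S u hS hu; apply/andP; split.
  exact: (sparse_lower hG L0 K0 eta0 eta2 lo0 hi0 hm net hS hu).
exact: (sparse_upper hG L0 K0 eta0 eta2 hi0 hm net hS hu).
Qed.

End sparse_event.

(** * The oracle inequality *)

Lemma sqrt_weight_bounds (R : realType) (a L : R) : 0 <= a -> 0 <= L ->
  Num.sqrt (a + L) <= Num.sqrt a + Num.sqrt (2 * L) <= 2 * Num.sqrt (a + L).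
Proof.
move=> a0 L0; have L2 : 0 <= 2 * L by rewrite mulr_ge0.
have sa := sqrtr_ge0 a; have sL := sqrtr_ge0 (2 * L).
have qa := sqr_sqrtr a0; have qL := sqr_sqrtr L2.
have aL : 0 <= a + L by rewrite addr_ge0.
have pr : 0 <= Num.sqrt a * Num.sqrt (2 * L) by rewrite mulr_ge0.
apply/andP; split; rewrite -(@ler_pXn2r _ 2)// ?nnegrE ?mulr_ge0 ?addr_ge0 ?sqrtr_ge0//.
  rewrite sqr_sqrtr// sqrrD; lra.
rewrite exprMn (sqr_sqrtr aL).
have := sqr_ge0 (Num.sqrt a - Num.sqrt (2 * L)); rewrite sqrrB sqrrD; lra.
Qed.

Section deterministic_bounds.
Context (R : realType) (n p M : nat) (G : 'I_M -> {set 'I_p}) (omega : 'I_M -> R).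
Context (X : 'M[R]_(n, p)) (y : 'cV[R]_n) (S : {set 'I_M}) (beta bh : 'cV[R]_p).
Context (sh sigma eta A_ AA L : R).
Hypothesis n0 : (0 < n)%N.
Hypothesis s0 : 0 < sigma.
Hypothesis A_1 : 1 < A_.
Hypothesis A_A : A_ < AA.
Hypothesis L0 : 0 <= L.
Hypothesis hG : is_grouping G.
Hypothesis eta01 : 0 <= eta < 1.
Hypothesis sol : scaled_group_lasso_solution G omega X y bh sh.
Let eps := y - X *m beta.
Let h := bh - beta.
Let rn : R := Num.sqrt n%:R.
Let r j := spectral_norm (subcols (G j) X) *
  (Num.sqrt #|G j|%:R + Num.sqrt (2 * L)) / n%:R.
Hypothesis weights : forall j, omega j / AA <= r j /\ r j <= omega j / A_.
Hypothesis noise : forall j,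
  l2norm ((subcols (G j) X)^T *m eps) <= eta * rn * omega j * l2norm eps.
Let b := l2norm eps / rn.
Let w := penalty G omega h.

Let rn0 : 0 < rn. Proof. by rewrite sqrtr_gt0 ltr0n. Qed.
Let rn2 : rn ^+ 2 = n%:R. Proof. by rewrite sqr_sqrtr. Qed.
Let nR0 : 0 < n%:R :> R. Proof. by rewrite ltr0n. Qed.
Let A0 : 0 < A_. Proof. exact: lt_trans ltr01 A_1. Qed.
Let AA0 : 0 < AA. Proof. exact: lt_trans A0 A_A. Qed.

Let r_ge0 j : 0 <= r j.
Proof. by rewrite divr_ge0// mulr_ge0 ?spectral_norm_ge0// addr_ge0 ?sqrtr_ge0. Qed.

Let omega_ge j : r j <= omega j.
Proof.
have [_] := weights j; rewrite ler_pdivlMr//; apply: le_trans.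
by rewrite ler_peMr// ltW.
Qed.

Let omega_ge0 j : 0 <= omega j. Proof. exact: le_trans (r_ge0 j) (omega_ge j). Qed.

Let group_image j : l2norm (X *m restr (G j) h)
  <= spectral_norm (subcols (G j) X) * l2norm (restr (G j) h).
Proof. by rewrite -subcols_subvec -l2norm_subvec l2norm_spectral. Qed.

Let max_error := Num.max `|1 - sh / b|
     (Num.max (l2norm (X *m bh - X *m beta) ^+ 2 / (n%:R * sigma ^+ 2))
     (Num.max (\sum_(j < M) l2norm (subvec (G j) bh - subvec (G j) beta)
                            / (sigma / omega j))
              (\sum_(j < M) l2norm (subcols (G j) X *m
                                    (subvec (G j) bh - subvec (G j) beta))
                            / (rn * sigma / omega j)))).

(** The comparison of [b] with 2 sigma carries the factor [K] so that K = 0 makes it trivial: the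
    null case then needs no control of the noise level. *)
Lemma max_error_le (K U : R) : 0 <= K -> 0 <= U ->
  `|sh - b| <= 8 * K ^+ 2 * b ->
  (l2norm (X *m h) / rn) ^+ 2 <= 64 * K ^+ 2 * b ^+ 2 ->
  w <= 8 * K ^+ 2 * b ->
  K * b <= K * (2 * sigma) ->
  \sum_j omega j * l2norm (X *m restr (G j) h) <= U * rn * w ->
  max_error <= (256 + 16 * U) * K ^+ 2.
Proof.
move=> K0 U0 h1 h2 h3 hb h4.
have [sh0 _] := sol.
have b0 : 0 <= b by rewrite divr_ge0 ?l2norm_ge0// ltW.
have K2 := sqr_ge0 K.
have UK : 0 <= U * K ^+ 2 by rewrite mulr_ge0.
(* The first term divides by [b]; if [b] were 0, the bound on |sh - b| would force sh = 0. *)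
have bp : 0 < b.
  rewrite lt0r b0 andbT; apply: contraTneq h1 => ->.
  by rewrite subr0 mulr0 -ltNge normr_gt0 gt_eqF.
have Kb0 : 0 <= K * b by rewrite mulr_ge0.
have KbK : K * (K * b) <= K * (K * (2 * sigma)) by rewrite ler_wpM2l.
have w1 : w / sigma <= 16 * K ^+ 2.
  rewrite ler_pdivrMr//; move: KbK h3; rewrite expr2; lra.
rewrite /max_error !ge_max; apply/and4P; split.
- have -> : 1 - sh / b = (b - sh) / b by field; rewrite gt_eqF.
  rewrite normrM normfV (gtr0_norm bp) ler_pdivrMr// distrC (le_trans h1)//.
  rewrite ler_wpM2r//; lra.
- rewrite -mulmxBr -/h -rn2 -exprMn -expr_div_n invfM mulrA expr_div_n.
  rewrite ler_pdivrMr ?exprn_gt0//; apply: le_trans h2 _.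
  have : (K * b) ^+ 2 <= (K * (2 * sigma)) ^+ 2.
    by rewrite ler_pXn2r// nnegrE// mulr_ge0// mulr_ge0// ltW.
  have : 0 <= U * K ^+ 2 * sigma ^+ 2 by rewrite mulr_ge0// sqr_ge0.
  rewrite !exprMn; lra.
- rewrite (eq_bigr (fun j => omega j * l2norm (restr (G j) h) / sigma)); last first.
    by move=> j _; rewrite subvecB l2norm_subvec invf_div mulrA [l2norm _ * _]mulrC.
  rewrite -mulr_suml; apply: le_trans w1 _; lra.
- rewrite (eq_bigr (fun j => omega j * l2norm (X *m restr (G j) h) / (rn * sigma))); last first.
    by move=> j _; rewrite subvecB subcols_subvec invf_div mulrA [l2norm _ * _]mulrC.
  rewrite -mulr_suml; apply: (@le_trans _ _ (U * (w / sigma))).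
    rewrite ler_pdivrMr ?mulr_gt0//; apply: le_trans h4 _.
    by rewrite le_eqVlt; apply/orP; left; apply/eqP; field; rewrite gt_eqF.
  have := ler_wpM2l U0 w1; lra.
Qed.

(** With an empty support set the cone condition makes every penalty term zero. A term may vanish
    because its weight does, but the weight dominates the spectral norm of the group up to a
    positive factor, so the image X h_j vanishes even when h_j does not. *)
Lemma max_error_null :
  ((0 < M)%N -> 0 < L) -> group_union G S = finset.set0 ->
  (forall i, i \notin group_union G S -> beta i 0 = 0) -> max_error <= 0.
Proof.
move=> Lpos GS0 supp.
(* [S] may still contain indices of empty groups, so it is replaced by the empty set. *)
have supp0 i : i \notin group_union G finset.set0 -> beta i 0 = 0.
  by rewrite /group_union big_set0 -GS0; exact: supp.
have cone := sqrt_lasso_cone n0 hG omega_ge0 eta01 supp0 sol noise.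
have wj0 j : omega j * l2norm (restr (G j) h) = 0.
  have Sw : \sum_(j | j \notin (finset.set0 : {set 'I_M}))
      omega j * l2norm (restr (G j) h) = 0.
    apply/eqP; rewrite eq_le; apply/andP; split; last first.
      by apply: sumr_ge0 => k _; rewrite mulr_ge0 ?l2norm_ge0.
    have e1 : 0 < 1 - eta by have [_] := andP eta01; rewrite subr_gt0.
    rewrite -(pmulr_rle0 _ e1); apply: le_trans cone _.
    by rewrite big_set0 mulr0.
  have /eqP := Sw; rewrite psumr_eq0; last by move=> k _; rewrite mulr_ge0 ?l2norm_ge0.
  by move=> /allP/(_ j); rewrite mem_index_enum inE /= => /(_ isT)/eqP.
have Xj0 j : l2norm (X *m restr (G j) h) = 0.
  have M0 : (0 < M)%N by apply: leq_ltn_trans (ltn_ord j).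
  have c0 : 0 < Num.sqrt #|G j|%:R + Num.sqrt (2 * L).
    by rewrite ltr_wpDl ?sqrtr_ge0// sqrtr_gt0 mulr_gt0// Lpos.
  apply/eqP; rewrite eq_le l2norm_ge0 andbT; apply: le_trans (group_image j) _.
  rewrite -(pmulr_lle0 _ c0) -(@pmulr_lle0 _ n%:R^-1) ?invr_gt0//.
  apply: (@le_trans _ _ (r j * l2norm (restr (G j) h))).
    by rewrite le_eqVlt; apply/orP; left; apply/eqP; rewrite /r; ring.
  by rewrite -(wj0 j) ler_wpM2r ?l2norm_ge0.
have w0 : w = 0 by rewrite /w /penalty big1.
have Xh0 : X *m h = 0.
  rewrite (sum_restr hG h) mulmx_sumr big1// => j _.
  by apply/eqP; rewrite -l2norm_eq0 Xj0.
have wK : penalty G omega (bh - beta) <= 0 * (l2norm (X *m (bh - beta)) / Num.sqrt n%:R).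
  by rewrite mul0r -/h -/w w0.
have K2 : 2 * 0 ^+ 2 <= 1 :> R by rewrite expr0n/= mulr0.
have [h1 h2 h3] := sqrt_lasso_oracle n0 hG omega_ge0 eta01 supp0 sol noise (lexx 0) K2 wK.
have -> : 0 = (256 + 16 * 0) * 0 ^+ 2 :> R by rewrite expr0n/= mulr0.
apply: max_error_le => //; first by rewrite !mul0r.
by rewrite big1 ?w0 ?mulr0// => j _; rewrite Xj0 mulr0.
Qed.

Section sparse_eigenvalues.
Context (l u kappa : R).
Hypothesis l0 : 0 < l.
Hypothesis u0 : 0 < u.
Hypothesis k0 : 0 < kappa.
Hypothesis Lp : 0 < L.
Hypothesis supp : forall i, i \notin group_union G S -> beta i 0 = 0.
Hypothesis small_groups : forall j, #|G j|%:R + L <= kappa * n%:R / 2.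
Hypothesis sparse : forall (S' : {set 'I_M}) (v : 'cV[R]_p), group_weight G L S' <= kappa * n%:R ->
  (forall i, i \notin group_union G S' -> v i 0 = 0) ->
  l * rn * l2norm v <= l2norm (X *m v) <= u * rn * l2norm v.

Let s := group_weight G L S.
(** The factor 2 / (1 - eta) comes from the cone, and 2 AA u from the upper bound on the weights. *)
Let B := 4 * AA * u / (1 - eta).
Let N j : R := #|G j|%:R + L.

Let e1 : 0 < 1 - eta. Proof. by have [_] := andP eta01; rewrite subr_gt0. Qed.
Let B0 : 0 < B. Proof. by rewrite divr_gt0// !mulr_gt0. Qed.
Let kn0 : 0 < kappa * n%:R. Proof. by rewrite mulr_gt0. Qed.
Let N0 j : 0 <= N j. Proof. by rewrite addr_ge0. Qed.
Let s_ge0 : 0 <= s. Proof. by apply: sumr_ge0 => j _; exact: N0. Qed.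

Let group_sparse j (v : 'cV[R]_p) :
  l * rn * l2norm (restr (G j) v) <= l2norm (X *m restr (G j) v)
    <= u * rn * l2norm (restr (G j) v).
Proof.
apply: (sparse (S' := [set j]%SET)).
  rewrite /group_weight big_set1; have := small_groups j; have := N0 j.
  rewrite /N; move: kn0; lra.
by move=> i; rewrite /group_union big_set1; exact: restr_notin.
Qed.

Let spectral_upper j : spectral_norm (subcols (G j) X) <= u * rn.
Proof.
apply: spectral_norm_le; first exact: ltW (mulr_gt0 u0 rn0).
move=> v; have [v' <- _] := subvec_surj v.
by rewrite subcols_subvec l2norm_subvec; have /andP[] := group_sparse j v'.
Qed.

Let omega_upper j : omega j <= 2 * AA * u / rn * Num.sqrt (N j).
Proof.
have [+ _] := weights j; rewrite ler_pdivrMr// => /le_trans; apply.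
have /andP[_ hc] := sqrt_weight_bounds (ler0n R #|G j|) L0.
rewrite (_ : 2 * AA * u / rn * Num.sqrt (N j) =
  (u * rn) * (2 * Num.sqrt (N j)) / n%:R * AA); last first.
  by rewrite -rn2; field; rewrite gt_eqF.
rewrite ler_wpM2r ?(ltW AA0)// ler_wpM2r ?invr_ge0 ?(ltW nR0)//.
apply: ler_pM; [exact: spectral_norm_ge0|by rewrite addr_ge0 ?sqrtr_ge0| |exact: hc].
exact: spectral_upper.
Qed.

Let omega_lower j :
  Num.sqrt (N j) * l2norm (restr (G j) h) <= rn / l * (omega j * l2norm (restr (G j) h)).
Proof.
have [->|hj] := eqVneq (restr (G j) h) 0; first by rewrite l2norm0 !mulr0.
have hp : 0 < l2norm (restr (G j) h) by rewrite lt0r l2norm_eq0 hj l2norm_ge0.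
rewrite mulrA ler_wpM2r ?(ltW hp)// mulrAC ler_pdivlMr//.
have /andP[hc _] := sqrt_weight_bounds (ler0n R #|G j|) L0.
have hl : l * rn <= spectral_norm (subcols (G j) X).
  rewrite -(ler_pM2r hp); apply: le_trans (group_image j).
  by have /andP[] := group_sparse j h.
have hr : Num.sqrt (N j) * l / rn <= r j.
  rewrite (_ : _ / rn = (l * rn) * Num.sqrt (N j) / n%:R); last first.
    by rewrite -rn2; field; rewrite gt_eqF.
  rewrite ler_wpM2r ?invr_ge0 ?(ltW nR0)//.
  by apply: ler_pM; [exact: ltW (mulr_gt0 l0 rn0)|exact: sqrtr_ge0|exact: hl|exact: hc].
by have := le_trans hr (omega_ge j); rewrite ler_pdivrMr// [_ * rn]mulrC.
Qed.

(** The cone reduces [w] to the groups in [S], where omega_j is of order (N_j / n)^{1/2};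
    Cauchy-Schwarz over [S] then produces the square root of [s], the sum of the N_j. *)
Let penalty_le : w <= B * (Num.sqrt s / rn) * l2norm h.
Proof.
have cone := sqrt_lasso_cone n0 hG omega_ge0 eta01 supp sol noise.
have wE : w = \sum_(j in S) omega j * l2norm (restr (G j) h) +
    \sum_(j | j \notin S) omega j * l2norm (restr (G j) h).
  by rewrite /w /penalty (bigID (mem S)).
have h1 : (1 - eta) * w <= 2 * \sum_(j in S) omega j * l2norm (restr (G j) h).
  by move: cone; rewrite -/h wE; lra.
have h2 : \sum_(j in S) Num.sqrt (N j) * l2norm (restr (G j) h) <= Num.sqrt s * l2norm h.
  pose a : 'cV[R]_M := \col_j (if j \in S then Num.sqrt (N j) else 0).
  pose c : 'cV[R]_M := \col_j (if j \in S then l2norm (restr (G j) h) else 0).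
  have -> : \sum_(j in S) Num.sqrt (N j) * l2norm (restr (G j) h) = dotp a c.
    rewrite /dotp big_mkcond; apply: eq_bigr => j _.
    by rewrite !mxE; case: ifP => //; rewrite mulr0.
  apply: le_trans (cauchy_schwarz a c) _.
  have la : l2norm a = Num.sqrt s.
    rewrite /l2norm; congr Num.sqrt; rewrite /s /group_weight [RHS]big_mkcond.
    apply: eq_bigr => j _; rewrite mxE; case: ifP => _; last by rewrite expr0n.
    by rewrite sqr_sqrtr.
  rewrite la ler_wpM2l ?sqrtr_ge0//.
  apply: le_trans (l2norm_restr_le (group_union G S) h).
  rewrite -(@ler_pXn2r _ 2)// ?nnegrE ?l2norm_ge0// sqr_l2norm_group_union//.
  rewrite sqr_l2norm [leRHS]big_mkcond; apply: ler_sum => j _.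
  by rewrite mxE; case: ifP => // _; rewrite expr0n.
have h3 : \sum_(j in S) omega j * l2norm (restr (G j) h) <=
    2 * AA * u / rn * (Num.sqrt s * l2norm h).
  apply: (@le_trans _ _ (2 * AA * u / rn * \sum_(j in S) Num.sqrt (N j) * l2norm (restr (G j) h))).
    by rewrite mulr_sumr; apply: ler_sum => j _; rewrite mulrA ler_wpM2r ?l2norm_ge0 ?omega_upper.
  by rewrite ler_wpM2l// divr_ge0 ?(ltW rn0)// !mulr_ge0 ?(ltW u0) ?(ltW AA0).
rewrite (_ : B * _ * _ = 2 * (2 * AA * u / rn * (Num.sqrt s * l2norm h)) / (1 - eta)).
  by rewrite ler_pdivlMr// mulrC (le_trans h1)// ler_pM2l.
by rewrite /B; field; rewrite !gt_eqF.
Qed.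

Lemma max_error_bound : s <= kappa * n%:R ->
  s * (16 * (u + l) ^+ 2 * B ^+ 2) <= l ^+ 4 * kappa * n%:R ->
  s * (8 * B ^+ 2) <= l ^+ 2 * n%:R ->
  b <= 2 * sigma ->
  max_error <= (256 + 16 * u) * (4 * B ^+ 2 / l ^+ 2) * s / n%:R.
Proof.
move=> sk sa sb bs.
have hproj (S' : {set 'I_M}) : group_weight G L S' <= kappa * n%:R ->
  l * rn * l2norm (restr (group_union G S') h) <= l2norm (X *m restr (group_union G S') h)
  <= u * rn * l2norm (restr (group_union G S') h).
  by move=> hS'; apply: (sparse hS') => i; exact: restr_notin.
have lrn0 : 0 < l * rn by rewrite mulr_gt0.
have urn0 : 0 < u * rn by rewrite mulr_gt0.
have RL := restricted_lower_bound hG Lp kn0 small_groups (ltW urn0) (ltW lrn0)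
  (fun S' hS' => proj2 (andP (hproj S' hS'))) (fun S' hS' => proj1 (andP (hproj S' hS'))).
set W := weighted_norm _ _ _ _ in RL.
have WE : W <= rn / l * w.
  rewrite /W /weighted_norm /w /penalty mulr_sumr [leLHS]big_mkcond; apply: ler_sum => j _.
  by rewrite inE; exact: omega_lower.
pose q := Num.sqrt s / rn.
have q0 : 0 <= q by rewrite divr_ge0 ?sqrtr_ge0// ltW.
have q2 : q ^+ 2 = s / n%:R by rewrite expr_div_n rn2 sqr_sqrtr.
have WE2 : W <= rn / l * (B * q * l2norm h).
  by apply: le_trans WE _; rewrite ler_wpM2l ?penalty_le//; exact: divr_ge0 (ltW rn0) (ltW l0).
have sk0 : 0 < Num.sqrt (kappa * n%:R) by rewrite sqrtr_gt0.
have ul : 0 < u + l by rewrite addr_gt0.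
(* By [sa] the shelling loss is at most half of the main term, which leaves l/2 in [hx]. *)
have hq : (u + l) * (2 / Num.sqrt (kappa * n%:R) * (rn / l * (B * q))) <= l / 2.
  have skE : Num.sqrt (kappa * n%:R) ^+ 2 = kappa * n%:R by rewrite sqr_sqrtr// ltW.
  rewrite (_ : (u + l) * _ = (u + l) * 2 * rn * B * q / (Num.sqrt (kappa * n%:R) * l)); last first.
    by field; rewrite !gt_eqF.
  rewrite ler_pdivrMr ?mulr_gt0// -(@ler_pXn2r _ 2)// ?nnegrE.
  - have eL : ((u + l) * 2 * rn * B * q) ^+ 2 = s * (16 * (u + l) ^+ 2 * B ^+ 2) / 4.
      transitivity (4 * (u + l) ^+ 2 * B ^+ 2 * rn ^+ 2 * q ^+ 2); first by ring.
      by rewrite rn2 q2; field; rewrite gt_eqF.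
    have eR : (l / 2 * (Num.sqrt (kappa * n%:R) * l)) ^+ 2 = l ^+ 4 * kappa * n%:R / 4.
      by rewrite !exprMn skE; field.
    rewrite eL eR; move: sa; lra.
  - by rewrite mulr_ge0// mulr_ge0 ?(ltW B0)// mulr_ge0 ?(ltW rn0)// mulr_ge0 ?(ltW ul).
  - by rewrite !mulr_ge0 ?(ltW l0) ?(ltW sk0).
have hx : l / 2 * l2norm h <= l2norm (X *m h) / rn.
  rewrite ler_pdivlMr//; apply: le_trans RL.
  have c1 : 0 <= (u * rn + l * rn) * (2 / Num.sqrt (kappa * n%:R)).
    by rewrite mulr_ge0 ?addr_ge0 ?divr_ge0 ?(ltW urn0) ?(ltW lrn0) ?(ltW sk0).
  have := ler_wpM2l c1 WE2.
  have := ler_wpM2r (mulr_ge0 (ltW rn0) (l2norm_ge0 h)) hq.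
  lra.
(* [penalty_le] bounds [w] by B q |h| and [hx] bounds |h| by 2/l times the prediction norm; [sb] is
   the condition 2 K^2 <= 1. *)
pose K := 2 * B / l * q.
have K0 : 0 <= K by rewrite mulr_ge0// divr_ge0 ?(ltW l0)// mulr_ge0 ?(ltW B0).
have K2 : K ^+ 2 = 4 * B ^+ 2 / l ^+ 2 * (s / n%:R).
  by rewrite -q2 /K; field; rewrite gt_eqF.
have wK : w <= K * (l2norm (X *m h) / rn).
  apply: le_trans penalty_le _.
  have Bq : 0 <= B * q * (2 / l) by exact: mulr_ge0 (mulr_ge0 (ltW B0) q0) (ltW (divr_gt0 (ltr0n R 2) l0)).
  rewrite (_ : K * _ = B * q * (2 / l) * (l2norm (X *m h) / rn)); last by rewrite /K; ring.
  have := ler_wpM2l Bq hx; apply: le_trans.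
  by rewrite le_eqVlt; apply/orP; left; apply/eqP; rewrite /q; field; rewrite !gt_eqF.
have K21 : 2 * K ^+ 2 <= 1.
  rewrite K2 (_ : 2 * _ = s * (8 * B ^+ 2) / (l ^+ 2 * n%:R)).
    by rewrite ler_pdivrMr ?mulr_gt0 ?exprn_gt0// mul1r.
  by field; rewrite !gt_eqF.
have [h1 h2 h3] := sqrt_lasso_oracle n0 hG omega_ge0 eta01 supp sol noise K0 K21 wK.
rewrite (_ : (256 + 16 * u) * _ * s / n%:R = (256 + 16 * u) * K ^+ 2); last first.
  by rewrite K2; ring.
apply: max_error_le => //; rewrite ?(ltW u0)//; first by rewrite ler_wpM2l.
rewrite /w /penalty mulr_sumr; apply: ler_sum => j _.
rewrite mulrCA ler_wpM2l//; by have /andP[] := group_sparse j h.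
Qed.

End sparse_eigenvalues.

End deterministic_bounds.

(** Half of the exponent g x absorbs the constant 3 e / (1 - q), which is possible since 1 <= a x
    and [a] is small against g / ln(3 e / (1 - q)). The other half is at least a x, so the
    exponential terms fit into (1 - q) exp(-a x) <= (1 - q) delta. *)
Lemma failure_probability_le (R : realType) (q g a delta x : R) :
  0 <= q < 1 -> 0 < a -> g <= 2^-1 -> 2 * a <= g ->
  2 * a * ln (3 * expR 1 / (1 - q)) <= g -> 1 <= a * x -> expR (- (a * x)) <= delta ->
  q * delta + 2 * expR (1 - g * x) + expR (- x / 2) <= delta.
Proof.
move=> /andP[q0 q1] a0 g1 ag hlam ax hd; set lam := ln _ in hlam.
have q1' : 0 < 1 - q by rewrite subr_gt0.
have e1 : 1 < 3 * expR 1 / (1 - q).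
  rewrite ltr_pdivlMr// mul1r; have : 1 < expR 1 :> R by rewrite expR_gt1.
  lra.
have lam0 : 0 <= lam by rewrite ln_ge0// ltW.
have x0 : 0 < x by rewrite -(pmulr_rgt0 _ a0) (lt_le_trans _ ax).
have lamx : lam <= g * x / 2.
  have := ler_wpM2r (ltW x0) hlam; have := ler_wpM2l lam0 ax; lra.
have h1 : expR (- x / 2) <= expR (1 - g * x).
  rewrite ler_expR; have := ler_wpM2r (ltW x0) g1; lra.
have h2 : 3 * expR 1 <= (1 - q) * expR (g * x / 2).
  have : expR lam <= expR (g * x / 2) by rewrite ler_expR.
  by rewrite /lam lnK ?posrE ?(lt_trans ltr01 e1)// ler_pdivrMr// (mulrC _ (1 - q)).
have h3 : 3 * expR (1 - g * x) <= (1 - q) * expR (- (a * x)).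
  apply: (@le_trans _ _ ((1 - q) * expR (- (g * x / 2)))).
    have -> : 1 - g * x = 1 - g * x / 2 + - (g * x / 2) by lra.
    rewrite expRD mulrA ler_wpM2r ?expR_ge0// expRD mulrA -ler_pdivlMr ?expR_gt0//.
    by rewrite -expRN opprK.
  rewrite ler_wpM2l ?(ltW q1')// ler_expR lerN2.
  have := ler_wpM2r (ltW x0) ag; lra.
have h4 : (1 - q) * expR (- (a * x)) <= (1 - q) * delta by rewrite ler_wpM2l// ltW.
lra.
Qed.

Lemma exists_pos_le5 (R : realType) (a b c d e : R) :
  0 < a -> 0 < b -> 0 < c -> 0 < d -> 0 < e ->
  exists2 x : R, 0 < x & [/\ x <= a, x <= b, x <= c, x <= d & x <= e].
Proof.
move=> a0 b0 c0 d0 e0.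
exists (Num.min a (Num.min b (Num.min c (Num.min d e)))); first by rewrite !lt_min a0 b0 c0 d0.
by split; rewrite !ge_min lexx ?orbT.
Qed.

Lemma probability_ge_setC d (T : measurableType d) (R : realType) (P : probability T R)
    (E : set T) (delta : R) : measurable E -> (P (~` E) <= delta%:E)%E ->
  ((1 - delta)%:E <= P E)%E.
Proof.
move=> mE hE; rewrite -[E]setCK probability_setC; last exact: measurableC.
by rewrite EFinB leeB.
Qed.

Theorem theorem7 (R : realType) (c_ cc A_ AA v0 : R)
  (hc_ : 0 < c_) (hcc : c_ <= cc) (hA_ : 1 < A_) (hAA : A_ < AA) (hv0 : 1 < v0) :
  exists a_ C : R, [/\ 0 < a_, 0 < C &
  forall (n p M : nat) (delta sigma a0 : R)
    (G : 'I_M -> {set 'I_p}) (S : {set 'I_M})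
    (beta : 'cV[R]_p) (Sigma : 'M[R]_p)
    (d : measure_display) (T : measurableType d) (P : probability T R)
    (X : {RV P >-> 'M[R]_(n, p)}) (y : {RV P >-> 'cV[R]_n})
    (omega : T -> 'I_M -> R),
  let eps w := y w - X w *m beta in
  let sigma_star w := l2norm (eps w) / Num.sqrt n%:R in
  let L := ln (M%:R / delta) in
  let s := #|group_union G S|%:R + #|S|%:R * L in
  (0 < n)%N -> 0 < delta -> delta < 1 -> 0 < sigma ->
  is_grouping G ->
  iid_rows P X ->
  (forall i j, 'E_P[fun w => (X w i j)%R] = 0)%E ->
  (forall j k, 'E_P[fun w => ((n%:R^-1 *: ((X w)^T *m X w)) j k)%R]
               = (Sigma j k)%:E)%E ->
  (forall a, eigenvalue Sigma a -> c_ <= a <= cc) ->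
  sub_gaussian_rows P v0 Sigma X ->
  isotropic_gaussian P sigma eps ->
  independent_pair P X eps ->
  (forall w j,
     let r := spectral_norm (subcols (G j) (X w)) *
              (Num.sqrt #|G j|%:R + Num.sqrt (2 * L)) / n%:R in
     omega w j / AA <= r /\ r <= omega w j / A_) ->
  [set i | beta i 0 != 0]%SET \subset group_union G S ->
  (\big[Num.max/0]_(j < M) (#|G j|%:R + L)) * (0 < #|S|)%N%:R + s <= a0 * n%:R ->
  a0 <= a_ ->
  exists E : set T, [/\ measurable E, ((1 - delta)%:E <= P E)%E &
    forall w, E w -> forall (bh : 'cV[R]_p) (sh : R),
      scaled_group_lasso_solution G (omega w) (X w) (y w) bh sh ->
      Num.max `|1 - sh / sigma_star w|
     (Num.max (l2norm (X w *m bh - X w *m beta) ^+ 2 / (n%:R * sigma ^+ 2))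
     (Num.max (\sum_(j < M) l2norm (subvec (G j) bh - subvec (G j) beta)
                            / (sigma / omega w j))
              (\sum_(j < M) l2norm (subcols (G j) (X w) *m
                                    (subvec (G j) bh - subvec (G j) beta))
                            / (Num.sqrt n%:R * sigma / omega w j))))
      <= C * s / n%:R]].
Proof.
have cc0 : 0 < cc := lt_le_trans hc_ hcc.
have v00 : 0 < v0 := lt_trans ltr01 hv0.
have A0 : 0 < A_ := lt_trans ltr01 hA_.
have AA0 : 0 < AA := lt_trans A0 hAA.
(* [A1 > 1] gives q < 1, [A1 < A2] leaves room for integer directions, [A2 < A_] gives eta < 1. *)
pose A1 := 1 + (A_ - 1) / 3; pose A2 := 1 + 2 * (A_ - 1) / 3.
have A11 : 1 < A1 by rewrite /A1; lra.
have A12 : A1 < A2 by rewrite /A1 /A2; lra.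
have A20 : 0 < A2 by exact: lt_trans ltr01 (lt_trans A11 A12).
pose eta := A2 / A_.
have eta01 : 0 <= eta < 1.
  by rewrite divr_ge0 ?(ltW A20) ?(ltW A0)//= ltr_pdivrMr// mul1r /A2; lra.
pose q := expR (- (A1 - 1) ^+ 2 / 2).
have q01 : 0 <= q < 1.
  rewrite expR_ge0 expR_lt1 mulNr oppr_lt0 divr_gt0// exprn_gt0// subr_gt0//.
pose a1 := Num.sqrt (c_ / 2); pose b1 := Num.sqrt (2 * v0 * cc).
have a10 : 0 < a1 by rewrite sqrtr_gt0 divr_gt0.
have b10 : 0 < b1 by rewrite sqrtr_gt0 !mulr_gt0.
have a1b1 : a1 <= b1.
  rewrite ler_sqrt; last by rewrite !mulr_ge0 ?(ltW v00) ?(ltW cc0).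
  have : 1 * c_ <= v0 * cc by rewrite ler_pM ?(ltW hc_)// ltW.
  lra.
(* The mesh of the net: the loss 2 b1 th = a1 / 8 is a quarter of the main term a1 / 2 in the sparse
   lower bound. *)
pose th := a1 / (16 * b1).
have th0 : 0 < th by rewrite divr_gt0 ?mulr_gt0.
have th2 : th <= 2^-1 by rewrite ler_pdivrMr ?mulr_gt0//; lra.
(* Half of the Chernoff rate. [kappa] below is tuned so that the net has log-cardinality at most g n
   + 1, and the rate g is left for the probability. *)
pose g := (256 * v0 ^+ 2)^-1.
have g0 : 0 < g by rewrite invr_gt0 mulr_gt0 ?ltr0n ?exprn_gt0.
have g1 : g <= 2^-1.
  rewrite lef_pV2 ?posrE ?mulr_gt0 ?ltr0n ?exprn_gt0//.
  have : 1 <= v0 ^+ 2 by rewrite exprn_ege1// ltW.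
  lra.
pose kappa := g / ((th ^+ 2)^-1 + 2).
have t0 : 0 < (th ^+ 2)^-1 by rewrite invr_gt0 exprn_gt0.
have k0 : 0 < kappa by rewrite divr_gt0// addr_gt0.
have kE : kappa * (th ^+ 2)^-1 + 2 * kappa = g.
  have : kappa * ((th ^+ 2)^-1 + 2) = g by rewrite /kappa mulfVK// gt_eqF// addr_gt0.
  lra.
have gE : (128 * v0 ^+ 2)^-1 = 2 * g by rewrite /g; field; rewrite gt_eqF.
have thE : 2 * b1 * th = a1 / 8 by rewrite /th; field; rewrite gt_eqF.
clearbody kappa g th.
pose l := a1 / 4; pose u := 2 * b1.
have l0 : 0 < l by rewrite divr_gt0.
have u0 : 0 < u by rewrite mulr_gt0.
pose B := 4 * AA * u / (1 - eta).
have B0 : 0 < B.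
  by rewrite divr_gt0 ?mulr_gt0// subr_gt0; case/andP: eta01.
pose lam := ln (3 * expR 1 / (1 - q)).
have [_ q1] := andP q01.
have lam0 : 0 < lam.
  rewrite ln_gt0// ltr_pdivlMr ?subr_gt0// mul1r.
  have : 1 < expR 1 :> R by rewrite expR_gt1.
  have [] := andP q01; lra.
have ul0 : 0 < 16 * (u + l) ^+ 2 * B ^+ 2.
  exact: mulr_gt0 (mulr_gt0 (ltr0n R 16) (exprn_gt0 2 (addr_gt0 u0 l0))) (exprn_gt0 2 B0).
(* The first two bounds serve [failure_probability_le], the third keeps every group below half of
   the block budget kappa n, the fourth absorbs the shelling loss and the fifth gives 2 K^2 <= 1. *)
have [a_ a_0 [ha1 ha2 ha3 ha4 ha5]] :=
  exists_pos_le5 (a := g / 2) (b := g / (2 * lam)) (c := kappa / 2)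
    (d := l ^+ 4 * kappa / (16 * (u + l) ^+ 2 * B ^+ 2)) (e := l ^+ 2 / (8 * B ^+ 2))
    (divr_gt0 g0 (ltr0n R 2)) (divr_gt0 g0 (mulr_gt0 (ltr0n R 2) lam0)) (divr_gt0 k0 (ltr0n R 2))
    (divr_gt0 (mulr_gt0 (exprn_gt0 4 l0) k0) ul0)
    (divr_gt0 (exprn_gt0 2 l0) (mulr_gt0 (ltr0n R 8) (exprn_gt0 2 B0))).
have B8 : 0 < 8 * B ^+ 2 := mulr_gt0 (ltr0n R 8) (exprn_gt0 2 B0).
have {}ha1 : 2 * a_ <= g by rewrite mulrC -ler_pdivlMr.
have {}ha2 : 2 * a_ * lam <= g.
  by move: ha2; rewrite ler_pdivlMr ?mulr_gt0// mulrCA mulrA.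
move: ha4 ha5; rewrite (ler_pdivlMr _ _ ul0) (ler_pdivlMr _ _ B8) => ha4 ha5.
have ll : l <= a1 / 2 - a1 / 8 by rewrite /l; lra.
pose C := (256 + 16 * u) * (4 * B ^+ 2 / l ^+ 2).
have C0 : 0 < C.
  apply: mulr_gt0; first exact: addr_gt0 (ltr0n R 256) (mulr_gt0 (ltr0n R 16) u0).
  exact: divr_gt0 (mulr_gt0 (ltr0n R 4) (exprn_gt0 2 B0)) (exprn_gt0 2 l0).
exists a_, C; split => // n p M delta sigma a0 G S beta Sigma d T P X y omega eps sigma_star L s.
move=> n0 d0 d1 s0 hG iid _ cov eig subG gauss ind weights supp size a0a.
have nR0 : 0 < n%:R :> R by rewrite ltr0n.
have mX : measurable_fun setT X by exact: measurable_funPT.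
have me : measurable_fun setT eps.
  apply: measurable_matrix => i j; rewrite (ord1 j).
  rewrite (_ : (fun w => _) = (fun w => y w i 0 - (X w *m beta) i 0)); last first.
    by apply/funext => w; rewrite /eps !mxE.
  apply: measurable_funB; last exact: measurable_mulmx_entry.
  exact: measurableT_comp (measurable_entry i 0) (measurable_funPT y).
have Lpos : (0 < M)%N -> 0 < L.
  move=> M0; rewrite ln_gt0// ltr_pdivlMr// mul1r (lt_le_trans d1)//.
  by rewrite ler1n.
have L0 : 0 <= L.
  (* For M = 0 the default value of [ln] at 0 makes [L] zero. *)
  have [M0|/Lpos/ltW//] := posnP M.
  by rewrite /L M0 mul0r ln0.
have supp' i : i \notin group_union G S -> beta i 0 = 0.
  move=> iS; apply/eqP; apply: contraNT iS => bi.
  by apply: (fintype.subsetP supp); rewrite inE.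
have d01 : 0 < delta < 1 by rewrite d0.
have [E0 [mE0 PE0 hE0]] := noise_event G n0 s0 d01 A11 A12 mX me gauss ind.
have noise w : E0 w -> forall j, l2norm ((subcols (G j) (X w))^T *m (y w - X w *m beta))
    <= eta * Num.sqrt n%:R * omega w j * l2norm (y w - X w *m beta).
  move=> Ew j; have := hE0 w Ew j; rewrite -/L -/(eps w).
  have [_] := weights w j; set c := _ + _ => hw.
  have rn0 : 0 < Num.sqrt n%:R :> R by rewrite sqrtr_gt0.
  have rn2 : Num.sqrt n%:R ^+ 2 = n%:R :> R by rewrite sqr_sqrtr.
  rewrite mulrC -ler_pdivlMr// => /le_trans; apply.
  rewrite ler_pdivrMr//.
  have h : 0 <= A2 * n%:R * l2norm (eps w) by rewrite !mulr_ge0 ?l2norm_ge0 ?(ltW A20).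
  have := ler_wpM2l h hw.
  rewrite (_ : A2 * _ * _ * (_ / _) = A2 * c * spectral_norm (subcols (G j) (X w)) * l2norm (eps w)).
    move/le_trans; apply.
    rewrite le_eqVlt; apply/orP; left; apply/eqP.
    transitivity (eta * Num.sqrt n%:R ^+ 2 * omega w j * l2norm (eps w)); last by ring.
    by rewrite rn2 /eta; ring.
  by field; rewrite gt_eqF.
have sE : s = group_weight G L S.
  by rewrite /s /group_weight (card_group_union R hG) big_split/= sumr_const -[L *+ _]mulr_natl.
have s_ge0 : 0 <= s by rewrite addr_ge0 ?mulr_ge0.
have [GS0|GS0] := eqVneq (group_union G S) finset.set0.
  exists E0; split => //.
    apply: probability_ge_setC => //; apply: le_trans PE0 _.
    by rewrite lee_fin ger_pMl// ltW.
  move=> w Ew bh sh sol; apply: (@le_trans _ _ 0).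
    exact: (max_error_null n0 s0 hA_ hG eta01 sol (weights w) (noise w Ew) Lpos GS0 supp').
  by rewrite divr_ge0 ?(ltW nR0)// mulr_ge0// ltW.
have GS1 : 1 <= #|group_union G S|%:R :> R by rewrite ler1n card_gt0.
have S0 : S != finset.set0.
  by apply: contraNneq GS0 => ->; rewrite /group_union big_set0.
have [jS _] := finset.set0Pn _ S0.
have M0 : (0 < M)%N := leq_ltn_trans (leq0n _) (ltn_ord jS).
have Lp := Lpos M0.
have an : a0 * n%:R <= a_ * n%:R by rewrite ler_pM2r.
have szs : (\big[Num.max/0]_(j < M) (#|G j|%:R + L)) + s <= a_ * n%:R.
  by move: size; rewrite card_gt0 S0 mulr1 => /le_trans; apply.
have NB j : #|G j|%:R + L <= a_ * n%:R.
  apply: le_trans szs; rewrite ler_wpDr//.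
  exact: (le_bigmax _ (fun j => #|G j|%:R + L)).
have sB : s <= a_ * n%:R.
  apply: le_trans szs; rewrite lerDr.
  by apply: le_trans (le_bigmax _ (fun j => #|G j|%:R + L) jS); rewrite addr_ge0.
have an1 : 1 <= a_ * n%:R.
  by apply: le_trans sB; rewrite (le_trans GS1)// lerDl mulr_ge0.
have MR0 : 0 < M%:R :> R by rewrite ltr0n.
have eL : expR (- L) = delta / M%:R.
  by rewrite expRN lnK ?posrE ?divr_gt0// invf_div.
have ML : M%:R * expR (- L) <= 1 by rewrite eL mulrC mulfVK ?gt_eqF// ltW.
have dl : expR (- (a_ * n%:R)) <= delta.
  apply: (@le_trans _ _ (expR (- L))).
    rewrite ler_expR lerN2; apply: le_trans (NB jS); rewrite lerDr//.
  by rewrite eL ler_pdivrMr// ler_peMr ?(ltW d0)// ler1n.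
have kn0 : 0 < kappa * n%:R by rewrite mulr_gt0.
have [E1 [mE1 PE1 hE1]] :=
  sparse_event n0 hv0 hc_ mX iid cov eig subG hG L0 ML kn0 th0 th2.
pose E2 := [set w | l2norm (eps w) ^+ 2 <= 4 * n%:R * sigma ^+ 2].
have m2 : measurable_fun setT (fun w => l2norm (eps w) ^+ 2).
  by apply: measurable_funX; apply: measurable_l2norm => i; exact: measurable_coord.
have mE2 : measurable E2 by apply: measurable_set_le => //; exact: measurable_cst.
have PE2 : (P (~` E2) <= (expR (- n%:R / 2))%:E)%E.
  apply: le_trans (gaussian_norm_tail s0 me gauss).
  rewrite le_eqVlt; apply/orP; left; apply/eqP; congr (P _).
  by apply/seteqP; split => w /=; rewrite ltNge => /negP.
exists (E0 `&` (E1 `&` E2)); split.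
- by apply: measurableI => //; exact: measurableI.
- apply: probability_ge_setC; first by apply: measurableI => //; exact: measurableI.
  rewrite setCI setCI.
  have mU : measurable (~` E1 `|` ~` E2) by apply: measurableU; exact: measurableC.
  apply: (@le_trans _ _ (P (~` E0) + (P (~` E1) + P (~` E2)))%E).
    apply: le_trans (measureU2 P (measurableC mE0) mU) _; rewrite leeD2l//.
    exact: measureU2 (measurableC mE1) (measurableC mE2).
  apply: le_trans (leeD PE0 (leeD PE1 PE2)) _.
  rewrite -!EFinD lee_fin.
  have hx : kappa * n%:R / th ^+ 2 + 2 * (kappa * n%:R) + 1 - n%:R / (128 * v0 ^+ 2) =
      1 - g * n%:R.
    rewrite gE.
    transitivity ((kappa / th ^+ 2 + 2 * kappa) * n%:R + 1 - 2 * g * n%:R); first by ring.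
    by rewrite kE; ring.
  rewrite hx addrA; apply: (failure_probability_le q01 a_0 g1 _ _ an1 dl).
    exact: ha1.
  exact: ha2.
move=> w [Ew0 [Ew1 Ew2]] bh sh sol.
have small j : #|G j|%:R + L <= kappa * n%:R / 2.
  by apply: le_trans (NB j) _; rewrite mulrAC ler_pM2r.
have sparse (S' : {set 'I_M}) (v : 'cV[R]_p) : group_weight G L S' <= kappa * n%:R ->
    (forall i, i \notin group_union G S' -> v i 0 = 0) ->
    l * Num.sqrt n%:R * l2norm v <= l2norm (X w *m v) <= u * Num.sqrt n%:R * l2norm v.
  move=> hS' hv; have /andP[h1 h2] := hE1 w Ew1 S' v hS' hv.
  rewrite -/a1 -/b1 in h1 h2; apply/andP; split; last by rewrite /u -(mulrA 2).
  apply: le_trans h1; rewrite ler_wpM2r ?l2norm_ge0//.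
  rewrite (_ : _ - _ = (a1 / 2 - 2 * b1 * th) * Num.sqrt n%:R); last by ring.
  rewrite thE.
  by rewrite ler_wpM2r ?sqrtr_ge0.
rewrite -[C * s / _]/(C * s / n%:R) sE.
apply: (max_error_bound n0 s0 hA_ hAA L0 hG eta01 sol (weights w) (noise w Ew0) l0 u0 k0 Lp supp' small sparse); rewrite -?sE.
- apply: le_trans sB _; apply: (@le_trans _ _ (kappa / 2 * n%:R)).
    by rewrite ler_pM2r.
  by rewrite ler_pM2r// ler_pdivrMr// ler_peMr ?(ltW k0)// ler1n.
- apply: le_trans (ler_wpM2r (ltW ul0) sB) _.
  by rewrite mulrAC ler_pM2r.
- apply: le_trans (ler_wpM2r (ltW B8) sB) _.
  by rewrite mulrAC ler_pM2r.
- rewrite ler_pdivrMr ?sqrtr_gt0// -(@ler_pXn2r _ 2)// ?nnegrE ?l2norm_ge0//.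
    apply: le_trans Ew2 _; rewrite !exprMn sqr_sqrtr; last exact: ltW.
    by rewrite le_eqVlt; apply/orP; left; apply/eqP; ring.
  by rewrite !mulr_ge0 ?sqrtr_ge0 ?(ltW s0).
Qed.
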